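(* Let $m\ge 1$ be an integer and let $L(s)=\prod_{p}\prod_{j=1}^{m}(1-c_j(p)p^{-s})^{-1}$ ($s=\sigma+it$, $\sigma>1$), where $|c_j(p)|\le 1$. Let $N\ge 16$ be an integer and $0<\delta<7/2$. Assume: (i) $L(s)$ continues analytically to a holomorphic function on $\sigma\ge\sigma_L$ for some $1/2\le\sigma_L<1$ with $\delta<7(1-\sigma_L)$; (ii) $L(s)$ has no zero in $D_{\delta,N}=\{\sigma\ge 1\}\cup\{1-\delta/7\le\sigma<1,\ |t|\le 2(\log N)^3\}$; (iii) $L(s)\ll N^{\gamma_1}(1+|t|)^{\gamma_2}$ for $\sigma_L<\sigma<4$, with fixed constants $\gamma_1,\gamma_2>0$. Let $1-\delta/28<\alpha<2-\delta/7$ and $(\log N)^{14/\delta}\le y\le N^{2\pi/5}$. Then \[ \log L(\alpha)=\sum_{p\le y}\frac{d_p(1)}{p^{\alpha}}+C(\alpha)+O\bigg(\frac{y^{1-\alpha}}{(2-\alpha)^2\log y}+\frac{(\log N)^2}{(\log\log N)(\log N)^{14/\delta}}+\frac{y^{1+\delta/14}(\log N)^{\delta/14+3/2}}{\delta^2N^{\pi/2}}+\frac{y^{1-\delta/14-\alpha}\log N}{\delta^3\log y}\bigg). \] In particular, \[ \log L(1)=\sum_{p\le y}\frac{d_p(1)}{p}+C(1)+O\bigg(\frac{1}{\log y}+\frac{(\log N)^2}{(\log\log N)(\log N)^{14/\delta}}+\frac{y^{1+\delta/14}(\log N)^{\delta/14+3/2}}{\delta^2N^{\pi/2}}+\frac{\log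 N}{\delta^3y^{\delta/14}\log y}\bigg). \]
   Context: $p$ runs over primes. $d_p(\ell)=\sum_{j=1}^m c_j(p)^\ell$, and for $\alpha>1/2$, $C(\alpha)=\sum_p\sum_{\ell=2}^\infty \frac{d_p(\ell)}{\ell p^{\ell\alpha}}$. $\log L(s)$ denotes the branch of the logarithm holomorphic on the zero-free simply connected region $D_{\delta,N}$ and equal to $\sum_p\sum_{\ell\ge1}\frac{d_p(\ell)}{\ell p^{\ell s}}$ for $\sigma>1$. Implied constants depend only on $m,\gamma_1,\gamma_2$. *)

(* Defs.v *)
(* Stdlib real numbers with Coquelicot. *)
From Stdlib Require Import Reals ZArith Znumtheory.
From Coquelicot Require Import Coquelicot.

Open Scope R_scope.

Definition Cexp (z : C) : C :=
  (exp (Re z) * cos (Im z), exp (Re z) * sin (Im z)).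

(* n ^ s for a positive integer n, with the real logarithm of n. *)
Definition natCpow (n : nat) (s : C) : C := Cexp (s * RtoC (ln (INR n)))%C.

(* Coquelicot's [Series] is real-valued; this is the sum of a convergent complex
   series, taken componentwise.  It is only used on absolutely convergent series. *)
Definition CSeries (a : nat -> C) : C :=
  (Series (fun n => Re (a n)), Series (fun n => Im (a n))).

(* The product f 1 * ... * f n. *)
Fixpoint Cprod (f : nat -> C) (n : nat) : C :=
  match n with
  | O => RtoC 1
  | S k => (Cprod f k * f (S k))%C
  end.

Definition Csum (f : nat -> C) (a b : nat) : C :=
  sum_n_m (G := C_AbelianMonoid) f a b.

Definition is_prime (p : nat) : Prop := prime (Z.of_nat p).

(* Extensions by 0 and by 1 from the primes to all integers, for sums and
   products over primes in increasing order. *)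
Definition at_primes0 (f : nat -> C) (p : nat) : C :=
  if prime_dec (Z.of_nat p) then f p else RtoC 0.

Definition at_primes1 (f : nat -> C) (p : nat) : C :=
  if prime_dec (Z.of_nat p) then f p else RtoC 1.

Definition sum_primes_le (y : R) (f : nat -> C) : C :=
  Csum (at_primes0 f) 0 (Z.to_nat (Int_part y)).

Definition series_primes (f : nat -> C) : C := CSeries (at_primes0 f).

(* In what follows [c j p] is the coefficient c_j(p), 1 <= j <= m. *)

Definition euler_factor (m : nat) (c : nat -> nat -> C) (s : C) (p : nat) : C :=
  Cprod (fun j => / (RtoC 1 - c j p * natCpow p (- s)))%C m.

Definition is_euler_product (m : nat) (c : nat -> nat -> C) (s l : C) : Prop :=
  filterlim (fun x : nat => Cprod (at_primes1 (euler_factor m c s)) x)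
    eventually (locally (T := C_UniformSpace) l).

Definition d_coef (m : nat) (c : nat -> nat -> C) (p l : nat) : C :=
  Csum (fun j => Cpow (c j p) l) 1 m.

(* d_p(l) / (l p^(l s)) *)
Definition log_term (m : nat) (c : nat -> nat -> C) (s : C) (p l : nat) : C :=
  (d_coef m c p l / (RtoC (INR l) * natCpow p (RtoC (INR l) * s)))%C.

Definition log_series (m : nat) (c : nat -> nat -> C) (s : C) : C :=
  series_primes (fun p => CSeries (fun k => log_term m c s p (k + 1))).

Definition C_const (m : nat) (c : nat -> nat -> C) (alpha : R) : C :=
  series_primes
    (fun p => CSeries (fun k => log_term m c (RtoC alpha) p (k + 2))).

(* For a set A that need not be open: complex differentiable on some open
   neighbourhood of A. *)
Definition holomorphic_on (A : C -> Prop) (f : C -> C) : Prop :=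
  exists U : C -> Prop,
    open (T := C_UniformSpace) U /\
    (forall z, A z -> U z) /\
    (forall z, U z -> ex_derive (K := C_AbsRing) (V := C_NormedModule) f z).

Definition half_plane (sigma0 : R) (s : C) : Prop := sigma0 <= Re s.

Definition D_region (delta : R) (N : nat) (s : C) : Prop :=
  1 <= Re s \/
  (1 - delta / 7 <= Re s < 1 /\ Rabs (Im s) <= 2 * (ln (INR N)) ^ 3).

(* [logL] is the branch of log L on the region A that is given by the Dirichlet
   series for Re s > 1. *)
Definition is_log_branch (m : nat) (c : nat -> nat -> C) (A : C -> Prop)
    (L logL : C -> C) : Prop :=
  holomorphic_on A logL /\
  (forall s, A s -> Cexp (logL s) = L s) /\
  (forall s, 1 < Re s -> logL s = log_series m c s).

(* Main.v *)
(* Newman's contour argument. Put Lam = ln N and, with w the shift from alpha,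
   a = 1 - alpha. From log L one removes a finite (hence entire) truncation C_X of
   the prime powers, and compares H(w) = (log L - C_X)(alpha + w) with the sum
   S(w) of d_p(1) / p^(alpha + w) over p <= y, by integrating
     (H - S)(w) y^w (1 + (w - a)^2 / Lam^2) / w
   over the boundary of [a - delta/12, a + Lam] x [-Lam, Lam].
   - On Re w > a, H - S is a tail of the Dirichlet series, of size at most
     m y^(-u) / u at distance u from Re w = a; the factor y^w u cancels this, so
     this part is O(y^a / Lam) = O(y^a / ln y). Bounding the sum over primes by
     the one over integers suffices.
   - On Re w < a the part of S is moved to Re w = a - Lam, where S is small in
     the same way.
   - On Re w < a the part of H uses |log L| << Lam / delta, which follows from (iii)
     by the Borel-Caratheodory inequality; since the line lies delta/84 to the left
     of 1 - delta/14, it gains y^(-delta/84). *)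
Require Import Defs.
From Stdlib Require Import Reals ZArith Znumtheory Lra Lia List.
From Coquelicot Require Import Coquelicot.
Open Scope R_scope.

(** * Complex continuity and differentiability *)

(** The value 2 pi i of the integral of 1 / (w - z0) is never computed: Cauchy's formula keeps this
    integral as a factor, and for upper bounds it suffices that its modulus is not small. Cauchy's
    theorem is proved with finitely many points of mere continuity allowed, so difference quotients
    can be integrated without removing singularities. The error of the truncation C_X gets
    multiplied by u y^u, up to Lam y^Lam, so X depends on N and y; this is harmless because the
    bound for C_X is uniform in X. Four abscissae are nested: 1 - delta/7 bounds the zero-free
    region, the squares of Borel-Caratheodory reach 1 - delta/8, log L is bounded from 1 - delta/12
    on, where the contour runs, and 1 - delta/14 gives the exponent claimed. The condition alpha > 1
    - delta/28 keeps the pole w = 0 at distance more than delta/21 from the left side. Of the three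
    factors 1/delta in the last error term, one comes from Borel-Caratheodory and two from trading
    exp (- delta Y / 84) for the logarithm of the vertical integral and for 1 / Y. *)

Definition ccont {U : UniformSpace} (f : U -> C) (x : U) : Prop :=
  continuous (U := R_UniformSpace) (fun w => Re (f w)) x /\
  continuous (U := R_UniformSpace) (fun w => Im (f w)) x.

Lemma ccont_ext {U : UniformSpace} (f g : U -> C) (x : U) :
  (forall w, f w = g w) -> ccont f x -> ccont g x.
Proof.
  intros H [H1 H2]; split.
  - apply continuous_ext with (fun w => Re (f w)); [intros w; now rewrite H | exact H1].
  - apply continuous_ext with (fun w => Im (f w)); [intros w; now rewrite H | exact H2].
Qed.

Lemma ccont_const {U : UniformSpace} (a : C) (x : U) : ccont (fun _ => a) x.
Proof. split; apply continuous_const. Qed.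

Lemma ccont_id (z : C) : ccont (U := C_UniformSpace) (fun w => w) z.
Proof.
  split.
  - destruct z as [x y]; exact (continuous_fst (U := R_UniformSpace) (V := R_UniformSpace) x y).
  - destruct z as [x y]; exact (continuous_snd (U := R_UniformSpace) (V := R_UniformSpace) x y).
Qed.

Lemma ccont_opp {U : UniformSpace} (f : U -> C) (x : U) :
  ccont f x -> ccont (fun w => - f w)%C x.
Proof.
  intros [H1 H2]; split; cbn.
  - exact (continuous_opp (V := R_NormedModule) _ _ H1).
  - exact (continuous_opp (V := R_NormedModule) _ _ H2).
Qed.

Lemma ccont_plus {U : UniformSpace} (f g : U -> C) (x : U) :
  ccont f x -> ccont g x -> ccont (fun w => f w + g w)%C x.
Proof.
  intros [H1 H2] [K1 K2]; split; cbn.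
  - exact (continuous_plus (V := R_NormedModule) _ _ _ H1 K1).
  - exact (continuous_plus (V := R_NormedModule) _ _ _ H2 K2).
Qed.

Lemma ccont_minus {U : UniformSpace} (f g : U -> C) (x : U) :
  ccont f x -> ccont g x -> ccont (fun w => f w - g w)%C x.
Proof. intros H K; apply ccont_plus; [exact H | now apply ccont_opp]. Qed.

Lemma ccont_mult {U : UniformSpace} (f g : U -> C) (x : U) :
  ccont f x -> ccont g x -> ccont (fun w => f w * g w)%C x.
Proof.
  intros [H1 H2] [K1 K2]; split; cbn.
  - apply (continuous_minus (V := R_NormedModule)).
    + exact (continuous_mult (K := R_AbsRing) _ _ _ H1 K1).
    + exact (continuous_mult (K := R_AbsRing) _ _ _ H2 K2).
  - apply (continuous_plus (V := R_NormedModule)).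
    + exact (continuous_mult (K := R_AbsRing) _ _ _ H1 K2).
    + exact (continuous_mult (K := R_AbsRing) _ _ _ H2 K1).
Qed.

Lemma continuous_Rdiv {U : UniformSpace} (f g : U -> R) (x : U) :
  continuous (U := R_UniformSpace) f x -> continuous (U := R_UniformSpace) g x ->
  g x <> 0 -> continuous (U := R_UniformSpace) (fun w => f w / g w) x.
Proof.
  intros H K Hg. apply (continuous_mult (K := R_AbsRing) f (fun w => / g w)); [exact H|].
  apply (continuous_comp g Rinv); [exact K|].
  apply continuity_pt_filterlim, continuity_pt_inv; [|exact Hg].
  apply derivable_continuous_pt, derivable_pt_id.
Qed.

Lemma Cnorm2_neq0 (z : C) : z <> 0%C -> fst z ^ 2 + snd z ^ 2 <> 0.
Proof.
  intros H E. apply H. destruct z as [u v]; simpl in *.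
  apply injective_projections; simpl; nra.
Qed.

Lemma ccont_inv {U : UniformSpace} (f : U -> C) (x : U) :
  f x <> 0%C -> ccont f x -> ccont (fun w => / f w)%C x.
Proof.
  intros Hf [H1 H2].
  assert (HD : continuous (U := R_UniformSpace) (fun w => fst (f w) ^ 2 + snd (f w) ^ 2) x).
  { apply (continuous_plus (V := R_NormedModule)); simpl.
    - apply (continuous_mult (K := R_AbsRing)); [exact H1|].
      apply (continuous_mult (K := R_AbsRing)); [exact H1 | apply continuous_const].
    - apply (continuous_mult (K := R_AbsRing)); [exact H2|].
      apply (continuous_mult (K := R_AbsRing)); [exact H2 | apply continuous_const]. }
  pose proof (Cnorm2_neq0 _ Hf) as HN.
  split.
  - exact (continuous_Rdiv _ _ _ H1 HD HN).
  - exact (continuous_Rdiv _ _ _ (continuous_opp (V := R_NormedModule) _ _ H2) HD HN).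
Qed.

Lemma ccont_pow {U : UniformSpace} (f : U -> C) (x : U) (n : nat) :
  ccont f x -> ccont (fun w => Cpow (f w) n) x.
Proof.
  intros H; induction n as [|n IH]; simpl; [apply ccont_const | now apply ccont_mult].
Qed.

Lemma ccont_comp {U V : UniformSpace} (g : U -> V) (f : V -> C) (x : U) :
  continuous g x -> ccont f (g x) -> ccont (fun w => f (g w)) x.
Proof.
  intros Hg [H1 H2]; split.
  - exact (continuous_comp g (fun w => Re (f w)) x Hg H1).
  - exact (continuous_comp g (fun w => Im (f w)) x Hg H2).
Qed.

Lemma continuous_pairR {U : UniformSpace} (f g : U -> R) (x : U) :
  continuous (U := R_UniformSpace) f x -> continuous (U := R_UniformSpace) g x ->
  continuous (U := C_UniformSpace) (fun w => (f w, g w)) x.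
Proof.
  intros Hf Hg P [e He].
  specialize (Hf (fun u => ball (f x) e u) (locally_ball _ e)).
  specialize (Hg (fun u => ball (g x) e u) (locally_ball _ e)).
  unfold filtermap in *. simpl in *.
  generalize (filter_and _ _ Hf Hg). apply filter_imp.
  intros w [Hw1 Hw2]. apply He. now split.
Qed.

Lemma ccont_continuous {U : UniformSpace} (f : U -> C) (x : U) :
  ccont f x -> continuous (U := C_UniformSpace) f x.
Proof.
  intros [H1 H2].
  apply continuous_ext with (fun w => (Re (f w), Im (f w))).
  - intros w; now destruct (f w).
  - now apply continuous_pairR.
Qed.

Lemma im_le_Cmod (z : C) : Rabs (Im z) <= Cmod z.
Proof. apply Rle_trans with (2 := Rmax_Cmod z), Rmax_r. Qed.

(** Balls of [C_UniformSpace] are boxes in the two components, in accordance with [ccont]; passing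
    to discs costs a factor [sqrt 2 < 2], whence the halved radii. *)
Lemma ccont_eps (f : C -> C) (z : C) :
  ccont (U := C_UniformSpace) f z <->
  (forall eps, 0 < eps -> exists eta, 0 < eta /\
     forall w, Cmod (w - z) < eta -> Cmod (f w - f z) < eps).
Proof.
  split.
  - intros H eps Heps. apply ccont_continuous in H.
    assert (He2 : 0 < eps / 2) by lra.
    destruct (H _ (locally_ball (f z) (mkposreal _ He2))) as [eta Heta].
    exists eta. split; [apply cond_pos|].
    intros w Hw.
    assert (B : ball (M := C_UniformSpace) z eta w).
    { apply C_NormedModule_mixin_compat1. exact Hw. }
    specialize (Heta w B).
    apply (C_NormedModule_mixin_compat2 (f z) (f w)) in Heta.
    change (Cmod (f w - f z) < sqrt 2 * (eps / 2)) in Heta.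
    assert (sqrt 2 < 2).
    { rewrite <- (sqrt_square 2) at 2 by lra. apply sqrt_lt_1; lra. }
    nra.
  - intros H.
    assert (K : forall g : C -> R, (forall u v, Rabs (g u - g v) <= Cmod (u - v)) ->
       continuous (T := C_UniformSpace) (U := R_UniformSpace) (fun w => g (f w)) z).
    { intros g Hg P [e He]. destruct (H e (cond_pos e)) as (eta & Heta & Hw).
      assert (He2 : 0 < eta / 2) by lra.
      exists (mkposreal _ He2). intros w B. apply He.
      apply (C_NormedModule_mixin_compat2 z w) in B.
      change (Cmod (w - z) < sqrt 2 * (eta / 2)) in B.
      assert (sqrt 2 < 2).
      { rewrite <- (sqrt_square 2) at 2 by lra. apply sqrt_lt_1; lra. }
      change (Rabs (g (f w) - g (f z)) < e).
      eapply Rle_lt_trans; [apply Hg|]. apply Hw. nra. }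
    split; apply K; intros u v.
    + replace (Re u - Re v) with (Re (u - v)%C) by (destruct u, v; simpl; ring). apply re_le_Cmod.
    + replace (Im u - Im v) with (Im (u - v)%C) by (destruct u, v; simpl; ring). apply im_le_Cmod.
Qed.

(* Carathéodory's form of complex differentiability. *)
Definition cdiff (f : C -> C) (z : C) : Prop :=
  exists phi : C -> C, ccont (U := C_UniformSpace) phi z /\
    forall w, (f w - f z = phi w * (w - z))%C.

Lemma cdiff_ccont (f : C -> C) (z : C) : cdiff f z -> ccont (U := C_UniformSpace) f z.
Proof.
  intros (phi & Hc & H).
  apply ccont_ext with (fun w => f z + phi w * (w - z))%C.
  - intros w. rewrite <- H. ring.
  - apply ccont_plus; [apply ccont_const|]. apply ccont_mult; [exact Hc|].
    apply ccont_minus; [apply ccont_id | apply ccont_const].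
Qed.

Lemma cdiff_ext (f g : C -> C) (z : C) :
  (forall w, f w = g w) -> cdiff f z -> cdiff g z.
Proof. intros E (phi & Hc & H). exists phi; split; [exact Hc|]. intros w; now rewrite <- !E. Qed.

Lemma cdiff_const (a z : C) : cdiff (fun _ => a) z.
Proof. exists (fun _ => RtoC 0); split; [apply ccont_const | intros w; ring]. Qed.

Lemma cdiff_id (z : C) : cdiff (fun w => w) z.
Proof. exists (fun _ => RtoC 1); split; [apply ccont_const | intros w; ring]. Qed.

Lemma cdiff_plus (f g : C -> C) (z : C) :
  cdiff f z -> cdiff g z -> cdiff (fun w => f w + g w)%C z.
Proof.
  intros (p & Hp & Ep) (q & Hq & Eq). exists (fun w => p w + q w)%C.
  split; [now apply ccont_plus|]. intros w.
  replace (f w + g w - (f z + g z))%C with ((f w - f z) + (g w - g z))%C by ring.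
  rewrite Ep, Eq; ring.
Qed.

Lemma cdiff_mult (f g : C -> C) (z : C) :
  cdiff f z -> cdiff g z -> cdiff (fun w => f w * g w)%C z.
Proof.
  intros Df Dg. pose proof (cdiff_ccont _ _ Dg) as Cg.
  destruct Df as (p & Hp & Ep), Dg as (q & Hq & Eq).
  exists (fun w => p w * g w + f z * q w)%C. split.
  - apply ccont_plus; apply ccont_mult; auto using @ccont_const.
  - intros w.
    replace (f w * g w - f z * g z)%C with ((f w - f z) * g w + f z * (g w - g z))%C by ring.
    rewrite Ep, Eq; ring.
Qed.

Lemma cdiff_opp (f : C -> C) (z : C) : cdiff f z -> cdiff (fun w => - f w)%C z.
Proof.
  intros H. apply cdiff_ext with (fun w => (- (1)) * f w)%C; [intros w; ring|].
  apply cdiff_mult; [apply cdiff_const | exact H].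
Qed.

Lemma cdiff_minus (f g : C -> C) (z : C) :
  cdiff f z -> cdiff g z -> cdiff (fun w => f w - g w)%C z.
Proof. intros; apply cdiff_plus; [assumption | now apply cdiff_opp]. Qed.

Lemma cdiff_pow (f : C -> C) (z : C) (n : nat) :
  cdiff f z -> cdiff (fun w => Cpow (f w) n) z.
Proof.
  intros H; induction n as [|n IH]; simpl; [apply cdiff_const | now apply cdiff_mult].
Qed.

Lemma cdiff_comp (f g : C -> C) (z : C) :
  cdiff g z -> cdiff f (g z) -> cdiff (fun w => f (g w)) z.
Proof.
  intros Dg. pose proof (cdiff_ccont _ _ Dg) as Cg.
  destruct Dg as (q & Hq & Eq). intros (p & Hp & Ep).
  exists (fun w => p (g w) * q w)%C. split.
  - apply ccont_mult; [|exact Hq].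
    exact (ccont_comp (U := C_UniformSpace) (V := C_UniformSpace) g p z (ccont_continuous _ _ Cg) Hp).
  - intros w. rewrite Ep, Eq; ring.
Qed.

Lemma cdiff_eps (f : C -> C) (z d : C) :
  (forall eps, 0 < eps -> exists eta, 0 < eta /\ forall w, Cmod (w - z) < eta ->
     Cmod (f w - f z - d * (w - z)) <= eps * Cmod (w - z)) -> cdiff f z.
Proof.
  intros H.
  exists (fun w => if Ceq_dec w z then d else (f w - f z) / (w - z))%C. split.
  - apply ccont_eps. intros eps Heps. assert (0 < eps / 2) by lra.
    destruct (H _ H0) as (eta & Heta & Hw). exists eta. split; [exact Heta|].
    intros w Hwz. destruct (Ceq_dec z z) as [_|N]; [|easy].
    destruct (Ceq_dec w z) as [->|N].
    + replace (d - d)%C with (RtoC 0) by ring. rewrite Cmod_0; lra.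
    + assert (N' : (w - z)%C <> 0%C).
      { intros E. apply N. replace w with (w - z + z)%C by ring. rewrite E; ring. }
      replace ((f w - f z) / (w - z) - d)%C with ((f w - f z - d * (w - z)) / (w - z))%C
        by (field; exact N').
      rewrite Cmod_div by exact N'. apply Cmod_gt_0 in N'.
      apply Rle_lt_trans with (eps / 2); [|lra].
      apply Rle_div_l; [exact N'|]. now apply Hw.
  - intros w. destruct (Ceq_dec w z) as [->|N]; [ring|].
    assert (N' : (w - z)%C <> 0%C).
    { intros E. apply N. replace w with (w - z + z)%C by ring. rewrite E; ring. }
    field; exact N'.
Qed.

(** The bridge from [holomorphic_on], which speaks of [ex_derive], to the form used in all the
    contour arguments. *)
Lemma ex_derive_cdiff (f : C -> C) (z : C) :
  ex_derive (K := C_AbsRing) (V := C_NormedModule) f z -> cdiff f z.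
Proof.
  intros [d [_ H]]. apply cdiff_eps with d. intros eps Heps.
  destruct (H z (fun P HP => HP) (mkposreal _ Heps)) as [eta Heta].
  exists eta. split; [apply cond_pos|]. intros w Hw.
  specialize (Heta w Hw).
  change (Cmod (f w - f z - (w - z) * d) <= eps * Cmod (w - z)) in Heta.
  replace (d * (w - z))%C with ((w - z) * d)%C by ring. exact Heta.
Qed.

Lemma cdiff_Cinv (z : C) : z <> 0%C -> cdiff Cinv z.
Proof.
  (* Since [/ 0] is [0], the factorisation at [w = 0] reads [- / z = phi 0 * (- z)], which forces
     the exceptional value there. *)
  intros Hz. exists (fun w => if Ceq_dec w 0 then (/ z) * (/ z) else - (/ w) * (/ z))%C. split.
  - apply ccont_eps. intros eps Heps.
    assert (K : ccont (U := C_UniformSpace) (fun w => - (/ w) * (/ z))%C z).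
    { apply ccont_mult; [|apply ccont_const]. apply ccont_opp, ccont_inv; [exact Hz | apply ccont_id]. }
    destruct (proj1 (ccont_eps _ _) K eps Heps) as (eta & Heta & Hw).
    apply Cmod_gt_0 in Hz as Hz'.
    exists (Rmin eta (Cmod z)). split; [now apply Rmin_pos|].
    intros w Hwz. destruct (Ceq_dec z 0) as [|_]; [easy|].
    destruct (Ceq_dec w 0) as [->|N].
    + exfalso. replace (0 - z)%C with (- z)%C in Hwz by ring. rewrite Cmod_opp in Hwz.
      pose proof (Rmin_r eta (Cmod z)); lra.
    + apply Hw. eapply Rlt_le_trans; [exact Hwz | apply Rmin_l].
  - intros w. destruct (Ceq_dec w 0) as [->|N].
    + assert (E : (/ 0)%C = RtoC 0) by (apply injective_projections; simpl; unfold Rdiv; ring).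
      rewrite E. field. exact Hz.
    + field. now split.
Qed.

Lemma cdiff_inv (f : C -> C) (z : C) :
  f z <> 0%C -> cdiff f z -> cdiff (fun w => / f w)%C z.
Proof. intros H D. exact (cdiff_comp Cinv f z D (cdiff_Cinv _ H)). Qed.

Lemma cdiff_div (f g : C -> C) (z : C) :
  g z <> 0%C -> cdiff f z -> cdiff g z -> cdiff (fun w => f w / g w)%C z.
Proof. intros H Df Dg. apply cdiff_mult; [exact Df | now apply cdiff_inv]. Qed.

(** * Integrals over rectangles *)

Definition CInt (g : R -> C) (a b : R) : C :=
  (RInt (fun t => Re (g t)) a b, RInt (fun t => Im (g t)) a b).

Definition cont_on (g : R -> C) (a b : R) : Prop :=
  forall t, a <= t <= b -> ccont (U := R_UniformSpace) g t.

Lemma cont_on_ex (g : R -> C) (a b : R) : a <= b -> cont_on g a b ->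
  ex_RInt (fun t => Re (g t)) a b /\ ex_RInt (fun t => Im (g t)) a b.
Proof.
  intros Hab H; split; apply (ex_RInt_continuous (V := R_CompleteNormedModule));
    intros t Ht; rewrite Rmin_left, Rmax_right in Ht by exact Hab; now destruct (H t Ht).
Qed.

Lemma cont_on_sub (g : R -> C) (a b a' b' : R) :
  a <= a' -> b' <= b -> cont_on g a b -> cont_on g a' b'.
Proof. intros Ha Hb H t Ht; apply H; lra. Qed.

Lemma CInt_ext (g h : R -> C) (a b : R) : a <= b ->
  (forall t, a <= t <= b -> g t = h t) -> CInt g a b = CInt h a b.
Proof.
  intros Hab H. unfold CInt. f_equal; apply RInt_ext; intros t Ht;
    rewrite Rmin_left, Rmax_right in Ht by exact Hab; rewrite H; auto; lra.
Qed.

Lemma CInt_Chasles (g : R -> C) (a b c : R) : a <= b <= c -> cont_on g a c ->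
  CInt g a c = (CInt g a b + CInt g b c)%C.
Proof.
  intros [Hab Hbc] H.
  destruct (cont_on_ex g a b Hab) as [A1 A2]; [apply (cont_on_sub g a c); auto; lra|].
  destruct (cont_on_ex g b c Hbc) as [B1 B2]; [apply (cont_on_sub g a c); auto; lra|].
  unfold CInt, Cplus; simpl.
  f_equal; symmetry; now apply (RInt_Chasles (V := R_CompleteNormedModule)).
Qed.

Lemma CInt_minus (g h : R -> C) (a b : R) : a <= b -> cont_on g a b -> cont_on h a b ->
  CInt (fun t => g t - h t)%C a b = (CInt g a b - CInt h a b)%C.
Proof.
  intros Hab Hg Hh.
  destruct (cont_on_ex g a b Hab Hg) as [A1 A2], (cont_on_ex h a b Hab Hh) as [B1 B2].
  unfold CInt, Cminus, Cplus, Copp; simpl.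
  f_equal; now apply (RInt_minus (V := R_CompleteNormedModule)).
Qed.

Lemma CInt_scal (k : C) (g : R -> C) (a b : R) : a <= b -> cont_on g a b ->
  CInt (fun t => k * g t)%C a b = (k * CInt g a b)%C.
Proof.
  intros Hab Hg.
  destruct (cont_on_ex g a b Hab Hg) as [A1 A2].
  destruct k as [u v].
  unfold CInt, Cmult; simpl. f_equal.
  - transitivity (RInt (fun t => u * Re (g t)) a b - RInt (fun t => v * Im (g t)) a b).
    + apply (RInt_minus (V := R_CompleteNormedModule));
        now apply (ex_RInt_scal (V := R_NormedModule)).
    + f_equal; now apply (RInt_scal (V := R_CompleteNormedModule)).
  - transitivity (RInt (fun t => u * Im (g t)) a b + RInt (fun t => v * Re (g t)) a b).
    + apply (RInt_plus (V := R_CompleteNormedModule));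
        now apply (ex_RInt_scal (V := R_NormedModule)).
    + f_equal; now apply (RInt_scal (V := R_CompleteNormedModule)).
Qed.

(** Bounding the two components separately would lose a factor; [Cmod] is the norm of the product
    module, so the sharp inequality comes from [norm_RInt_le]. *)
Lemma CInt_le (g : R -> C) (h : R -> R) (a b : R) : a <= b -> cont_on g a b ->
  ex_RInt h a b -> (forall t, a <= t <= b -> Cmod (g t) <= h t) ->
  Cmod (CInt g a b) <= RInt h a b.
Proof.
  intros Hab Hg Hh H. rewrite Cmod_norm.
  destruct (cont_on_ex g a b Hab Hg) as [A1 A2].
  apply (norm_RInt_le (V := prod_NormedModule R_AbsRing R_NormedModule R_NormedModule) g h a b).
  - exact Hab.
  - intros t Ht. rewrite <- Cmod_norm. now apply H.
  - apply (is_RInt_fct_extend_pair (U := R_NormedModule) (V := R_NormedModule));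
      now apply (RInt_correct (V := R_CompleteNormedModule)).
  - now apply (RInt_correct (V := R_CompleteNormedModule)).
Qed.

Lemma CInt_le_const (g : R -> C) (M a b : R) : a <= b -> cont_on g a b ->
  (forall t, a <= t <= b -> Cmod (g t) <= M) -> Cmod (CInt g a b) <= (b - a) * M.
Proof.
  intros Hab Hg H.
  replace ((b - a) * M) with (RInt (fun _ => M) a b).
  - apply CInt_le; auto. apply ex_RInt_const.
  - rewrite RInt_const. reflexivity.
Qed.

Lemma CInt_nil (g : R -> C) (a : R) : CInt g a a = RtoC 0.
Proof. unfold CInt. now rewrite !RInt_point. Qed.

Lemma CInt_const (k : C) (a b : R) : CInt (fun _ => k) a b = (RtoC (b - a) * k)%C.
Proof.
  unfold CInt. rewrite !RInt_const. unfold scal; simpl; unfold mult; simpl.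
  apply injective_projections; simpl; unfold Re, Im; ring.
Qed.

Lemma RInt_id_R (a b : R) : RInt (fun t => t) a b = (b ^ 2 - a ^ 2) / 2.
Proof.
  apply is_RInt_unique.
  replace ((b ^ 2 - a ^ 2) / 2) with (minus (b ^ 2 / 2) (a ^ 2 / 2))
    by (unfold minus, plus, opp; simpl; field).
  apply (is_RInt_derive (V := R_CompleteNormedModule) (fun t => t ^ 2 / 2) (fun t => t)).
  - intros t _. auto_derive; [auto | field].
  - intros t _. apply continuous_id.
Qed.

(** * Contour integrals along the boundary of a rectangle *)

Definition in_rect (x1 x2 y1 y2 : R) (z : C) : Prop :=
  x1 <= Re z <= x2 /\ y1 <= Im z <= y2.

Definition h_int (f : C -> C) (x1 x2 y : R) : C := CInt (fun x => f (x, y)) x1 x2.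
Definition v_int (f : C -> C) (x y1 y2 : R) : C := CInt (fun y => f (x, y)) y1 y2.

(** The counterclockwise integral of [f dz]: the bottom and right sides count positively, and [dz]
    is [Ci dy] on the vertical sides. *)
Definition rect_int (f : C -> C) (x1 x2 y1 y2 : R) : C :=
  (h_int f x1 x2 y1 - h_int f x1 x2 y2 + Ci * (v_int f x2 y1 y2 - v_int f x1 y1 y2))%C.

Definition rect_cont (f : C -> C) (x1 x2 y1 y2 : R) : Prop :=
  forall z, in_rect x1 x2 y1 y2 z -> ccont (U := C_UniformSpace) f z.

Lemma rect_cont_H (f : C -> C) (x1 x2 y1 y2 y : R) :
  rect_cont f x1 x2 y1 y2 -> y1 <= y <= y2 -> cont_on (fun x => f (x, y)) x1 x2.
Proof.
  intros H Hy t Ht.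
  apply (ccont_comp (U := R_UniformSpace) (V := C_UniformSpace) (fun x => (x, y)) f).
  - apply continuous_pairR; [apply continuous_id | apply continuous_const].
  - apply H. now split.
Qed.

Lemma rect_cont_V (f : C -> C) (x1 x2 y1 y2 x : R) :
  rect_cont f x1 x2 y1 y2 -> x1 <= x <= x2 -> cont_on (fun y => f (x, y)) y1 y2.
Proof.
  intros H Hx t Ht.
  apply (ccont_comp (U := R_UniformSpace) (V := C_UniformSpace) (fun y => (x, y)) f).
  - apply continuous_pairR; [apply continuous_const | apply continuous_id].
  - apply H. now split.
Qed.

Lemma rect_int_split_x (f : C -> C) (x1 c x2 y1 y2 : R) :
  x1 <= c <= x2 -> y1 <= y2 -> rect_cont f x1 x2 y1 y2 ->
  rect_int f x1 x2 y1 y2 = (rect_int f x1 c y1 y2 + rect_int f c x2 y1 y2)%C.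
Proof.
  intros Hc Hy H. unfold rect_int, h_int.
  rewrite (CInt_Chasles (fun x => f (x, y1)) x1 c x2), (CInt_Chasles (fun x => f (x, y2)) x1 c x2);
    try lra; try (apply (rect_cont_H f x1 x2 y1 y2); auto; lra).
  ring.
Qed.

Lemma rect_int_split_y (f : C -> C) (x1 x2 y1 c y2 : R) :
  x1 <= x2 -> y1 <= c <= y2 -> rect_cont f x1 x2 y1 y2 ->
  rect_int f x1 x2 y1 y2 = (rect_int f x1 x2 y1 c + rect_int f x1 x2 c y2)%C.
Proof.
  intros Hx Hc H. unfold rect_int, v_int.
  rewrite (CInt_Chasles (fun y => f (x1, y)) y1 c y2), (CInt_Chasles (fun y => f (x2, y)) y1 c y2);
    try lra; try (apply (rect_cont_V f x1 x2 y1 y2); auto; lra).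
  ring.
Qed.

Definition on_edge (x1 x2 y1 y2 : R) (z : C) : Prop :=
  in_rect x1 x2 y1 y2 z /\ (Re z = x1 \/ Re z = x2 \/ Im z = y1 \/ Im z = y2).

(** Continuity on the boundary alone, because integrands such as [/ (w - z0)] have a pole inside. *)
Definition edge_cont (f : C -> C) (x1 x2 y1 y2 : R) : Prop :=
  forall z, on_edge x1 x2 y1 y2 z -> ccont (U := C_UniformSpace) f z.

Lemma rect_cont_edge (f : C -> C) (x1 x2 y1 y2 : R) :
  rect_cont f x1 x2 y1 y2 -> edge_cont f x1 x2 y1 y2.
Proof. intros H z [Hz _]. exact (H z Hz). Qed.

Lemma edge_cont_H (f : C -> C) (x1 x2 y1 y2 y : R) : y1 <= y2 ->
  edge_cont f x1 x2 y1 y2 -> y = y1 \/ y = y2 -> cont_on (fun x => f (x, y)) x1 x2.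
Proof.
  intros Hy H E. apply (rect_cont_H f x1 x2 y y); [|lra].
  intros z [Hz1 Hz2]. apply H. unfold on_edge, in_rect. lra.
Qed.

Lemma edge_cont_V (f : C -> C) (x1 x2 y1 y2 x : R) : x1 <= x2 ->
  edge_cont f x1 x2 y1 y2 -> x = x1 \/ x = x2 -> cont_on (fun y => f (x, y)) y1 y2.
Proof.
  intros Hx H E. apply (rect_cont_V f x x y1 y2); [|lra].
  intros z [Hz1 Hz2]. apply H. unfold on_edge, in_rect. lra.
Qed.

Lemma rect_int_minus (f g : C -> C) (x1 x2 y1 y2 : R) : x1 <= x2 -> y1 <= y2 ->
  edge_cont f x1 x2 y1 y2 -> edge_cont g x1 x2 y1 y2 ->
  rect_int (fun w => f w - g w)%C x1 x2 y1 y2 =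
  (rect_int f x1 x2 y1 y2 - rect_int g x1 x2 y1 y2)%C.
Proof.
  intros Hx Hy Hf Hg. unfold rect_int, h_int, v_int.
  rewrite (CInt_minus (fun x => f (x, y1)) (fun x => g (x, y1))),
    (CInt_minus (fun x => f (x, y2)) (fun x => g (x, y2))),
    (CInt_minus (fun y => f (x1, y)) (fun y => g (x1, y))),
    (CInt_minus (fun y => f (x2, y)) (fun y => g (x2, y)));
    try assumption;
    try (apply (edge_cont_H _ x1 x2 y1 y2); auto);
    try (apply (edge_cont_V _ x1 x2 y1 y2); auto).
  ring.
Qed.

Lemma rect_int_scal (k : C) (f : C -> C) (x1 x2 y1 y2 : R) : x1 <= x2 -> y1 <= y2 ->
  edge_cont f x1 x2 y1 y2 ->
  rect_int (fun w => k * f w)%C x1 x2 y1 y2 = (k * rect_int f x1 x2 y1 y2)%C.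
Proof.
  intros Hx Hy Hf. unfold rect_int, h_int, v_int.
  rewrite !CInt_scal;
    try assumption;
    try (apply (edge_cont_H _ x1 x2 y1 y2); auto);
    try (apply (edge_cont_V _ x1 x2 y1 y2); auto).
  ring.
Qed.

Lemma rect_int_ext (f g : C -> C) (x1 x2 y1 y2 : R) : x1 <= x2 -> y1 <= y2 ->
  (forall z, on_edge x1 x2 y1 y2 z -> f z = g z) ->
  rect_int f x1 x2 y1 y2 = rect_int g x1 x2 y1 y2.
Proof.
  intros Hx Hy H. unfold rect_int, h_int, v_int.
  rewrite (CInt_ext (fun x => f (x, y1)) (fun x => g (x, y1))),
    (CInt_ext (fun x => f (x, y2)) (fun x => g (x, y2))),
    (CInt_ext (fun y => f (x1, y)) (fun y => g (x1, y))),
    (CInt_ext (fun y => f (x2, y)) (fun y => g (x2, y)));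
    auto; intros t Ht; apply H; unfold on_edge, in_rect; simpl; lra.
Qed.

Lemma Cmod_Ci_mult (z : C) : Cmod (Ci * z) = Cmod z.
Proof. rewrite Cmod_mult, Cmod_Ci; ring. Qed.

Lemma Cmod_minus_le (u v : C) : Cmod (u - v) <= Cmod u + Cmod v.
Proof. eapply Rle_trans; [apply Cmod_triangle|]. rewrite Cmod_opp; lra. Qed.

Lemma rect_int_le (f : C -> C) (M x1 x2 y1 y2 : R) : x1 <= x2 -> y1 <= y2 ->
  edge_cont f x1 x2 y1 y2 ->
  (forall z, on_edge x1 x2 y1 y2 z -> Cmod (f z) <= M) ->
  Cmod (rect_int f x1 x2 y1 y2) <= 2 * ((x2 - x1) + (y2 - y1)) * M.
Proof.
  intros Hx Hy Hf HM. unfold rect_int.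
  assert (H1 : forall y, y = y1 \/ y = y2 -> Cmod (h_int f x1 x2 y) <= (x2 - x1) * M).
  { intros y E. apply CInt_le_const; auto.
    - apply (edge_cont_H _ x1 x2 y1 y2); auto.
    - intros t Ht. apply HM; unfold on_edge, in_rect; simpl; lra. }
  assert (H2 : forall x, x = x1 \/ x = x2 -> Cmod (v_int f x y1 y2) <= (y2 - y1) * M).
  { intros x E. apply CInt_le_const; auto.
    - apply (edge_cont_V _ x1 x2 y1 y2); auto.
    - intros t Ht. apply HM; unfold on_edge, in_rect; simpl; lra. }
  pose proof (H1 y1 (or_introl eq_refl)); pose proof (H1 y2 (or_intror eq_refl)).
  pose proof (H2 x1 (or_introl eq_refl)); pose proof (H2 x2 (or_intror eq_refl)).
  eapply Rle_trans; [apply Cmod_triangle|]. rewrite Cmod_Ci_mult.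
  pose proof (Cmod_minus_le (h_int f x1 x2 y1) (h_int f x1 x2 y2)).
  pose proof (Cmod_minus_le (v_int f x2 y1 y2) (v_int f x1 y1 y2)).
  lra.
Qed.

Lemma rect_int_affine (k l z : C) (x1 x2 y1 y2 : R) : x1 <= x2 -> y1 <= y2 ->
  rect_int (fun w => k + l * (w - z))%C x1 x2 y1 y2 = RtoC 0.
Proof.
  intros Hx Hy.
  assert (C1 : rect_cont (fun w => w) x1 x2 y1 y2) by (intros w _; apply ccont_id).
  assert (C0 : forall a, rect_cont (fun _ => a) x1 x2 y1 y2) by (intros a w _; apply ccont_const).
  assert (C2 : rect_cont (fun w => l * w)%C x1 x2 y1 y2)
    by (intros w _; apply ccont_mult; [apply ccont_const | apply ccont_id]).
  rewrite (rect_int_ext _ (fun w => l * w - (l * z - k))%C) by (auto; intros; ring).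
  rewrite rect_int_minus, rect_int_scal by (auto using rect_cont_edge).
  assert (E0 : forall a, rect_int (fun _ => a) x1 x2 y1 y2 = RtoC 0).
  { intros a. unfold rect_int, h_int, v_int. rewrite !CInt_const. ring. }
  assert (E1 : rect_int (fun w => w) x1 x2 y1 y2 = RtoC 0).
  { unfold rect_int, h_int, v_int, CInt; simpl. rewrite !RInt_id_R, !RInt_const.
    apply injective_projections; simpl; unfold scal; simpl; unfold mult; simpl; field. }
  rewrite E0, E1. ring.
Qed.

(** * Goursat's theorem *)

(** The last quarter needs no test: if the other three fall short of a fourth of the total modulus,
    the triangle inequality makes it large enough. *)
Definition quarter (f : C -> C) (q : R * R * R * R) : R * R * R * R :=
  let '(x1, x2, y1, y2) := q in
  let u := (x1 + x2) / 2 in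
  let v := (y1 + y2) / 2 in
  let d := Cmod (rect_int f x1 x2 y1 y2) / 4 in
  if Rle_dec d (Cmod (rect_int f x1 u y1 v)) then (x1, u, y1, v)
  else if Rle_dec d (Cmod (rect_int f u x2 y1 v)) then (u, x2, y1, v)
  else if Rle_dec d (Cmod (rect_int f x1 u v y2)) then (x1, u, v, y2)
  else (u, x2, v, y2).

Lemma rect_cont_sub (f : C -> C) (x1 x2 y1 y2 x1' x2' y1' y2' : R) :
  x1 <= x1' -> x2' <= x2 -> y1 <= y1' -> y2' <= y2 ->
  rect_cont f x1 x2 y1 y2 -> rect_cont f x1' x2' y1' y2'.
Proof. intros ? ? ? ? H z [Hx Hy]. apply H. split; lra. Qed.

Lemma quarter_spec (f : C -> C) (x1 x2 y1 y2 : R) : x1 <= x2 -> y1 <= y2 ->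
  rect_cont f x1 x2 y1 y2 ->
  let '(x1', x2', y1', y2') := quarter f (x1, x2, y1, y2) in
  x1 <= x1' /\ x2' <= x2 /\ y1 <= y1' /\ y2' <= y2 /\
  x2' - x1' = (x2 - x1) / 2 /\ y2' - y1' = (y2 - y1) / 2 /\
  Cmod (rect_int f x1 x2 y1 y2) / 4 <= Cmod (rect_int f x1' x2' y1' y2').
Proof.
  intros Hx Hy H. unfold quarter.
  set (u := (x1 + x2) / 2). set (v := (y1 + y2) / 2).
  assert (Hu : x1 <= u <= x2) by (unfold u; lra).
  assert (Hv : y1 <= v <= y2) by (unfold v; lra).
  repeat destruct Rle_dec; repeat (split; [unfold u, v; lra|]); try assumption.
  apply Rnot_le_lt in n, n0, n1.
  assert (E : rect_int f x1 x2 y1 y2 =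
    (rect_int f x1 u y1 v + rect_int f x1 u v y2 +
     (rect_int f u x2 y1 v + rect_int f u x2 v y2))%C).
  { rewrite (rect_int_split_x f x1 u x2) by auto.
    rewrite (rect_int_split_y f x1 u y1 v y2), (rect_int_split_y f u x2 y1 v y2); auto; try lra;
      apply (rect_cont_sub f x1 x2 y1 y2); auto; lra. }
  assert (B : Cmod (rect_int f x1 x2 y1 y2) <=
    Cmod (rect_int f x1 u y1 v) + Cmod (rect_int f x1 u v y2) +
    (Cmod (rect_int f u x2 y1 v) + Cmod (rect_int f u x2 v y2))).
  { rewrite E at 1. eapply Rle_trans; [apply Cmod_triangle|].
    apply Rplus_le_compat; apply Cmod_triangle. }
  lra.
Qed.

Fixpoint quarters (f : C -> C) (q : R * R * R * R) (n : nat) : R * R * R * R :=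
  match n with O => q | S k => quarter f (quarters f q k) end.

Lemma quarters_spec (f : C -> C) (x1 x2 y1 y2 : R) (n : nat) : x1 <= x2 -> y1 <= y2 ->
  rect_cont f x1 x2 y1 y2 ->
  let '(x1', x2', y1', y2') := quarters f (x1, x2, y1, y2) n in
  x1 <= x1' /\ x2' <= x2 /\ y1 <= y1' /\ y2' <= y2 /\
  x2' - x1' = (x2 - x1) / 2 ^ n /\ y2' - y1' = (y2 - y1) / 2 ^ n /\
  Cmod (rect_int f x1 x2 y1 y2) / 4 ^ n <= Cmod (rect_int f x1' x2' y1' y2').
Proof.
  intros Hx Hy H. induction n as [|n IH]; simpl.
  - repeat split; lra.
  - destruct (quarters f (x1, x2, y1, y2) n) as [[[a b] c] d].
    destruct IH as (I1 & I2 & I3 & I4 & I5 & I6 & I7).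
    assert (0 < / 2 ^ n) by (apply Rinv_0_lt_compat, pow_lt; lra).
    assert (a <= b) by (unfold Rdiv in I5; nra).
    assert (c <= d) by (unfold Rdiv in I6; nra).
    pose proof (quarter_spec f a b c d H1 H2
      (rect_cont_sub f x1 x2 y1 y2 a b c d I1 I2 I3 I4 H)) as Q.
    destruct (quarter f (a, b, c, d)) as [[[a' b'] c'] d'].
    destruct Q as (Q1 & Q2 & Q3 & Q4 & Q5 & Q6 & Q7).
    assert (2 ^ n <> 0) by (apply pow_nonzero; lra).
    assert (4 ^ n <> 0) by (apply pow_nonzero; lra).
    repeat split; try lra.
    + rewrite Q5, I5. field; lra.
    + rewrite Q6, I6. field; lra.
    + eapply Rle_trans; [|exact Q7].
      replace (Cmod (rect_int f x1 x2 y1 y2) / (4 * 4 ^ n))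
        with (Cmod (rect_int f x1 x2 y1 y2) / 4 ^ n / 4) by (field; lra).
      lra.
Qed.

Lemma nested_point (a b : nat -> R) :
  (forall n, a n <= a (S n)) -> (forall n, b (S n) <= b n) -> (forall n, a n <= b n) ->
  exists x, forall n, a n <= x <= b n.
Proof.
  intros Ha Hb Hab.
  assert (Ma : forall n k, a n <= a (n + k)%nat).
  { intros n k; induction k as [|k IH]; [rewrite Nat.add_0_r; lra|].
    rewrite Nat.add_succ_r. specialize (Ha (n + k)%nat); lra. }
  assert (Mb : forall n k, b (n + k)%nat <= b n).
  { intros n k; induction k as [|k IH]; [rewrite Nat.add_0_r; lra|].
    rewrite Nat.add_succ_r. specialize (Hb (n + k)%nat); lra. }
  assert (K : forall n k, a n <= b k).
  { intros n k. apply Rle_trans with (a (n + k)%nat); [apply Ma|].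
    apply Rle_trans with (b (n + k)%nat); [apply Hab|]. rewrite Nat.add_comm. apply Mb. }
  destruct (completeness (fun x => exists n, x = a n)) as [x [U L]].
  - exists (b O). intros x [n ->]. apply K.
  - exists (a O). now exists O.
  - exists x. intros n; split; [apply U; now exists n|].
    apply L. intros z [k ->]. apply K.
Qed.

Definition rect_diff (f : C -> C) (x1 x2 y1 y2 : R) : Prop :=
  forall z, in_rect x1 x2 y1 y2 z -> cdiff f z.

Lemma rect_diff_cont (f : C -> C) (x1 x2 y1 y2 : R) :
  rect_diff f x1 x2 y1 y2 -> rect_cont f x1 x2 y1 y2.
Proof. intros H z Hz; now apply cdiff_ccont, H. Qed.

Lemma pow_small (A eta : R) : 0 < eta -> exists n, A / 2 ^ n < eta.
Proof.
  intros He. destruct (pow_lt_1_zero (/ 2)) with (y := eta / (Rabs A + 1)) as [n Hn].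
  - rewrite Rabs_pos_eq; lra.
  - apply Rdiv_lt_0_compat; [lra|]. pose proof (Rabs_pos A); lra.
  - exists n. specialize (Hn n (le_n n)).
    rewrite Rabs_pos_eq in Hn by (apply pow_le; lra). rewrite pow_inv in Hn.
    pose proof (Rabs_pos A). apply Rlt_div_r in Hn; [|lra].
    pose proof (Rle_abs A). assert (0 < / 2 ^ n) by (apply Rinv_0_lt_compat, pow_lt; lra).
    unfold Rdiv. nra.
Qed.

Lemma Cmod_le_box (z : C) (h k : R) : Rabs (Re z) <= h -> Rabs (Im z) <= k -> Cmod z <= h + k.
Proof.
  intros Hh Hk. replace z with (RtoC (Re z) + Ci * RtoC (Im z))%C.
  - eapply Rle_trans; [apply Cmod_triangle|]. rewrite Cmod_Ci_mult, !Cmod_R. lra.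
  - apply injective_projections; simpl; unfold Re, Im; ring.
Qed.

Theorem goursat (f : C -> C) (x1 x2 y1 y2 : R) : x1 <= x2 -> y1 <= y2 ->
  rect_diff f x1 x2 y1 y2 -> rect_int f x1 x2 y1 y2 = RtoC 0.
Proof.
  intros Hx Hy Hd. pose proof (rect_diff_cont _ _ _ _ _ Hd) as Hc.
  pose proof (fun n => quarters_spec f x1 x2 y1 y2 n Hx Hy Hc) as Q.
  set (q := quarters f (x1, x2, y1, y2)) in Q.
  set (a := fun n => fst (fst (fst (q n)))). set (b := fun n => snd (fst (fst (q n)))).
  set (c := fun n => snd (fst (q n))). set (d := fun n => snd (q n)).
  assert (QE : forall n, q n = (a n, b n, c n, d n)).
  { intros n. unfold a, b, c, d. now destruct (q n) as [[[? ?] ?] ?]. }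
  assert (P2 : forall n, 0 < / 2 ^ n) by (intros; apply Rinv_0_lt_compat, pow_lt; lra).
  assert (Q' : forall n, x1 <= a n /\ b n <= x2 /\ y1 <= c n /\ d n <= y2 /\
     b n - a n = (x2 - x1) / 2 ^ n /\ d n - c n = (y2 - y1) / 2 ^ n /\
     Cmod (rect_int f x1 x2 y1 y2) / 4 ^ n <= Cmod (rect_int f (a n) (b n) (c n) (d n))).
  { intros n. specialize (Q n). now rewrite QE in Q. }
  assert (Hab : forall n, a n <= b n).
  { intros n. destruct (Q' n) as (_ & _ & _ & _ & E & _). specialize (P2 n). unfold Rdiv in E. nra. }
  assert (Hcd : forall n, c n <= d n).
  { intros n. destruct (Q' n) as (_ & _ & _ & _ & _ & E & _). specialize (P2 n). unfold Rdiv in E. nra. }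
  assert (Hcn : forall n, rect_cont f (a n) (b n) (c n) (d n)).
  { intros n. destruct (Q' n) as (E1 & E2 & E3 & E4 & _). now apply (rect_cont_sub f x1 x2 y1 y2). }
  assert (St : forall n, a n <= a (S n) /\ b (S n) <= b n /\ c n <= c (S n) /\ d (S n) <= d n).
  { intros n. pose proof (quarter_spec f (a n) (b n) (c n) (d n) (Hab n) (Hcd n) (Hcn n)) as S1.
    rewrite <- QE in S1. change (quarter f (q n)) with (q (S n)) in S1. rewrite QE in S1. tauto. }
  destruct (nested_point a b) as [x0 Hx0]; try (intros n; apply St); auto.
  destruct (nested_point c d) as [y0 Hy0]; try (intros n; apply St); auto.
  assert (Hz : in_rect x1 x2 y1 y2 (x0, y0)).
  { split; simpl; [specialize (Hx0 O) | specialize (Hy0 O)]; exact Hx0 || exact Hy0. }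
  destruct (Hd _ Hz) as (phi & Hphi & Ephi).
  set (P := (x2 - x1) + (y2 - y1)). assert (HP : 0 <= P) by (unfold P; lra).
  apply Cmod_eq_0. apply Rle_antisym; [|apply Cmod_ge_0].
  apply le_epsilon. intros eps Heps. rewrite Rplus_0_l.
  (* With [P] the half-perimeter, the n-th rectangle contributes at most [2 (P / 2^n) (P / 2^n)]
     times this number, and the loss of the bisection is [4^n]; the [+ 1] covers [P = 0]. *)
  assert (He' : 0 < eps / (2 * P * P + 1)) by (apply Rdiv_lt_0_compat; nra).
  destruct (proj1 (ccont_eps _ _) Hphi _ He') as (eta & Heta & Hw).
  destruct (pow_small P eta Heta) as [n Hn].
  destruct (Q' n) as (E1 & E2 & E3 & E4 & E5 & E6 & E7).
  set (z0 := (x0, y0)) in *.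
  (* Subtracting the affine part leaves the integral unchanged and turns the integrand into
     [(phi w - phi z0) * (w - z0)], which is small compared with the diameter. *)
  assert (J : rect_int f (a n) (b n) (c n) (d n) =
     rect_int (fun w => f w - (f z0 + phi z0 * (w - z0)))%C (a n) (b n) (c n) (d n)).
  { rewrite rect_int_minus, rect_int_affine; auto using rect_cont_edge.
    - ring.
    - intros w _. apply ccont_plus; [apply ccont_const|].
      apply ccont_mult; [apply ccont_const|].
      apply ccont_minus; [apply ccont_id | apply ccont_const]. }
  assert (B : Cmod (rect_int f (a n) (b n) (c n) (d n)) <=
     2 * (P / 2 ^ n) * (eps / (2 * P * P + 1) * (P / 2 ^ n))).
  { rewrite J. eapply Rle_trans; [apply rect_int_le with (M := eps / (2 * P * P + 1) * (P / 2 ^ n))|]; auto.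
    - apply rect_cont_edge. intros w Hw'. apply ccont_minus; [exact (Hcn n w Hw')|]. apply ccont_plus; [apply ccont_const|].
      apply ccont_mult; [apply ccont_const|].
      apply ccont_minus; [apply ccont_id | apply ccont_const].
    - intros w [[Hw1 Hw2] _].
      assert (Hwz : Cmod (w - z0) <= P / 2 ^ n).
      { eapply Rle_trans; [apply Cmod_le_box with (h := b n - a n) (k := d n - c n)|].
        - specialize (Hx0 n). unfold z0. destruct w; simpl in *. apply Rabs_le; lra.
        - specialize (Hy0 n). unfold z0. destruct w; simpl in *. apply Rabs_le; lra.
        - rewrite E5, E6. unfold P. right. field. apply pow_nonzero; lra. }
      replace (f w - (f z0 + phi z0 * (w - z0)))%C with ((phi w - phi z0) * (w - z0))%C.
      + rewrite Cmod_mult. apply Rmult_le_compat; try apply Cmod_ge_0; [|exact Hwz].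
        left. apply Hw. lra.
      + replace ((phi w - phi z0) * (w - z0))%C with (phi w * (w - z0) - phi z0 * (w - z0))%C by ring.
        rewrite <- Ephi. ring.
    - replace (b n - a n + (d n - c n)) with (P / 2 ^ n); [right; ring|].
      rewrite E5, E6. unfold P. field. apply pow_nonzero; lra. }
  assert (H4 : 4 ^ n = 2 ^ n * 2 ^ n) by (rewrite <- Rpow_mult_distr; f_equal; lra).
  assert (0 < 2 ^ n) by (apply pow_lt; lra).
  rewrite H4 in E7.
  assert (Cmod (rect_int f x1 x2 y1 y2) <= 2 * P * P * (eps / (2 * P * P + 1))).
  { apply Rmult_le_reg_r with (/ (2 ^ n * 2 ^ n)); [apply Rinv_0_lt_compat; nra|].
    eapply Rle_trans; [exact E7|]. eapply Rle_trans; [exact B|].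
    right. field. split; apply Rgt_not_eq; [lra | nra]. }
  eapply Rle_trans; [exact H0|].
  replace (2 * P * P * (eps / (2 * P * P + 1))) with (eps * (2 * P * P) / (2 * P * P + 1)) by (field; apply Rgt_not_eq; nra).
  apply Rle_div_l; nra.
Qed.

(* Cutting a small square around an exceptional point out of the rectangle
   leaves rectangles that avoid it; the square contributes at most its
   perimeter times a local bound. *)
Theorem goursat_except (l : list C) : forall (f : C -> C) (x1 x2 y1 y2 : R),
  x1 <= x2 -> y1 <= y2 ->
  rect_cont f x1 x2 y1 y2 ->
  (forall z, in_rect x1 x2 y1 y2 z -> ~ In z l -> cdiff f z) ->
  rect_int f x1 x2 y1 y2 = RtoC 0.
Proof.
  induction l as [|p l IH]; intros f x1 x2 y1 y2 Hx Hy Hc Hd.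
  - apply goursat; auto. intros z Hz. now apply Hd.
  (* A piece of the subdivision degenerates when [p] lies on the corresponding side of the
     rectangle; any other piece has to avoid [p]. *)
  - assert (IH' : forall a b c d, x1 <= a <= b /\ b <= x2 -> y1 <= c <= d /\ d <= y2 ->
        (a = b \/ c = d \/ ~ in_rect a b c d p) -> rect_int f a b c d = RtoC 0).
    { intros a b c d H1 H2 [E|[E|E]].
      - subst b. unfold rect_int, h_int. rewrite !CInt_nil. ring.
      - subst d. unfold rect_int, v_int. rewrite !CInt_nil. ring.
      - apply IH; try lra.
        + apply (rect_cont_sub f x1 x2 y1 y2); auto; lra.
        + intros z Hz Hl. apply Hd.
          * destruct Hz; split; lra.
          * intros [->|Hin]; auto. }
    destruct (Rle_dec x1 (Re p)) as [P1|P1]; [|apply IH'; try lra; right; right; intros [[]]; lra].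
    destruct (Rle_dec (Re p) x2) as [P2|P2]; [|apply IH'; try lra; right; right; intros [[]]; lra].
    destruct (Rle_dec y1 (Im p)) as [P3|P3]; [|apply IH'; try lra; right; right; intros [_ []]; lra].
    destruct (Rle_dec (Im p) y2) as [P4|P4]; [|apply IH'; try lra; right; right; intros [_ []]; lra].
    destruct (proj1 (ccont_eps f p) (Hc p (conj (conj P1 P2) (conj P3 P4))) 1 Rlt_0_1)
      as (eta & Heta & Hw).
    set (M := Cmod (f p) + 1). assert (HM : 0 < M) by (pose proof (Cmod_ge_0 (f p)); unfold M; lra).
    apply Cmod_eq_0. apply Rle_antisym; [|apply Cmod_ge_0].
    apply le_epsilon. intros eps Heps. rewrite Rplus_0_l.
    (* The square has sides at most [2 * e], so it stays within the range [eta] of the bound [M] and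
       its perimeter times [M] is at most [8 * e * M <= eps]. *)
    set (e := Rmin (eta / 3) (eps / (8 * M))).
    assert (He : 0 < e) by (apply Rmin_pos; apply Rdiv_lt_0_compat; lra).
    assert (He1 : e <= eta / 3) by apply Rmin_l.
    assert (He2 : e * (8 * M) <= eps).
    { apply Rle_div_r; [lra|]. apply Rmin_r. }
    set (a := Rmax x1 (Re p - e)). set (b := Rmin x2 (Re p + e)).
    set (c := Rmax y1 (Im p - e)). set (d := Rmin y2 (Im p + e)).
    assert (Ha : x1 <= a /\ Re p - e <= a <= Re p /\ (a = x1 \/ a < Re p)).
    { unfold a, Rmax; destruct Rle_dec; lra. }
    assert (Hb : b <= x2 /\ Re p <= b <= Re p + e /\ (b = x2 \/ Re p < b)).
    { unfold b, Rmin; destruct Rle_dec; lra. }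
    assert (Hc' : y1 <= c /\ Im p - e <= c <= Im p /\ (c = y1 \/ c < Im p)).
    { unfold c, Rmax; destruct Rle_dec; lra. }
    assert (Hd' : d <= y2 /\ Im p <= d <= Im p + e /\ (d = y2 \/ Im p < d)).
    { unfold d, Rmin; destruct Rle_dec; lra. }
    rewrite (rect_int_split_x f x1 a x2), (rect_int_split_x f a b x2) by
      (try lra; apply (rect_cont_sub f x1 x2 y1 y2); auto; lra).
    rewrite (rect_int_split_y f a b y1 c y2), (rect_int_split_y f a b c d y2) by
      (try lra; apply (rect_cont_sub f x1 x2 y1 y2); auto; lra).
    rewrite (IH' x1 a y1 y2), (IH' b x2 y1 y2), (IH' a b y1 c), (IH' a b d y2);
      try lra.
    2: { destruct Hd' as (_ & _ & [E|E]); [lra | right; right; intros [_ []]; lra]. }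
    2: { destruct Hc' as (_ & _ & [E|E]); [lra | right; right; intros [_ []]; lra]. }
    2: { destruct Hb as (_ & _ & [E|E]); [lra | right; right; intros [[]]; lra]. }
    2: { destruct Ha as (_ & _ & [E|E]); [lra | right; right; intros [[]]; lra]. }
    replace (0 + (0 + (rect_int f a b c d + 0) + 0))%C with (rect_int f a b c d) by ring.
    eapply Rle_trans; [apply rect_int_le with (M := M)|]; try lra.
    + apply rect_cont_edge, (rect_cont_sub f x1 x2 y1 y2); auto; lra.
    + intros z [[Hz1 Hz2] _]. replace (f z) with (f p + (f z - f p))%C by ring.
      eapply Rle_trans; [apply Cmod_triangle|]. unfold M.
      apply Rplus_le_compat_l. left. apply Hw.
      apply Rle_lt_trans with (e + e); [|lra].
      apply Cmod_le_box; destruct z, p; simpl in *; apply Rabs_le; lra.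
    + nra.
Qed.

(** * Cauchy's formula and the maximum modulus principle *)

Lemma Cminus_neq0 (w z : C) : w <> z -> (w - z)%C <> 0%C.
Proof. intros N E. apply N. replace w with (w - z + z)%C by ring. rewrite E; ring. Qed.

Lemma ccont_local (f g : C -> C) (z : C) (eta : R) : 0 < eta ->
  (forall w, Cmod (w - z) < eta -> f w = g w) ->
  ccont (U := C_UniformSpace) f z -> ccont (U := C_UniformSpace) g z.
Proof.
  intros He E H. apply ccont_eps. intros eps Heps.
  destruct (proj1 (ccont_eps _ _) H eps Heps) as (e & He' & Hw).
  exists (Rmin eta e). split; [now apply Rmin_pos|]. intros w W.
  pose proof (Rmin_l eta e); pose proof (Rmin_r eta e).
  rewrite <- !E; try lra; [apply Hw; lra|].
  replace (z - z)%C with (RtoC 0) by ring. rewrite Cmod_0; lra.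
Qed.

Lemma cdiff_local (f g : C -> C) (z : C) (eta : R) : 0 < eta ->
  (forall w, Cmod (w - z) < eta -> f w = g w) -> cdiff f z -> cdiff g z.
Proof.
  intros He E (phi & Hc & H).
  (* The identity in [cdiff] is required for all [w], so away from [z] the slope has to be
     recomputed from [g]. *)
  exists (fun w => if Ceq_dec w z then phi w else (g w - g z) / (w - z))%C. split.
  - apply (ccont_local phi _ z eta He); [|exact Hc]. intros w W.
    destruct (Ceq_dec w z) as [_|N]; [reflexivity|].
    rewrite <- !E; auto.
    + rewrite H. field. now apply Cminus_neq0.
    + replace (z - z)%C with (RtoC 0) by ring. rewrite Cmod_0; lra.
  - intros w. destruct (Ceq_dec w z) as [->|N]; [ring|]. field. now apply Cminus_neq0.
Qed.

(** At [z0] itself only continuity of the quotient is obtained; differentiability there would be the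
    removable singularity theorem. This is why the integral theorems carry a list of exceptional
    points. *)
Lemma difference_quotient (f : C -> C) (z0 : C) : cdiff f z0 ->
  exists g : C -> C,
    (forall w, (f w - f z0 = g w * (w - z0))%C) /\
    ccont (U := C_UniformSpace) g z0 /\
    (forall z, ccont (U := C_UniformSpace) f z -> ccont (U := C_UniformSpace) g z) /\
    (forall z, z <> z0 -> cdiff f z -> cdiff g z).
Proof.
  intros (g & Hg & E). exists g. split; [exact E|]. split; [exact Hg|].
  assert (L : forall z, z <> z0 -> 0 < Cmod (z - z0) /\ forall w, Cmod (w - z) < Cmod (z - z0) ->
     ((f w - f z0) / (w - z0))%C = g w).
  { intros z N. split; [apply Cmod_gt_0; now apply Cminus_neq0|].
    intros w W. assert (w <> z0).
    { intros ->. replace (z0 - z)%C with (- (z - z0))%C in W by ring. rewrite Cmod_opp in W; lra. }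
    rewrite E. field. now apply Cminus_neq0. }
  split.
  - intros z Hz. destruct (Ceq_dec z z0) as [->|N]; [exact Hg|].
    destruct (L z N) as [L1 L2]. apply (ccont_local _ _ _ _ L1 L2).
    apply ccont_mult; [apply ccont_minus; [exact Hz | apply ccont_const]|].
    apply ccont_inv; [now apply Cminus_neq0|].
    apply ccont_minus; [apply ccont_id | apply ccont_const].
  - intros z N Hz. destruct (L z N) as [L1 L2]. apply (cdiff_local _ _ _ _ L1 L2).
    apply cdiff_div; [now apply Cminus_neq0 | |].
    + apply cdiff_minus; [exact Hz | apply cdiff_const].
    + apply cdiff_minus; [apply cdiff_id | apply cdiff_const].
Qed.

Definition interior_rect (x1 x2 y1 y2 : R) (z : C) : Prop :=
  x1 < Re z < x2 /\ y1 < Im z < y2.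

Lemma edge_not_interior (x1 x2 y1 y2 : R) (w z : C) :
  on_edge x1 x2 y1 y2 w -> interior_rect x1 x2 y1 y2 z -> w <> z.
Proof. intros [_ H] [H1 H2] ->. lra. Qed.

Lemma edge_cont_inv (x1 x2 y1 y2 : R) (z : C) : interior_rect x1 x2 y1 y2 z ->
  edge_cont (fun w => / (w - z))%C x1 x2 y1 y2.
Proof.
  intros Hz w Hw. apply ccont_inv.
  - apply Cminus_neq0. now apply (edge_not_interior x1 x2 y1 y2).
  - apply ccont_minus; [apply ccont_id | apply ccont_const].
Qed.

(** The difference quotient of [f] at [z0] integrates to zero by [goursat_except], with [z0] added
    to the list. The index integral stays as a factor; [index_lower] supplies all that is needed
    about it. *)
Theorem cauchy_rect (l : list C) (f : C -> C) (x1 x2 y1 y2 : R) (z0 : C) :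
  interior_rect x1 x2 y1 y2 z0 -> rect_cont f x1 x2 y1 y2 ->
  (forall z, in_rect x1 x2 y1 y2 z -> ~ In z l -> cdiff f z) -> ~ In z0 l ->
  rect_int (fun w => f w / (w - z0))%C x1 x2 y1 y2 =
  (f z0 * rect_int (fun w => / (w - z0))%C x1 x2 y1 y2)%C.
Proof.
  intros Hz Hc Hd Hl.
  assert (Hz' : in_rect x1 x2 y1 y2 z0) by (destruct Hz; split; lra).
  assert (Hx : x1 <= x2) by (destruct Hz; lra). assert (Hy : y1 <= y2) by (destruct Hz; lra).
  destruct (difference_quotient f z0 (Hd z0 Hz' Hl)) as (g & E & G0 & G1 & G2).
  assert (Gc : rect_cont g x1 x2 y1 y2).
  { intros z Hzz. apply G1. exact (Hc z Hzz). }
  assert (I0 : rect_int g x1 x2 y1 y2 = RtoC 0).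
  { apply (goursat_except (z0 :: l)); auto.
    intros z Hzz Hn. apply G2.
    - intros ->. apply Hn. now left.
    - apply Hd; auto. intros Hin. apply Hn. now right. }
  pose proof (edge_cont_inv x1 x2 y1 y2 z0 Hz) as Ei.
  assert (Ef : edge_cont (fun w => f w / (w - z0))%C x1 x2 y1 y2).
  { intros w Hw. apply ccont_mult; [apply Hc, Hw | apply Ei, Hw]. }
  rewrite <- rect_int_scal by auto.
  assert (K : (rect_int (fun w => f w / (w - z0))%C x1 x2 y1 y2 -
      rect_int (fun w => f z0 * / (w - z0))%C x1 x2 y1 y2)%C = RtoC 0).
  { rewrite <- rect_int_minus; auto.
    - rewrite <- I0. apply rect_int_ext; auto. intros w Hw.
      assert (N : (w - z0)%C <> 0%C).
      { apply Cminus_neq0. now apply (edge_not_interior x1 x2 y1 y2). }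
      replace (f w / (w - z0) - f z0 * / (w - z0))%C with ((f w - f z0) / (w - z0))%C by (field; exact N).
      rewrite E. field; exact N.
    - intros w Hw. apply ccont_mult; [apply ccont_const | apply Ei, Hw]. }
  apply Ceq_minus. exact K.
Qed.

Lemma sum_sq_pos (a b : R) : a <> 0 \/ b <> 0 -> 0 < a * (a * 1) + b * (b * 1).
Proof.
  intros H. pose proof (Rle_0_sqr a) as A. pose proof (Rle_0_sqr b) as B. unfold Rsqr in *.
  destruct H as [H|H]; apply Rsqr_pos_lt in H; unfold Rsqr in H; lra.
Qed.

Lemma Im_rect_int (f : C -> C) (x1 x2 y1 y2 : R) :
  Im (rect_int f x1 x2 y1 y2) =
  RInt (fun t => Im (f (t, y1))) x1 x2 - RInt (fun t => Im (f (t, y2))) x1 x2 +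
  (RInt (fun t => Re (f (x2, t))) y1 y2 - RInt (fun t => Re (f (x1, t))) y1 y2).
Proof. unfold rect_int, h_int, v_int, CInt; simpl. ring. Qed.

(** The angle seen from [z] grows along each of the four sides, so all contributions to the
    imaginary part are nonnegative. Only the bottom side is kept, where the imaginary part is
    [(Im z - y1)] over the squared distance. *)
Lemma index_lower (x1 x2 y1 y2 D : R) (z : C) : interior_rect x1 x2 y1 y2 z -> 0 < D ->
  (forall x, x1 <= x <= x2 -> (x - Re z) ^ 2 + (y1 - Im z) ^ 2 <= D) ->
  (x2 - x1) * ((Im z - y1) / D) <= Cmod (rect_int (fun w => / (w - z))%C x1 x2 y1 y2).
Proof.
  intros Hz HD H. pose proof (edge_cont_inv x1 x2 y1 y2 z Hz) as Ei.
  destruct z as [p q]. destruct Hz as [Hp Hq]. simpl Re in *. simpl Im in *.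
  eapply Rle_trans; [|apply im_le_Cmod]. eapply Rle_trans; [|apply Rle_abs].
  rewrite Im_rect_int.
  destruct (cont_on_ex _ x1 x2 ltac:(lra) (edge_cont_H _ x1 x2 y1 y2 y1 ltac:(lra) Ei ltac:(auto))) as [_ B1].
  destruct (cont_on_ex _ x1 x2 ltac:(lra) (edge_cont_H _ x1 x2 y1 y2 y2 ltac:(lra) Ei ltac:(auto))) as [_ B2].
  destruct (cont_on_ex _ y1 y2 ltac:(lra) (edge_cont_V _ x1 x2 y1 y2 x1 ltac:(lra) Ei ltac:(auto))) as [B3 _].
  destruct (cont_on_ex _ y1 y2 ltac:(lra) (edge_cont_V _ x1 x2 y1 y2 x2 ltac:(lra) Ei ltac:(auto))) as [B4 _].
  assert (I1 : (x2 - x1) * ((q - y1) / D) <=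
     RInt (fun t => Im (/ ((t, y1) - (p, q)))%C) x1 x2).
  { replace ((x2 - x1) * ((q - y1) / D)) with (RInt (fun _ => (q - y1) / D) x1 x2)
      by (rewrite RInt_const; reflexivity).
    apply RInt_le; try lra; [apply ex_RInt_const | exact B1 |].
    intros t Ht. simpl. specialize (H t ltac:(lra)).
    replace (- (y1 + - q)) with (q - y1) by ring.
    apply Rmult_le_compat_l; [lra|]. apply Rinv_le_contravar; [apply sum_sq_pos; lra|]. eapply Rle_trans; [|exact H]. right; simpl; ring. }
  assert (I2 : RInt (fun t => Im (/ ((t, y2) - (p, q)))%C) x1 x2 <= 0).
  { replace 0 with (RInt (fun _ : R => 0) x1 x2) by (rewrite RInt_const; apply Rmult_0_r).
    apply RInt_le; try lra; [exact B2 | apply ex_RInt_const |].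
    intros t Ht. simpl.
    assert (0 < / ((t + - p) * ((t + - p) * 1) + (y2 + - q) * ((y2 + - q) * 1)))
      by (apply Rinv_0_lt_compat, sum_sq_pos; lra).
    unfold Rdiv. nra. }
  assert (I3 : RInt (fun t => Re (/ ((x1, t) - (p, q)))%C) y1 y2 <= 0).
  { replace 0 with (RInt (fun _ : R => 0) y1 y2) by (rewrite RInt_const; apply Rmult_0_r).
    apply RInt_le; try lra; [exact B3 | apply ex_RInt_const |].
    intros t Ht. simpl.
    assert (0 < / ((x1 + - p) * ((x1 + - p) * 1) + (t + - q) * ((t + - q) * 1)))
      by (apply Rinv_0_lt_compat, sum_sq_pos; lra).
    unfold Rdiv. nra. }
  assert (I4 : 0 <= RInt (fun t => Re (/ ((x2, t) - (p, q)))%C) y1 y2).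
  { apply RInt_ge_0; try lra; [exact B4 |].
    intros t Ht. simpl.
    assert (0 < / ((x2 + - p) * ((x2 + - p) * 1) + (t + - q) * ((t + - q) * 1)))
      by (apply Rinv_0_lt_compat, sum_sq_pos; lra).
    unfold Rdiv. nra. }
  lra.
Qed.

(* Landau's trick: applying Cauchy's formula to the powers of [f] removes the constant. *)
Theorem max_modulus_rect (l : list C) (f : C -> C) (M x1 x2 y1 y2 : R) (z0 : C) :
  interior_rect x1 x2 y1 y2 z0 -> rect_cont f x1 x2 y1 y2 ->
  (forall z, in_rect x1 x2 y1 y2 z -> ~ In z l -> cdiff f z) -> ~ In z0 l ->
  0 < M -> (forall z, on_edge x1 x2 y1 y2 z -> Cmod (f z) <= M) ->
  Cmod (f z0) <= M.
Proof.
  intros Hz Hc Hd Hl HM HB.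
  assert (Hx : x1 <= x2) by (destruct Hz; lra). assert (Hy : y1 <= y2) by (destruct Hz; lra).
  set (k := rect_int (fun w => / (w - z0))%C x1 x2 y1 y2).
  assert (Hk : 0 < Cmod k).
  { set (D := (x2 - x1) ^ 2 + (y2 - y1) ^ 2).
    assert (HD : 0 < D) by (destruct Hz; unfold D; simpl; nra).
    apply Rlt_le_trans with ((x2 - x1) * ((Im z0 - y1) / D)).
    - destruct Hz. apply Rmult_lt_0_compat; [lra|]. apply Rdiv_lt_0_compat; lra.
    - apply index_lower; auto. intros x Hxx. destruct Hz. unfold D. simpl.
      apply Rplus_le_compat; nra. }
  set (r := Rmin (Rmin (Re z0 - x1) (x2 - Re z0)) (Rmin (Im z0 - y1) (y2 - Im z0))).
  assert (Hr : 0 < r) by (destruct Hz; unfold r; repeat apply Rmin_pos; lra).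
  assert (Hdist : forall w, on_edge x1 x2 y1 y2 w -> r <= Cmod (w - z0)).
  { intros w [Hw1 Hw2]. pose proof (re_le_Cmod (w - z0)) as R1.
    pose proof (im_le_Cmod (w - z0)) as R2.
    assert (r <= Re z0 - x1 /\ r <= x2 - Re z0 /\ r <= Im z0 - y1 /\ r <= y2 - Im z0).
    { unfold r. pose proof (Rmin_l (Rmin (Re z0 - x1) (x2 - Re z0)) (Rmin (Im z0 - y1) (y2 - Im z0))).
      pose proof (Rmin_r (Rmin (Re z0 - x1) (x2 - Re z0)) (Rmin (Im z0 - y1) (y2 - Im z0))).
      pose proof (Rmin_l (Re z0 - x1) (x2 - Re z0)). pose proof (Rmin_r (Re z0 - x1) (x2 - Re z0)).
      pose proof (Rmin_l (Im z0 - y1) (y2 - Im z0)). pose proof (Rmin_r (Im z0 - y1) (y2 - Im z0)).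
      lra. }
    replace (Re (w - z0)) with (Re w - Re z0) in R1 by (destruct w, z0; simpl; ring).
    replace (Im (w - z0)) with (Im w - Im z0) in R2 by (destruct w, z0; simpl; ring).
    pose proof (Rle_abs (Re w - Re z0)); pose proof (Rle_abs (- (Re w - Re z0))).
    pose proof (Rle_abs (Im w - Im z0)); pose proof (Rle_abs (- (Im w - Im z0))).
    rewrite Rabs_Ropp in *. lra. }
  set (P := 2 * ((x2 - x1) + (y2 - y1))). assert (HP : 0 <= P) by (unfold P; lra).
  assert (K : forall n, Cmod (f z0) ^ n * Cmod k <= P * (M ^ n / r)).
  { intros n.
    assert (E := cauchy_rect l (fun w => Cpow (f w) n) x1 x2 y1 y2 z0 Hz
      ltac:(intros w Hw; apply ccont_pow; exact (Hc w Hw))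
      ltac:(intros w Hw Hn; apply cdiff_pow; exact (Hd w Hw Hn)) Hl).
    rewrite <- Cmod_pow, <- Cmod_mult. unfold k. cbv beta in E. rewrite <- E.
    apply rect_int_le; auto.
    - intros w Hw. apply ccont_mult; [apply ccont_pow, Hc, Hw|].
      now apply (edge_cont_inv x1 x2 y1 y2).
    - intros w Hw. assert (N : (w - z0)%C <> 0%C).
      { apply Cminus_neq0. now apply (edge_not_interior x1 x2 y1 y2). }
      rewrite Cmod_div, Cmod_pow by exact N.
      apply Rmult_le_compat.
      + apply pow_le, Cmod_ge_0.
      + left. now apply Rinv_0_lt_compat, Cmod_gt_0.
      + apply pow_incr. split; [apply Cmod_ge_0 | now apply HB].
      + apply Rinv_le_contravar; [exact Hr | now apply Hdist]. }
  apply Rnot_lt_le. intros Hlt.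
  (* Divided by [M ^ n], the bound [K] keeps all powers of [q] below a fixed number, which is
     impossible for [q > 1]. *)
  set (q := Cmod (f z0) / M). assert (Hq : 1 < q) by (unfold q; apply Rlt_div_r; lra).
  destruct (Pow_x_infinity q) with (b := P / (r * Cmod k) + 1) as [n Hn].
  { rewrite Rabs_pos_eq; lra. }
  specialize (Hn n (le_n n)). rewrite Rabs_pos_eq in Hn by (apply pow_le; lra).
  specialize (K n).
  assert (E : q ^ n = Cmod (f z0) ^ n / M ^ n).
  { unfold q, Rdiv. rewrite Rpow_mult_distr, pow_inv. reflexivity. }
  assert (HMn : 0 < M ^ n) by (apply pow_lt; lra).
  assert (q ^ n <= P / (r * Cmod k)); [|lra].
  rewrite E. apply Rle_div_l; [lra|].
  apply Rmult_le_reg_r with (Cmod k); [exact Hk|].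
  eapply Rle_trans; [exact K|]. right. field. split; apply Rgt_not_eq; lra.
Qed.

(** * The Borel-Carathéodory inequality *)

(** The line [Re = M] is the perpendicular bisector of the segment from [0] to [2 M], and [g] lies
    on the side of [0]. *)
Lemma Cmod_le_reflect (g : C) (M : R) : 0 < M -> Re g <= M -> Cmod g <= Cmod (RtoC (2 * M) - g).
Proof.
  intros HM Hg. destruct g as [a b]. simpl in Hg. unfold Cmod; simpl. apply sqrt_le_1_alt. nra.
Qed.

(* The Schwarz lemma for [g / (2 M - g)], [g = f - f s0], on a square instead of a
   disc: the boundary of the square is at distance at least [rho] from the centre. *)
Theorem borel_caratheodory_square (f : C -> C) (s0 z : C) (rho M theta : R) :
  0 < rho -> 0 < M -> theta < 1 ->
  rect_diff f (Re s0 - rho) (Re s0 + rho) (Im s0 - rho) (Im s0 + rho) ->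
  (forall w, in_rect (Re s0 - rho) (Re s0 + rho) (Im s0 - rho) (Im s0 + rho) w ->
     Re (f w - f s0)%C <= M) ->
  Cmod (z - s0) <= theta * rho ->
  Cmod (f z - f s0) <= 2 * M / (1 - theta).
Proof.
  intros Hr HM Ht Hd HB Hz.
  (* The quotient [k] below has [s0] as its exceptional point, so this case is settled apart. *)
  destruct (Ceq_dec z s0) as [->|N].
  { replace (f s0 - f s0)%C with (RtoC 0) by ring. rewrite Cmod_0.
    apply Rdiv_le_0_compat; lra. }
  assert (Hs : in_rect (Re s0 - rho) (Re s0 + rho) (Im s0 - rho) (Im s0 + rho) s0)
    by (split; lra).
  set (g := fun w => (f w - f s0)%C).
  assert (Dn : forall w, in_rect (Re s0 - rho) (Re s0 + rho) (Im s0 - rho) (Im s0 + rho) w ->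
     (RtoC (2 * M) - g w)%C <> 0%C).
  { intros w Hw E. specialize (HB w Hw). fold (g w) in HB.
    apply (f_equal Re) in E. destruct (g w) as [a b]. simpl in *. lra. }
  assert (Gd : rect_diff g (Re s0 - rho) (Re s0 + rho) (Im s0 - rho) (Im s0 + rho)).
  { intros w Hw. apply cdiff_minus; [exact (Hd w Hw) | apply cdiff_const]. }
  set (h := fun w => (g w / (RtoC (2 * M) - g w))%C).
  assert (Hh : rect_diff h (Re s0 - rho) (Re s0 + rho) (Im s0 - rho) (Im s0 + rho)).
  { intros w Hw. apply cdiff_div; [now apply Dn | exact (Gd w Hw) |].
    apply cdiff_minus; [apply cdiff_const | exact (Gd w Hw)]. }
  assert (h0 : h s0 = RtoC 0).
  { unfold h, g. replace (f s0 - f s0)%C with (RtoC 0) by ring. unfold Cdiv; ring. }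
  assert (h1 : forall w, in_rect (Re s0 - rho) (Re s0 + rho) (Im s0 - rho) (Im s0 + rho) w ->
     Cmod (h w) <= 1).
  { intros w Hw. unfold h. rewrite Cmod_div by now apply Dn.
    apply Rle_div_l; [now apply Cmod_gt_0, Dn|]. rewrite Rmult_1_l.
    apply Cmod_le_reflect; auto. exact (HB w Hw). }
  destruct (difference_quotient h s0 (Hh s0 Hs)) as (k & Ek & _ & Kc & Kd).
  assert (Hzi : interior_rect (Re s0 - rho) (Re s0 + rho) (Im s0 - rho) (Im s0 + rho) z).
  { pose proof (re_le_Cmod (z - s0)) as R1. pose proof (im_le_Cmod (z - s0)) as R2.
    replace (Re (z - s0)) with (Re z - Re s0) in R1 by (destruct z, s0; simpl; ring).
    replace (Im (z - s0)) with (Im z - Im s0) in R2 by (destruct z, s0; simpl; ring).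
    assert (Cmod (z - s0) < rho) by (eapply Rle_lt_trans; [exact Hz|]; nra).
    assert (A1 : Rabs (Re z - Re s0) < rho) by lra. assert (A2 : Rabs (Im z - Im s0) < rho) by lra.
    apply Rabs_def2 in A1, A2. split; lra. }
  assert (Kz : Cmod (k z) <= / rho).
  { apply (max_modulus_rect (s0 :: nil) k (/ rho) (Re s0 - rho) (Re s0 + rho) (Im s0 - rho) (Im s0 + rho));
      auto.
    - intros w Hw. apply Kc. now apply cdiff_ccont, Hh.
    - intros w Hw Hn. apply Kd; [|now apply Hh]. intros ->. apply Hn. now left.
    - intros [E|[]]. now apply N.
    - now apply Rinv_0_lt_compat.
    - intros w [Hw1 Hw2].
      assert (Dist : rho <= Cmod (w - s0)).
      { pose proof (re_le_Cmod (w - s0)) as R1. pose proof (im_le_Cmod (w - s0)) as R2.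
        replace (Re (w - s0)) with (Re w - Re s0) in R1 by (destruct w, s0; simpl; ring).
        replace (Im (w - s0)) with (Im w - Im s0) in R2 by (destruct w, s0; simpl; ring).
        pose proof (Rle_abs (Re w - Re s0)); pose proof (Rle_abs (- (Re w - Re s0))).
        pose proof (Rle_abs (Im w - Im s0)); pose proof (Rle_abs (- (Im w - Im s0))).
        rewrite Rabs_Ropp in *. lra. }
      specialize (h1 w Hw1). specialize (Ek w). rewrite h0 in Ek.
      replace (h w - 0)%C with (h w) in Ek by ring.
      rewrite Ek, Cmod_mult in h1.
      apply Rmult_le_reg_r with rho; [exact Hr|]. rewrite Rinv_l by lra.
      eapply Rle_trans; [|exact h1]. apply Rmult_le_compat_l; [apply Cmod_ge_0 | exact Dist]. }
  assert (Hhz : Cmod (h z) <= theta).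
  { specialize (Ek z). rewrite h0 in Ek. replace (h z - 0)%C with (h z) in Ek by ring.
    rewrite Ek, Cmod_mult.
    replace theta with (/ rho * (theta * rho)) by (field; lra).
    apply Rmult_le_compat; auto using Cmod_ge_0. }
  assert (Hzin : in_rect (Re s0 - rho) (Re s0 + rho) (Im s0 - rho) (Im s0 + rho) z)
    by (destruct Hzi; split; lra).
  change (f z - f s0)%C with (g z).
  assert (Eg : Cmod (g z) = Cmod (h z) * Cmod (RtoC (2 * M) - g z)).
  { rewrite <- Cmod_mult. f_equal. unfold h. field. now apply Dn. }
  pose proof (Cmod_minus_le (RtoC (2 * M)) (g z)) as T.
  rewrite Cmod_R, Rabs_pos_eq in T by lra.
  pose proof (Cmod_ge_0 (g z)). pose proof (Cmod_ge_0 (h z)).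
  pose proof (Cmod_ge_0 (RtoC (2 * M) - g z)).
  apply Rle_div_r; [lra|].
  (* Solving [g = h (2 M - g)] for the modulus of [g], given that of [h] is at most [theta < 1]. *)
  assert (Cmod (g z) <= theta * (2 * M + Cmod (g z))).
  { rewrite Eg at 1. apply Rmult_le_compat; auto. }
  nra.
Qed.

(** * The complex exponential *)

Lemma Cexp_plus (z w : C) : Cexp (z + w) = (Cexp z * Cexp w)%C.
Proof.
  destruct z as [a b], w as [c d]. unfold Cexp; simpl. rewrite exp_plus, cos_plus, sin_plus.
  apply injective_projections; simpl; ring.
Qed.

Lemma Cmod_Cexp (z : C) : Cmod (Cexp z) = exp (Re z).
Proof.
  destruct z as [a b]. unfold Cexp, Cmod; simpl.
  replace (exp a * cos b * (exp a * cos b * 1) + exp a * sin b * (exp a * sin b * 1))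
    with (exp a * exp a * (Rsqr (sin b) + Rsqr (cos b))) by (unfold Rsqr; ring).
  rewrite sin2_cos2, Rmult_1_r. apply sqrt_square. left; apply exp_pos.
Qed.

Lemma Cexp_neq0 (z : C) : Cexp z <> 0%C.
Proof. apply Cmod_gt_0. rewrite Cmod_Cexp. apply exp_pos. Qed.

Lemma Cexp_0 : Cexp 0 = 1%C.
Proof. unfold Cexp; simpl. rewrite exp_0, cos_0, sin_0. apply injective_projections; simpl; ring. Qed.

Lemma derivable_pt_lim_at_0 (f : R -> R) (l : R) : derivable_pt_lim f 0 l ->
  forall eps, 0 < eps -> exists d, 0 < d /\
    forall h, Rabs h < d -> Rabs (f h - f 0 - l * h) <= eps * Rabs h.
Proof.
  intros H eps He. destruct (H eps He) as [d Hd]. exists d. split; [apply cond_pos|].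
  intros h Hh. destruct (Req_dec h 0) as [->|N].
  - replace (f 0 - f 0 - l * 0) with 0 by ring. rewrite Rabs_R0; lra.
  - specialize (Hd h N Hh). rewrite Rplus_0_l in Hd.
    replace (f h - f 0 - l * h) with (((f h - f 0) / h - l) * h) by (field; exact N).
    rewrite Rabs_mult. apply Rmult_le_compat_r; [apply Rabs_pos | lra].
Qed.

Lemma cdiff_Cexp_0 : cdiff Cexp 0.
Proof.
  apply cdiff_eps with (RtoC 1). intros eps Heps. rewrite Cexp_0.
  (* Each component of the remainder will be at most [3 * e * c], and [6 * e <= eps]; the bound
     [e <= 1] keeps [exp x] below [2]. *)
  set (e := Rmin 1 (eps / 8)). assert (He : 0 < e) by (apply Rmin_pos; lra).
  assert (e1 : e <= 1) by apply Rmin_l. assert (e2 : e <= eps / 8) by apply Rmin_r.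
  destruct (derivable_pt_lim_at_0 exp 1) with (eps := e) as (d1 & Hd1 & D1); auto.
  { pose proof (derivable_pt_lim_exp 0) as X. now rewrite exp_0 in X. }
  destruct (derivable_pt_lim_at_0 sin 1) with (eps := e) as (d2 & Hd2 & D2); auto.
  { pose proof (derivable_pt_lim_sin 0) as X. now rewrite cos_0 in X. }
  destruct (derivable_pt_lim_at_0 cos 0) with (eps := e) as (d3 & Hd3 & D3); auto.
  { pose proof (derivable_pt_lim_cos 0) as X. now rewrite sin_0, Ropp_0 in X. }
  rewrite exp_0 in D1. rewrite sin_0 in D2. rewrite cos_0 in D3.
  exists (Rmin (Rmin d1 d2) (Rmin d3 (e / 2))).
  split; [repeat apply Rmin_pos; lra|].
  intros w Hw. replace (w - 0)%C with w in * by ring. destruct w as [x y].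
  pose proof (re_le_Cmod (x, y)) as R1. pose proof (im_le_Cmod (x, y)) as R2.
  unfold Re, Im in R1, R2; simpl in R1, R2.
  set (c := Cmod (x, y)) in *.
  pose proof (Rmin_l (Rmin d1 d2) (Rmin d3 (e / 2))). pose proof (Rmin_r (Rmin d1 d2) (Rmin d3 (e / 2))).
  pose proof (Rmin_l d1 d2). pose proof (Rmin_r d1 d2).
  pose proof (Rmin_l d3 (e / 2)). pose proof (Rmin_r d3 (e / 2)).
  specialize (D1 x ltac:(lra)). specialize (D2 y ltac:(lra)). specialize (D3 y ltac:(lra)).
  rewrite Rminus_0_r in D2. rewrite Rmult_0_l, Rminus_0_r in D3. rewrite Rmult_1_l in D1, D2.
  assert (Ex : Rabs (exp x - 1) <= e).
  { replace (exp x - 1) with (exp x - 1 - x + x) by ring.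
    eapply Rle_trans; [apply Rabs_triang|]. pose proof (Rabs_pos x). nra. }
  assert (Ex2 : Rabs (exp x) <= 2).
  { replace (exp x) with (exp x - 1 + 1) by ring.
    eapply Rle_trans; [apply Rabs_triang|]. rewrite Rabs_R1. lra. }
  eapply Rle_trans; [apply Cmod_le_box with (h := 3 * e * c) (k := 3 * e * c)|].
  - simpl.
    replace (exp x * cos y + - (1) + - (1 * x - 0 * y))
      with (exp x * (cos y - 1) + (exp x - 1 - x)) by ring.
    eapply Rle_trans; [apply Rabs_triang|]. rewrite Rabs_mult.
    pose proof (Rabs_pos (cos y - 1)). pose proof (Rabs_pos (exp x)). pose proof (Rabs_pos y).
    assert (Rabs (exp x) * Rabs (cos y - 1) <= 2 * (e * c)) by (apply Rmult_le_compat; nra).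
    nra.
  - simpl.
    replace (exp x * sin y + - 0 + - (1 * y + 0 * x))
      with (exp x * (sin y - y) + (exp x - 1) * y) by ring.
    eapply Rle_trans; [apply Rabs_triang|]. rewrite !Rabs_mult.
    pose proof (Rabs_pos (sin y - y)). pose proof (Rabs_pos (exp x)). pose proof (Rabs_pos y).
    pose proof (Rabs_pos (exp x - 1)).
    assert (Rabs (exp x) * Rabs (sin y - y) <= 2 * (e * c)) by (apply Rmult_le_compat; nra).
    assert (Rabs (exp x - 1) * Rabs y <= e * c) by (apply Rmult_le_compat; nra).
    lra.
  - assert (0 <= c) by apply Cmod_ge_0. nra.
Qed.

Lemma cdiff_Cexp (z : C) : cdiff Cexp z.
Proof.
  apply cdiff_ext with (fun w => Cexp z * Cexp (w - z))%C.
  - intros w. rewrite <- Cexp_plus. f_equal. ring.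
  - apply cdiff_mult; [apply cdiff_const|].
    apply (cdiff_comp Cexp (fun w => w - z)%C).
    + apply cdiff_minus; [apply cdiff_id | apply cdiff_const].
    + replace (z - z)%C with (RtoC 0) by ring. apply cdiff_Cexp_0.
Qed.

Lemma cdiff_natCpow (n : nat) (f : C -> C) (z : C) :
  cdiff f z -> cdiff (fun w => natCpow n (f w)) z.
Proof.
  intros H. apply (cdiff_comp Cexp (fun w => f w * RtoC (ln (INR n)))%C).
  - apply cdiff_mult; [exact H | apply cdiff_const].
  - apply cdiff_Cexp.
Qed.

Lemma Cmod_natCpow (n : nat) (s : C) : Cmod (natCpow n s) = Rpower (INR n) (Re s).
Proof.
  unfold natCpow. rewrite Cmod_Cexp. unfold Rpower. f_equal. destruct s; simpl; ring.
Qed.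

Lemma natCpow_neq0 (n : nat) (s : C) : natCpow n s <> 0%C.
Proof. apply Cexp_neq0. Qed.

(** * Newman's contour integral *)

(* The factor [1 + ((w - a) / R)^2] vanishes at [a + i R] and [a - i R], where the
   bounds for the Dirichlet series and for its partial sums blow up. *)
Definition kernel (a R Y : R) (w : C) : C :=
  (Cexp (w * RtoC Y) * (1 + (w - RtoC a) * (w - RtoC a) / RtoC (R * R)))%C.

Lemma cdiff_kernel (a R Y : R) (w : C) : cdiff (kernel a R Y) w.
Proof.
  assert (D : cdiff (fun w => w - RtoC a)%C w)
    by (apply cdiff_minus; [apply cdiff_id | apply cdiff_const]).
  apply cdiff_mult.
  - apply (cdiff_comp Cexp (fun w => w * RtoC Y)%C); [|apply cdiff_Cexp].
    apply cdiff_mult; [apply cdiff_id | apply cdiff_const].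
  - apply cdiff_plus; [apply cdiff_const|].
    apply cdiff_mult; [now apply cdiff_mult | apply cdiff_const].
Qed.

Lemma cdiff_kernel_div (a R Y : R) (w : C) : w <> 0%C ->
  cdiff (fun w => kernel a R Y w / w)%C w.
Proof. intros N. apply cdiff_div; [exact N | apply cdiff_kernel | apply cdiff_id]. Qed.

Lemma Cmod_kernel (a R Y s t : R) : 0 < R ->
  Cmod (kernel a R Y ((a + s)%R, t)) =
  exp ((a + s) * Y) * (Cmod (RtoC (R * R) + (s, t) * (s, t)) / (R * R)).
Proof.
  intros HR. unfold kernel.
  replace (((a + s)%R, t) - RtoC a)%C with ((s, t) : C)
    by (apply injective_projections; simpl; ring).
  rewrite Cmod_mult, Cmod_Cexp. f_equal.
  - f_equal. simpl. ring.
  - assert (N : RtoC (R * R) <> 0%C) by (intros E; apply RtoC_inj in E; nra).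
    replace (1 + (s, t) * (s, t) / RtoC (R * R))%C
      with ((RtoC (R * R) + (s, t) * (s, t)) / RtoC (R * R))%C by (field; exact N).
    rewrite Cmod_div, Cmod_R, Rabs_pos_eq by (auto; nra). reflexivity.
Qed.

(** For [t * t = R * R] the numerator [R R + (s + i t)^2] equals [s (s + 2 i t)]. The factor [s] is
    what cancels the [1 / s] in the bounds for the tail and for the partial sum; the pole
    contributes only [1 / R] at this height. *)
Lemma kernel_bound_edge (a R Y s t : R) : 0 < R -> Rabs s <= R -> Rabs t = R ->
  Cmod (kernel a R Y ((a + s)%R, t) / ((a + s)%R, t)) <= exp ((a + s) * Y) * (3 * Rabs s / (R * R)).
Proof.
  intros HR Hs Ht.
  assert (Hw : R <= Cmod ((a + s)%R, t)) by (rewrite <- Ht; apply (im_le_Cmod ((a + s)%R, t))).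
  assert (N : (((a + s)%R, t) : C) <> 0%C) by (apply Cmod_gt_0; lra).
  rewrite Cmod_div, Cmod_kernel by auto.
  assert (Htt : R * R = t * t) by (rewrite <- Ht, <- Rabs_mult, Rabs_pos_eq; nra).
  assert (E : (RtoC (R * R) + (s, t) * (s, t))%C = (RtoC s * (s, (2 * t)%R))%C).
  { rewrite Htt. apply injective_projections; simpl; ring. }
  assert (B : Cmod (s, (2 * t)%R) <= 3 * R).
  { eapply Rle_trans; [apply Cmod_le_box with (h := R) (k := 2 * R)|lra]; simpl; [exact Hs|].
    rewrite Rabs_mult, Ht, Rabs_pos_eq; lra. }
  rewrite E, Cmod_mult, Cmod_R. unfold Rdiv at 1. rewrite Rmult_assoc.
  apply Rmult_le_compat_l; [left; apply exp_pos|].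
  apply Rle_trans with (Rabs s * (3 * R) / (R * R) * / R).
  - apply Rmult_le_compat.
    + apply Rdiv_le_0_compat; [|nra]. apply Rmult_le_pos; [apply Rabs_pos | apply Cmod_ge_0].
    + left; apply Rinv_0_lt_compat; lra.
    + apply Rmult_le_compat_r; [left; apply Rinv_0_lt_compat; nra|].
      apply Rmult_le_compat_l; [apply Rabs_pos | exact B].
    + apply Rinv_le_contravar; auto.
  - right. field. lra.
Qed.

Lemma kernel_bound (a R Y s t d : R) : 0 < R -> Rabs s <= R -> Rabs t <= R ->
  0 < d <= Cmod ((a + s)%R, t) ->
  Cmod (kernel a R Y ((a + s)%R, t) / ((a + s)%R, t)) <= exp ((a + s) * Y) * (3 / d).
Proof.
  intros HR Hs Ht Hd.
  assert (N : (((a + s)%R, t) : C) <> 0%C) by (apply Cmod_gt_0; lra).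
  rewrite Cmod_div, Cmod_kernel by auto.
  assert (B : Cmod (RtoC (R * R) + (s, t) * (s, t)) <= 3 * (R * R)).
  { eapply Rle_trans; [apply Cmod_triangle|]. rewrite Cmod_mult, Cmod_R, Rabs_pos_eq by nra.
    assert (Cmod (s, t) * Cmod (s, t) = s * s + t * t).
    { unfold Cmod; simpl. rewrite sqrt_sqrt by nra. ring. }
    apply Rabs_le_between in Hs, Ht. nra. }
  unfold Rdiv at 1. rewrite Rmult_assoc.
  apply Rmult_le_compat_l; [left; apply exp_pos|].
  apply Rmult_le_compat.
  - apply Rdiv_le_0_compat; [apply Cmod_ge_0 | nra].
  - left; apply Rinv_0_lt_compat; lra.
  - apply Rle_div_l; [nra | exact B].
  - apply Rinv_le_contravar; lra.
Qed.

Lemma RInt_inv_affine (k b : R) (r : R) : 0 < b -> 0 <= r ->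
  is_RInt (fun t => k / (b + t)) 0 r (k * ln (1 + r / b)) /\
  is_RInt (fun t => k / (b - t)) (- r) 0 (k * ln (1 + r / b)).
Proof.
  intros Hb Hr.
  assert (E : ln (1 + r / b) = ln (b + r) - ln b).
  { rewrite <- ln_div by lra. f_equal. field; lra. }
  split.
  - replace (k * ln (1 + r / b)) with (minus (k * ln (b + r)) (k * ln (b + 0))).
    + apply (is_RInt_derive (V := R_CompleteNormedModule) (fun t => k * ln (b + t)) (fun t => k / (b + t)));
        intros t Ht; rewrite Rmin_left, Rmax_right in Ht by lra.
      * auto_derive; [lra | field; lra].
      * apply continuous_Rdiv; [apply continuous_const | | lra].
        apply (continuous_plus (V := R_NormedModule)); [apply continuous_const | apply continuous_id].
    + rewrite E, Rplus_0_r. unfold minus, plus, opp; simpl. ring.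
  - replace (k * ln (1 + r / b)) with (minus (- k * ln (b - 0)) (- k * ln (b - - r))).
    + apply (is_RInt_derive (V := R_CompleteNormedModule) (fun t => - k * ln (b - t)) (fun t => k / (b - t)));
        intros t Ht; rewrite Rmin_left, Rmax_right in Ht by lra.
      * auto_derive; [lra | field; lra].
      * apply continuous_Rdiv; [apply continuous_const | | lra].
        apply (continuous_minus (V := R_NormedModule)); [apply continuous_const | apply continuous_id].
    + rewrite E, Rminus_0_r. replace (b - - r) with (b + r) by ring.
      unfold minus, plus, opp; simpl. ring.
Qed.

(** On a vertical line at distance [b] from the pole, [1 / |w|] is comparable to [1 / (b + |t|)].
    Integrating it costs a logarithm of [r / b], where its maximum would cost [r / b] itself. *)
Lemma CInt_le_log (g : R -> C) (k b r : R) : 0 < b -> 0 <= r -> cont_on g (- r) r ->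
  (forall t, - r <= t <= r -> Cmod (g t) <= k / (b + Rabs t)) ->
  Cmod (CInt g (- r) r) <= 2 * k * ln (1 + r / b).
Proof.
  intros Hb Hr Hc H. destruct (RInt_inv_affine k b r Hb Hr) as [I1 I2].
  rewrite (CInt_Chasles g (- r) 0 r) by (auto; lra).
  eapply Rle_trans; [apply Cmod_triangle|].
  assert (A : Cmod (CInt g (- r) 0) <= RInt (fun t => k / (b - t)) (- r) 0).
  { apply CInt_le; try lra.
    - apply (cont_on_sub g (- r) r); auto; lra.
    - eexists; exact I2.
    - intros t Ht. eapply Rle_trans; [apply H; lra|]. rewrite Rabs_left1 by lra. right; f_equal. }
  assert (B : Cmod (CInt g 0 r) <= RInt (fun t => k / (b + t)) 0 r).
  { apply CInt_le; try lra.
    - apply (cont_on_sub g (- r) r); auto; lra.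
    - eexists; exact I1.
    - intros t Ht. eapply Rle_trans; [apply H; lra|]. rewrite Rabs_pos_eq by lra. lra. }
  rewrite (is_RInt_unique _ _ _ _ I1) in B. rewrite (is_RInt_unique _ _ _ _ I2) in A. lra.
Qed.

Lemma mul_exp_neg_le (u Y : R) : 0 < Y -> u * exp (- u * Y) <= / Y.
Proof.
  intros HY. apply Rmult_le_reg_r with Y; [exact HY|]. rewrite Rinv_l by lra.
  pose proof (exp_ineq1_le (u * Y)).
  replace (- u * Y) with (- (u * Y)) by ring. rewrite exp_Ropp.
  pose proof (exp_pos (u * Y)).
  replace (u * / exp (u * Y) * Y) with (u * Y / exp (u * Y)) by (field; lra).
  apply Rle_div_l; lra.
Qed.

Section NewmanContour.

Variables (H S : C -> C) (a rad eta Y B1 B2 : R).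
Hypotheses (Ha : -1 <= a) (Hae : a < eta) (Heta : 0 < eta < 1) (HR : 2 <= rad) (HY : 0 < Y).
Hypothesis H_diff : rect_diff H (a - eta) (a + rad) (- rad) rad.
Hypothesis S_diff : forall z, cdiff S z.
(** The weights match what the kernel supplies at distance [u] from [Re w = a]: the exponential
    comes from y^w, and [u] from the zeros on the horizontal sides; on the vertical sides [u] is
    [rad]. *)
Hypothesis tail_bound : forall u t, 0 < u <= rad -> Rabs t <= rad ->
  Cmod (H ((a + u)%R, t) - S ((a + u)%R, t)) * u * exp (u * Y) <= B1.
Hypothesis sum_bound : forall u t, 0 < u <= rad -> Rabs t <= rad ->
  Cmod (S ((a - u)%R, t)) * u * exp (- u * Y) <= B1.
Hypothesis H_bound : forall u t, 0 <= u <= eta -> Rabs t <= rad -> Cmod (H ((a - u)%R, t)) <= B2.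

Let E (w : C) : C := (kernel a rad Y w / w)%C.
Let F (w : C) : C := ((H w - S w) * E w)%C.
Let FH (w : C) : C := (H w * E w)%C.
Let FS (w : C) : C := (S w * E w)%C.

Lemma B1_nonneg : 0 <= B1.
Proof.
  eapply Rle_trans; [|apply (sum_bound 1 0); [lra | rewrite Rabs_R0; lra]].
  apply Rmult_le_pos; [|left; apply exp_pos].
  apply Rmult_le_pos; [apply Cmod_ge_0 | lra].
Qed.

Lemma edge_neq0 (x y : R) : x <> 0 \/ y <> 0 -> ((x, y) : C) <> 0%C.
Proof. intros N E0. injection E0. lra. Qed.

Lemma E_cont (z : C) : z <> 0%C -> ccont (U := C_UniformSpace) E z.
Proof. intros N. now apply cdiff_ccont, cdiff_kernel_div. Qed.

Lemma F_cont (z : C) : in_rect (a - eta) (a + rad) (- rad) rad z -> z <> 0%C ->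
  ccont (U := C_UniformSpace) F z.
Proof.
  intros Hz N. apply ccont_mult; [|now apply E_cont].
  apply ccont_minus; apply cdiff_ccont; auto.
Qed.

Lemma FH_cont (z : C) : in_rect (a - eta) (a + rad) (- rad) rad z -> z <> 0%C ->
  ccont (U := C_UniformSpace) FH z.
Proof. intros Hz N. apply ccont_mult; [apply cdiff_ccont; auto | now apply E_cont]. Qed.

Lemma FS_cont (z : C) : z <> 0%C -> ccont (U := C_UniformSpace) FS z.
Proof. intros N. apply ccont_mult; [apply cdiff_ccont; auto | now apply E_cont]. Qed.

Lemma cont_on_H (f : C -> C) (x1 x2 y : R) :
  (forall x, x1 <= x <= x2 -> ccont (U := C_UniformSpace) f (x, y)) ->
  cont_on (fun x => f (x, y)) x1 x2.
Proof.
  intros Hc. apply (rect_cont_H f x1 x2 y y); [|lra].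
  intros [u v] [Hu Hv]. simpl in *. replace v with y by lra. now apply Hc.
Qed.

Lemma cont_on_V (f : C -> C) (x y1 y2 : R) :
  (forall y, y1 <= y <= y2 -> ccont (U := C_UniformSpace) f (x, y)) ->
  cont_on (fun y => f (x, y)) y1 y2.
Proof.
  intros Hc. apply (rect_cont_V f x x y1 y2); [|lra].
  intros [u v] [Hu Hv]. simpl in *. replace u with x by lra. now apply Hc.
Qed.

Lemma right_H (y : R) : y = rad \/ y = - rad ->
  Cmod (h_int F a (a + rad) y) <= 3 * B1 * exp (a * Y) / rad.
Proof.
  intros Ey. assert (Ay : Rabs y = rad).
  { destruct Ey as [->| ->]; [|rewrite Rabs_Ropp]; apply Rabs_pos_eq; lra. }
  unfold h_int.
  replace (3 * B1 * exp (a * Y) / rad) with ((a + rad - a) * (B1 * (exp (a * Y) * (3 / (rad * rad)))))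
    by (field; lra).
  apply CInt_le_const; [lra | |].
  - apply cont_on_H. intros x Hx. apply F_cont; [split; simpl; lra|]. apply edge_neq0; lra.
  - intros x Hx. unfold F. rewrite Cmod_mult.
    set (u := x - a). replace x with (a + u) by (unfold u; ring).
    pose proof (kernel_bound_edge a rad Y u y ltac:(lra)
      ltac:(unfold u; rewrite Rabs_pos_eq; lra) Ay) as K.
    rewrite (Rabs_pos_eq u) in K by (unfold u; lra).
    pose proof B1_nonneg as HB. pose proof (exp_pos (a * Y)).
    assert (0 < 3 / (rad * rad)) by (apply Rdiv_lt_0_compat; nra).
    (* At [u = 0] nothing is assumed about [H - S], but this point is a zero of the kernel. *)
    destruct (Req_dec u 0) as [U0|U0].
    + rewrite U0 in *. replace (3 * 0 / (rad * rad)) with 0 in K by (field; lra).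
      rewrite Rmult_0_r in K. fold (E ((a + 0)%R, y)) in K. pose proof (Cmod_ge_0 (E ((a + 0)%R, y))).
      replace (Cmod (E ((a + 0)%R, y))) with 0 by lra. rewrite Rmult_0_r.
      apply Rmult_le_pos; [exact HB | nra].
    + assert (Hu : 0 < u) by (unfold u in *; lra).
      pose proof (tail_bound u y ltac:(unfold u in *; lra) ltac:(lra)) as T.
      eapply Rle_trans; [apply Rmult_le_compat_l; [apply Cmod_ge_0 | exact K]|].
      rewrite Rmult_plus_distr_r, exp_plus.
      replace (Cmod (H ((a + u)%R, y) - S ((a + u)%R, y)) *
        (exp (a * Y) * exp (u * Y) * (3 * u / (rad * rad)))) with
        (Cmod (H ((a + u)%R, y) - S ((a + u)%R, y)) * u * exp (u * Y) * (exp (a * Y) * (3 / (rad * rad))))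
        by (field; lra).
      apply Rmult_le_compat_r; [|exact T]. nra.
Qed.

Lemma right_V : Cmod (v_int F (a + rad) (- rad) rad) <= 12 * B1 * exp (a * Y) / rad.
Proof.
  unfold v_int. replace (12 * B1 * exp (a * Y) / rad) with ((rad - - rad) * (B1 / rad * (exp (a * Y) * (6 / rad))))
    by (field; lra).
  apply CInt_le_const; [lra | |].
  - apply cont_on_V. intros y Hy. apply F_cont; [split; simpl; lra|]. apply edge_neq0; lra.
  - intros y Hy. unfold F. rewrite Cmod_mult.
    assert (Ay : Rabs y <= rad) by (apply Rabs_le; lra).
    pose proof (kernel_bound a rad Y rad y (rad / 2) ltac:(lra) ltac:(rewrite Rabs_pos_eq; lra) Ay) as K.
    pose proof (tail_bound rad y ltac:(lra) Ay) as T.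
    eapply Rle_trans; [apply Rmult_le_compat_l; [apply Cmod_ge_0 | apply K]|].
    + split; [lra|]. eapply Rle_trans; [|apply (re_le_Cmod ((a + rad)%R, y))]. simpl.
      rewrite Rabs_pos_eq; lra.
    + rewrite Rmult_plus_distr_r, exp_plus.
      replace (Cmod (H ((a + rad)%R, y) - S ((a + rad)%R, y)) * (exp (a * Y) * exp (rad * Y) * (3 / (rad / 2))))
        with (Cmod (H ((a + rad)%R, y) - S ((a + rad)%R, y)) * rad * exp (rad * Y) * (exp (a * Y) * (6 / rad) / rad))
        by (field; lra).
      replace (B1 / rad * (exp (a * Y) * (6 / rad))) with (B1 * (exp (a * Y) * (6 / rad) / rad)) by (field; lra).
      apply Rmult_le_compat_r; [|exact T].
      pose proof (exp_pos (a * Y)).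
      apply Rdiv_le_0_compat; [|lra]. apply Rmult_le_pos; [lra|]. apply Rdiv_le_0_compat; lra.
Qed.

Lemma left_S_H (y : R) : y = rad \/ y = - rad ->
  Cmod (h_int FS (a - rad) a y) <= 3 * B1 * exp (a * Y) / rad.
Proof.
  intros Ey. assert (Ay : Rabs y = rad).
  { destruct Ey as [->| ->]; [|rewrite Rabs_Ropp]; apply Rabs_pos_eq; lra. }
  unfold h_int.
  replace (3 * B1 * exp (a * Y) / rad) with ((a - (a - rad)) * (B1 * (exp (a * Y) * (3 / (rad * rad)))))
    by (field; lra).
  apply CInt_le_const; [lra | |].
  - apply cont_on_H. intros x Hx. apply FS_cont, edge_neq0; lra.
  - intros x Hx. unfold FS. rewrite Cmod_mult.
    set (u := a - x). replace x with (a + - u) by (unfold u; ring).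
    pose proof (kernel_bound_edge a rad Y (- u) y ltac:(lra)
      ltac:(unfold u; rewrite Rabs_Ropp, Rabs_pos_eq; lra) Ay) as K.
    rewrite Rabs_Ropp, (Rabs_pos_eq u) in K by (unfold u; lra).
    pose proof B1_nonneg as HB. pose proof (exp_pos (a * Y)).
    assert (0 < 3 / (rad * rad)) by (apply Rdiv_lt_0_compat; nra).
    destruct (Req_dec u 0) as [U0|U0].
    + rewrite U0 in *. replace (3 * 0 / (rad * rad)) with 0 in K by (field; lra).
      rewrite Rmult_0_r in K. fold (E ((a + - 0)%R, y)) in K. pose proof (Cmod_ge_0 (E ((a + - 0)%R, y))).
      replace (Cmod (E ((a + - 0)%R, y))) with 0 by lra. rewrite Rmult_0_r.
      apply Rmult_le_pos; [exact HB | nra].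
    + assert (Hu : 0 < u) by (unfold u in *; lra).
      pose proof (sum_bound u y ltac:(unfold u in *; lra) ltac:(lra)) as T.
      change (a - u) with (a + - u) in T.
      eapply Rle_trans; [apply Rmult_le_compat_l; [apply Cmod_ge_0 | exact K]|].
      rewrite Rmult_plus_distr_r, exp_plus.
      replace (Cmod (S ((a + - u)%R, y)) * (exp (a * Y) * exp (- u * Y) * (3 * u / (rad * rad)))) with
        (Cmod (S ((a + - u)%R, y)) * u * exp (- u * Y) * (exp (a * Y) * (3 / (rad * rad))))
        by (field; lra).
      apply Rmult_le_compat_r; [|exact T]. nra.
Qed.

Lemma left_S_V : Cmod (v_int FS (a - rad) (- rad) rad) <= 12 * B1 * exp (a * Y) / rad.
Proof.
  unfold v_int. replace (12 * B1 * exp (a * Y) / rad) with ((rad - - rad) * (B1 / rad * (exp (a * Y) * (6 / rad))))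
    by (field; lra).
  apply CInt_le_const; [lra | |].
  - apply cont_on_V. intros y Hy. apply FS_cont, edge_neq0; lra.
  - intros y Hy. unfold FS. rewrite Cmod_mult.
    assert (Ay : Rabs y <= rad) by (apply Rabs_le; lra).
    change (a - rad) with (a + - rad).
    pose proof (kernel_bound a rad Y (- rad) y (rad / 2) ltac:(lra)
      ltac:(rewrite Rabs_Ropp, Rabs_pos_eq; lra) Ay) as K.
    pose proof (sum_bound rad y ltac:(lra) Ay) as T. change (a - rad) with (a + - rad) in T.
    eapply Rle_trans; [apply Rmult_le_compat_l; [apply Cmod_ge_0 | apply K]|].
    + split; [lra|]. eapply Rle_trans; [|apply (re_le_Cmod ((a + - rad)%R, y))]. simpl.
      rewrite Rabs_left1; lra.
    + rewrite Rmult_plus_distr_r, exp_plus.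
      replace (Cmod (S ((a + - rad)%R, y)) * (exp (a * Y) * exp (- rad * Y) * (3 / (rad / 2))))
        with (Cmod (S ((a + - rad)%R, y)) * rad * exp (- rad * Y) * (exp (a * Y) * (6 / rad) / rad))
        by (field; lra).
      replace (B1 / rad * (exp (a * Y) * (6 / rad))) with (B1 * (exp (a * Y) * (6 / rad) / rad)) by (field; lra).
      apply Rmult_le_compat_r; [|exact T].
      pose proof (exp_pos (a * Y)).
      apply Rdiv_le_0_compat; [|lra]. apply Rmult_le_pos; [lra|]. apply Rdiv_le_0_compat; lra.
Qed.

(** [H] has no decay here, but the zero of the kernel leaves [u * exp (- u * Y) <= / Y]; this is
    where the factor [1 / Y] comes from. *)
Lemma left_H_H (y : R) : y = rad \/ y = - rad ->
  Cmod (h_int FH (a - eta) a y) <= 3 * B2 * exp (a * Y) * eta / (rad * rad * Y).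
Proof.
  intros Ey. assert (Ay : Rabs y = rad).
  { destruct Ey as [->| ->]; [|rewrite Rabs_Ropp]; apply Rabs_pos_eq; lra. }
  unfold h_int.
  replace (3 * B2 * exp (a * Y) * eta / (rad * rad * Y))
    with ((a - (a - eta)) * (B2 * (exp (a * Y) * (3 / (rad * rad)) * / Y)))
    by (field; lra).
  apply CInt_le_const; [lra | |].
  - apply cont_on_H. intros x Hx. apply FH_cont; [split; simpl; lra|]. apply edge_neq0; lra.
  - intros x Hx. unfold FH. rewrite Cmod_mult.
    set (u := a - x). replace x with (a + - u) by (unfold u; ring).
    pose proof (kernel_bound_edge a rad Y (- u) y ltac:(lra)
      ltac:(unfold u; rewrite Rabs_Ropp, Rabs_pos_eq; lra) Ay) as K.
    rewrite Rabs_Ropp, (Rabs_pos_eq u) in K by (unfold u; lra).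
    pose proof (H_bound u y ltac:(unfold u in *; lra) ltac:(lra)) as T.
    change (a - u) with (a + - u) in T.
    apply Rmult_le_compat; try apply Cmod_ge_0; [exact T|].
    eapply Rle_trans; [exact K|].
    rewrite Rmult_plus_distr_r, exp_plus.
    pose proof (mul_exp_neg_le u Y HY). pose proof (exp_pos (a * Y)).
    assert (0 < 3 / (rad * rad)) by (apply Rdiv_lt_0_compat; nra).
    replace (exp (a * Y) * exp (- u * Y) * (3 * u / (rad * rad)))
      with (exp (a * Y) * (3 / (rad * rad)) * (u * exp (- u * Y))) by (field; lra).
    apply Rmult_le_compat_l; [nra | assumption].
Qed.

Lemma left_H_V : Cmod (v_int FH (a - eta) (- rad) rad) <=
  12 * B2 * exp ((a - eta) * Y) * ln (1 + rad / (eta - a)).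
Proof.
  unfold v_int.
  replace (12 * B2 * exp ((a - eta) * Y) * ln (1 + rad / (eta - a)))
    with (2 * (B2 * (exp ((a - eta) * Y) * 6)) * ln (1 + rad / (eta - a))) by ring.
  apply CInt_le_log; try lra.
  - apply cont_on_V. intros y Hy. apply FH_cont; [split; simpl; lra|]. apply edge_neq0; lra.
  - intros y Hy. unfold FH. rewrite Cmod_mult.
    assert (Ay : Rabs y <= rad) by (apply Rabs_le; lra). pose proof (Rabs_pos y).
    pose proof (H_bound eta y ltac:(lra) Ay) as T.
    change (a - eta) with (a + - eta) in *.
    unfold Rdiv. rewrite Rmult_assoc.
    apply Rmult_le_compat; try apply Cmod_ge_0; [exact T|].
    (* The mean of the absolute values of the coordinates is at most the modulus; this gives the
       weight the shape that [CInt_le_log] expects. *)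
    eapply Rle_trans; [apply (kernel_bound a rad Y (- eta) y ((eta - a + Rabs y) / 2)); try lra|].
    + rewrite Rabs_Ropp, Rabs_pos_eq; lra.
    + split; [lra|].
      pose proof (re_le_Cmod ((a + - eta)%R, y)) as R1. pose proof (im_le_Cmod ((a + - eta)%R, y)) as R2.
      simpl in R1, R2. rewrite Rabs_left1 in R1 by lra. lra.
    + right. field. lra.
Qed.

(** The pole [w = 0] lies to the right of [Re w = a - eta], so [FS] is holomorphic between that line
    and [Re w = a - rad], and the left part of its contour can be moved. [H] need not be defined
    there, which is why the integrand is split first. *)
Lemma contour_identity :
  rect_int F (a - eta) (a + rad) (- rad) rad =
  (h_int F a (a + rad) (- rad) - h_int F a (a + rad) rad + Ci * v_int F (a + rad) (- rad) rad
   + (h_int FH (a - eta) a (- rad) - h_int FH (a - eta) a rad - Ci * v_int FH (a - eta) (- rad) rad)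
   - (h_int FS (a - rad) a (- rad) - h_int FS (a - rad) a rad - Ci * v_int FS (a - rad) (- rad) rad))%C.
Proof.
  assert (CF : forall y, y = rad \/ y = - rad -> cont_on (fun x => F (x, y)) (a - eta) (a + rad)).
  { intros y Ey. apply cont_on_H. intros x Hx. apply F_cont; [split; simpl; lra|].
    apply edge_neq0; lra. }
  assert (CS : forall x1 x2 y, y = rad \/ y = - rad -> cont_on (fun x => FS (x, y)) x1 x2).
  { intros x1 x2 y Ey. apply cont_on_H. intros x Hx. apply FS_cont, edge_neq0; lra. }
  assert (CH : forall y, y = rad \/ y = - rad -> cont_on (fun x => FH (x, y)) (a - eta) a).
  { intros y Ey. apply cont_on_H. intros x Hx. apply FH_cont; [split; simpl; lra|].
    apply edge_neq0; lra. }
  assert (EF : forall w, F w = (FH w - FS w)%C) by (intros w; unfold F, FH, FS; ring).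
  assert (D1 : forall y, y = rad \/ y = - rad ->
    h_int F (a - eta) a y = (h_int FH (a - eta) a y - h_int FS (a - eta) a y)%C).
  { intros y Ey. unfold h_int. rewrite <- CInt_minus by (auto; lra).
    apply CInt_ext; [lra|]. intros; apply EF. }
  assert (D2 : v_int F (a - eta) (- rad) rad = (v_int FH (a - eta) (- rad) rad - v_int FS (a - eta) (- rad) rad)%C).
  { unfold v_int. rewrite <- CInt_minus; try lra.
    - apply CInt_ext; [lra|]. intros; apply EF.
    - apply cont_on_V. intros x Hx. apply FH_cont; [split; simpl; lra|]. apply edge_neq0; lra.
    - apply cont_on_V. intros x Hx. apply FS_cont, edge_neq0; lra. }
  assert (G : rect_int FS (a - rad) (a - eta) (- rad) rad = RtoC 0).
  { apply goursat; try lra. intros [x y] [Hx Hy]; simpl in *.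
    apply cdiff_mult; [apply S_diff | apply cdiff_kernel_div, edge_neq0; lra]. }
  unfold rect_int in G |- *.
  assert (Ch : forall y, y = rad \/ y = - rad ->
    h_int F (a - eta) (a + rad) y = (h_int F (a - eta) a y + h_int F a (a + rad) y)%C).
  { intros y Ey. unfold h_int. apply CInt_Chasles; [lra | auto]. }
  assert (Ch2 : forall y, y = rad \/ y = - rad ->
    h_int FS (a - rad) a y = (h_int FS (a - rad) (a - eta) y + h_int FS (a - eta) a y)%C).
  { intros y Ey. unfold h_int. apply CInt_Chasles; [lra | auto]. }
  rewrite !Ch, !Ch2, !D1, D2 by auto.
  (* The two sides differ exactly by the integral in [G], which is substituted for a zero before
     [ring]. *)
  match goal with |- ?L = ?Rt => apply Ceq_minus; transitivity (0 + - (0))%C; [|ring] end.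
  rewrite <- G at 1. ring.
Qed.

(** Cauchy's formula at [w = 0]: the kernel has modulus at least [1] there and the index integral at
    least [1 / 4]. The two horizontal pieces and the vertical one give [3 + 3 + 12] for the tail and
    again for the sum, so [36], and [144 = 4 * 36]. *)
Theorem newman_contour :
  Cmod (H 0 - S 0) <= 144 *
    (B1 * exp (a * Y) / rad + B2 * exp (a * Y) * eta / (rad * rad * Y)
     + B2 * exp ((a - eta) * Y) * ln (1 + rad / (eta - a))).
Proof.
  set (k := rect_int (fun w => / (w - 0))%C (a - eta) (a + rad) (- rad) rad).
  assert (Hi : interior_rect (a - eta) (a + rad) (- rad) rad 0) by (split; simpl; lra).
  (* The bottom side lies within distance [2 * rad] of [0], since [(rad + 1)^2 <= 3 rad^2] for
     [rad >= 2]. *)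
  assert (Hk : / 4 <= Cmod k).
  { eapply Rle_trans; [|apply (index_lower _ _ _ _ (4 * (rad * rad)) 0 Hi)].
    - simpl. replace (a + rad - (a - eta)) with (rad + eta) by ring.
      replace (0 - - rad) with rad by ring.
      replace ((rad + eta) * (rad / (4 * (rad * rad)))) with (/ 4 * ((rad + eta) / rad)) by (field; lra).
      rewrite <- (Rmult_1_r (/ 4)) at 1. apply Rmult_le_compat_l; [lra|].
      apply Rle_div_r; lra.
    - nra.
    - intros x Hx. simpl. assert (Rabs x <= rad + 1) by (apply Rabs_le; lra).
      apply Rabs_le_between in H0. nra. }
  assert (I : rect_int F (a - eta) (a + rad) (- rad) rad = ((H 0 - S 0) * kernel a rad Y 0 * k)%C).
  { unfold k. rewrite <- (cauchy_rect nil (fun w => (H w - S w) * kernel a rad Y w)%C); auto.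
    - apply rect_int_ext; try lra. intros w Hw.
      assert (N : w <> 0%C) by (now apply (edge_not_interior (a - eta) (a + rad) (- rad) rad)).
      unfold F, E. replace (w - 0)%C with w by ring. field. exact N.
    - intros z Hz. apply cdiff_ccont, cdiff_mult; [|apply cdiff_kernel].
      apply cdiff_minus; auto.
    - intros z Hz _. apply cdiff_mult; [|apply cdiff_kernel]. apply cdiff_minus; auto. }
  assert (K0 : 1 <= Cmod (kernel a rad Y 0)).
  { unfold kernel. replace (0 * RtoC Y)%C with (RtoC 0) by ring. rewrite Cexp_0.
    replace (1 * (1 + (0 - RtoC a) * (0 - RtoC a) / RtoC (rad * rad)))%C
      with (RtoC (1 + a * a / (rad * rad))).
    - rewrite Cmod_R. rewrite Rabs_pos_eq; assert (0 <= a * a / (rad * rad)) by (apply Rdiv_le_0_compat; nra); lra.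
    - rewrite RtoC_plus, RtoC_div by (apply Rgt_not_eq; nra). rewrite !RtoC_mult. field.
      intros E0. apply RtoC_inj in E0; lra. }
  assert (B : Cmod (rect_int F (a - eta) (a + rad) (- rad) rad) <=
     36 * (B1 * exp (a * Y) / rad) + 6 * (B2 * exp (a * Y) * eta / (rad * rad * Y))
     + 12 * (B2 * exp ((a - eta) * Y) * ln (1 + rad / (eta - a)))).
  { rewrite contour_identity.
    pose proof (right_H rad ltac:(auto)). pose proof (right_H (- rad) ltac:(auto)).
    pose proof (left_S_H rad ltac:(auto)). pose proof (left_S_H (- rad) ltac:(auto)).
    pose proof (left_H_H rad ltac:(auto)). pose proof (left_H_H (- rad) ltac:(auto)).
    pose proof right_V. pose proof left_S_V. pose proof left_H_V.
    eapply Rle_trans; [apply Cmod_minus_le|].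
    eapply Rle_trans; [apply Rplus_le_compat_r, Cmod_triangle|].
    eapply Rle_trans; [apply Rplus_le_compat_r, Rplus_le_compat_r, Cmod_triangle|].
    eapply Rle_trans; [apply Rplus_le_compat_r, Rplus_le_compat_l, Cmod_minus_le|].
    eapply Rle_trans; [apply Rplus_le_compat_l, Cmod_minus_le|].
    rewrite !Cmod_Ci_mult.
    pose proof (Cmod_minus_le (h_int F a (a + rad) (- rad)) (h_int F a (a + rad) rad)).
    pose proof (Cmod_minus_le (h_int FH (a - eta) a (- rad)) (h_int FH (a - eta) a rad)).
    pose proof (Cmod_minus_le (h_int FS (a - rad) a (- rad)) (h_int FS (a - rad) a rad)).
    unfold Rdiv in *. lra. }
  rewrite I, !Cmod_mult in B.
  pose proof (Cmod_ge_0 (H 0 - S 0)) as P.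
  assert (P1 : Cmod (H 0 - S 0) <= Cmod (H 0 - S 0) * Cmod (kernel a rad Y 0)) by nra.
  assert (P2 : Cmod (H 0 - S 0) * / 4 <= Cmod (H 0 - S 0) * Cmod (kernel a rad Y 0) * Cmod k)
    by (apply Rmult_le_compat; lra).
  assert (0 <= B2).
  { eapply Rle_trans; [apply Cmod_ge_0 | apply (H_bound 0 0); [lra | rewrite Rabs_R0; lra]]. }
  pose proof (exp_pos (a * Y)). pose proof (exp_pos ((a - eta) * Y)).
  assert (0 <= B2 * exp (a * Y) * eta / (rad * rad * Y)).
  { apply Rdiv_le_0_compat; [|apply Rmult_lt_0_compat; nra]. apply Rmult_le_pos; [|lra]. nra. }
  assert (0 <= B2 * exp ((a - eta) * Y) * ln (1 + rad / (eta - a))).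
  { apply Rmult_le_pos; [nra|]. rewrite <- ln_1. apply ln_le; [lra|].
    assert (0 <= rad / (eta - a)) by (apply Rdiv_le_0_compat; lra). lra. }
  lra.
Qed.

End NewmanContour.

(** * Power sums and complex series *)

Lemma exp_mono (x y : R) : x <= y -> exp x <= exp y.
Proof. intros [H| ->]; [left; now apply exp_increasing | apply Rle_refl]. Qed.

Lemma ln_le_sub_1 (t : R) : 0 < t -> ln t <= t - 1.
Proof. intros Ht. pose proof (exp_ineq1_le (ln t)) as H. rewrite exp_ln in H by exact Ht. lra. Qed.

(** Concavity of [ln]: the tangent inequality [ln t <= t - 1] is taken at [x / g] and [1 / g], whose
    mean with weights [t] and [1 - t] is [1]. *)
Lemma Rpower_le_affine (t x : R) : 0 <= t <= 1 -> 0 < x -> Rpower x t <= 1 + t * (x - 1).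
Proof.
  intros Ht Hx. set (g := 1 + t * (x - 1)).
  assert (Hg : 0 < g).
  { unfold g. destruct (Req_dec t 1) as [->|N]; [lra|]. assert (0 <= t * x) by nra. nra. }
  unfold Rpower. rewrite <- (exp_ln g) by exact Hg. apply exp_mono.
  pose proof (ln_le_sub_1 (x / g) ltac:(apply Rdiv_lt_0_compat; lra)) as A.
  pose proof (ln_le_sub_1 (1 / g) ltac:(apply Rdiv_lt_0_compat; lra)) as B.
  rewrite ln_div in A, B by lra. rewrite ln_1 in B.
  assert (E : t * (x / g) + (1 - t) * (1 / g) = 1) by (unfold g; field; fold g; lra).
  assert (t * (ln x - ln g) + (1 - t) * (0 - ln g) <= t * (x / g - 1) + (1 - t) * (1 / g - 1)).
  { apply Rplus_le_compat; apply Rmult_le_compat_l; lra. }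
  lra.
Qed.

(** Follows from the concave case with exponent [/ u] at the point [(1 + t)^u]. *)
Lemma Rpower_bernoulli (u t : R) : 1 <= u -> 0 < 1 + t -> 1 + u * t <= Rpower (1 + t) u.
Proof.
  intros Hu Ht.
  pose proof (Rpower_le_affine (/ u) (Rpower (1 + t) u)) as H.
  rewrite Rpower_mult, Rinv_r, Rpower_1 in H by lra.
  assert (A : 1 + t <= 1 + / u * (Rpower (1 + t) u - 1)).
  { apply H; [|apply exp_pos]. split; [left; apply Rinv_0_lt_compat; lra|].
    rewrite <- Rinv_1. apply Rinv_le_contravar; lra. }
  apply Rplus_le_reg_l in A. apply (Rmult_le_compat_l u) in A; [|lra].
  rewrite <- Rmult_assoc, Rinv_r, Rmult_1_l in A by lra. lra.
Qed.

Lemma Rpower_pred (x u : R) : 0 < x -> Rpower x (u - 1) = Rpower x u / x.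
Proof.
  intros Hx. unfold Rminus. rewrite Rpower_plus, Rpower_Ropp, Rpower_1 by exact Hx. reflexivity.
Qed.

(** A discrete integral comparison: for [u <= 1] the power decreases and is compared with the
    interval to the left of [k], for [u >= 1] (next lemma) with the one to the right. Both
    differences telescope. *)
Lemma Rpower_pred_le_low (k u : R) : 1 < k -> 0 < u <= 1 ->
  Rpower k (u - 1) <= (Rpower k u - Rpower (k - 1) u) / u.
Proof.
  intros Hk Hu. rewrite Rpower_pred by lra.
  assert (E : Rpower (k - 1) u = Rpower k u * Rpower ((k - 1) / k) u).
  { rewrite Rpower_mult_distr; [|lra|apply Rdiv_lt_0_compat; lra]. f_equal. field; lra. }
  pose proof (Rpower_le_affine u ((k - 1) / k) ltac:(lra) ltac:(apply Rdiv_lt_0_compat; lra)) as B.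
  replace (1 + u * ((k - 1) / k - 1)) with (1 - u / k) in B by (field; lra).
  pose proof (exp_pos (u * ln k)) as P. fold (Rpower k u) in P.
  rewrite E. apply (proj1 (Rle_div_r _ _ u ltac:(lra))).
  assert (Rpower k u * Rpower ((k - 1) / k) u <= Rpower k u * (1 - u / k))
    by (apply Rmult_le_compat_l; lra).
  unfold Rdiv in *. lra.
Qed.

Lemma Rpower_pred_le_high (k u : R) : 0 < k -> 1 <= u ->
  Rpower k (u - 1) <= (Rpower (k + 1) u - Rpower k u) / u.
Proof.
  intros Hk Hu. rewrite Rpower_pred by lra.
  assert (0 < / k) by now apply Rinv_0_lt_compat.
  assert (E : Rpower (k + 1) u = Rpower k u * Rpower (1 + / k) u).
  { rewrite Rpower_mult_distr by lra. f_equal. field; lra. }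
  pose proof (Rpower_bernoulli u (/ k) Hu ltac:(lra)) as B.
  pose proof (exp_pos (u * ln k)) as P. fold (Rpower k u) in P.
  rewrite E. apply (proj1 (Rle_div_r _ _ u ltac:(lra))).
  assert (Rpower k u * (1 + u * / k) <= Rpower k u * Rpower (1 + / k) u)
    by (apply Rmult_le_compat_l; lra).
  unfold Rdiv in *. lra.
Qed.

(** * Finite real sums and sums of powers *)

Definition rsum (f : nat -> R) (a b : nat) : R := sum_n_m (G := R_AbelianMonoid) f a b.

Lemma rsum_empty (f : nat -> R) (a b : nat) : (b < a)%nat -> rsum f a b = 0.
Proof. intros H. unfold rsum. now rewrite sum_n_m_zero. Qed.

Lemma rsum_S (f : nat -> R) (a b : nat) : (a <= S b)%nat -> rsum f a (S b) = rsum f a b + f (S b).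
Proof. intros H. unfold rsum. now rewrite sum_n_Sm. Qed.

Lemma rsum_first (f : nat -> R) (a b : nat) : (a <= b)%nat -> rsum f a b = f a + rsum f (S a) b.
Proof. intros H. unfold rsum. now rewrite sum_Sn_m. Qed.

Lemma rsum_le (f g : nat -> R) (a b : nat) :
  (forall k, (a <= k <= b)%nat -> f k <= g k) -> rsum f a b <= rsum g a b.
Proof.
  intros H. destruct (Nat.le_gt_cases a (S b)) as [Hab|Hab].
  2: { rewrite !rsum_empty by lia; lra. }
  induction b as [|b IH].
  - destruct a as [|a]; [|rewrite !rsum_empty by lia; lra].
    unfold rsum. rewrite !sum_n_n. apply H; lia.
  - destruct (Nat.eq_dec a (S (S b))) as [->|N]; [rewrite !rsum_empty by lia; lra|].
    rewrite !rsum_S by lia. apply Rplus_le_compat; [apply IH|apply H]; try lia.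
    intros k Hk; apply H; lia.
Qed.

Lemma rsum_nonneg (f : nat -> R) (a b : nat) :
  (forall k, (a <= k <= b)%nat -> 0 <= f k) -> 0 <= rsum f a b.
Proof.
  intros H. replace 0 with (rsum (fun _ => 0) a b); [now apply rsum_le|].
  unfold rsum. rewrite sum_n_m_const. apply Rmult_0_r.
Qed.

Lemma rsum_scal (k : R) (f : nat -> R) (a b : nat) :
  rsum (fun n => k * f n) a b = k * rsum f a b.
Proof. unfold rsum. apply (sum_n_m_mult_l (K := R_Ring)). Qed.

(** Later [u] runs up to [ln N], so decreasing and increasing powers both occur; [INR M + 1] is an
    upper end that serves for either. *)
Lemma sum_pow_pred_le (u : R) (M : nat) : 0 < u ->
  rsum (fun k => Rpower (INR k) (u - 1)) 1 M <= Rpower (INR M + 1) u / u.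
Proof.
  intros Hu.
  assert (Pz : forall x, 0 < Rpower x u / u)
    by (intros x; apply Rdiv_lt_0_compat; [apply exp_pos | exact Hu]).
  destruct M as [|M]; [rewrite rsum_empty by lia; left; apply Pz|].
  destruct (Rle_dec u 1) as [L|L].
  - apply Rle_trans with (Rpower (INR (S M)) u / u).
    + induction M as [|M IH].
      * unfold rsum. rewrite sum_n_n. simpl INR. unfold Rpower. rewrite ln_1, !Rmult_0_r, exp_0.
        apply Rle_div_r; lra.
      * rewrite rsum_S by lia. pose proof (pos_INR M).
        pose proof (Rpower_pred_le_low (INR (S (S M))) u ltac:(rewrite !S_INR; lra) ltac:(lra)) as K.
        replace (INR (S (S M)) - 1) with (INR (S M)) in K by (rewrite (S_INR (S M)); ring).
        unfold Rdiv in *. lra.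
    + apply Rmult_le_compat_r; [left; now apply Rinv_0_lt_compat|].
      apply Rle_Rpower_l; [lra|]. pose proof (pos_INR M). rewrite S_INR. lra.
  - apply Rle_trans with ((Rpower (INR (S M) + 1) u - 1) / u).
    + induction M as [|M IH].
      * unfold rsum. rewrite sum_n_n.
        pose proof (Rpower_pred_le_high 1 u ltac:(lra) ltac:(lra)) as K. simpl INR.
        replace (Rpower 1 u) with 1 in K; [exact K|].
        unfold Rpower. now rewrite ln_1, Rmult_0_r, exp_0.
      * rewrite rsum_S by lia. pose proof (pos_INR M).
        pose proof (Rpower_pred_le_high (INR (S (S M))) u ltac:(rewrite !S_INR; lra) ltac:(lra)) as K.
        replace (INR (S M) + 1) with (INR (S (S M))) in IH by (rewrite (S_INR (S M)); ring).
        unfold Rdiv in *. lra.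
    + apply Rmult_le_compat_r; [left; now apply Rinv_0_lt_compat | lra].
Qed.

(** From [ln (x + 1) - ln x >= 1 / (x + 1)] and [exp v >= 1 + v]; the right-hand side telescopes in
    [tail_pow_le]. *)
Lemma tail_pow_step (x u : R) : 0 < x -> 0 < u ->
  Rpower (x + 1) (- (1 + u)) <= (Rpower x (- u) - Rpower (x + 1) (- u)) / u.
Proof.
  intros Hx Hu. apply (proj1 (Rle_div_r _ _ u Hu)).
  replace (- (1 + u)) with (- u - 1) by ring. rewrite Rpower_pred by lra.
  assert (E : Rpower x (- u) = Rpower (x + 1) (- u) * exp (u * (ln (x + 1) - ln x))).
  { unfold Rpower. rewrite <- exp_plus. f_equal. ring. }
  pose proof (exp_pos (- u * ln (x + 1))) as P. fold (Rpower (x + 1) (- u)) in P.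
  pose proof (exp_ineq1_le (u * (ln (x + 1) - ln x))) as I.
  pose proof (ln_le_sub_1 (x / (x + 1)) ltac:(apply Rdiv_lt_0_compat; lra)) as L.
  rewrite ln_div in L by lra.
  replace (x / (x + 1) - 1) with (- / (x + 1)) in L by (field; lra).
  rewrite E.
  assert (u * / (x + 1) <= u * (ln (x + 1) - ln x)) by (apply Rmult_le_compat_l; lra).
  assert (Rpower (x + 1) (- u) * (1 + u * / (x + 1)) <=
          Rpower (x + 1) (- u) * exp (u * (ln (x + 1) - ln x))) by (apply Rmult_le_compat_l; lra).
  unfold Rdiv. lra.
Qed.

Lemma tail_pow_le (u : R) (M n : nat) : 0 < u -> (1 <= M)%nat ->
  rsum (fun k => Rpower (INR k) (- (1 + u))) (S M) n <= Rpower (INR M) (- u) / u.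
Proof.
  intros Hu HM.
  assert (Pz : forall x, 0 < Rpower x (- u) / u)
    by (intros x; apply Rdiv_lt_0_compat; [apply exp_pos | exact Hu]).
  assert (K : forall j, rsum (fun k => Rpower (INR k) (- (1 + u))) (S M) (M + j) <=
     Rpower (INR M) (- u) / u - Rpower (INR (M + j)) (- u) / u).
  { induction j as [|j IH].
    - rewrite Nat.add_0_r, rsum_empty by lia. lra.
    - rewrite Nat.add_succ_r, rsum_S by lia.
      assert (0 < INR (M + j)) by (apply lt_0_INR; lia).
      pose proof (tail_pow_step (INR (M + j)) u H Hu) as T. rewrite S_INR.
      unfold Rdiv in *. lra. }
  destruct (Nat.le_gt_cases n M) as [L|L].
  - rewrite rsum_empty by lia. left; apply Pz.
  - replace n with (M + (n - M))%nat by lia. eapply Rle_trans; [apply K|].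
    specialize (Pz (INR (M + (n - M)))). lra.
Qed.

(** * Finite complex sums *)

Lemma Csum_empty (f : nat -> C) (a b : nat) : (b < a)%nat -> Csum f a b = RtoC 0.
Proof. intros H. unfold Csum. now rewrite sum_n_m_zero. Qed.

Lemma Csum_S (f : nat -> C) (a b : nat) : (a <= S b)%nat ->
  Csum f a (S b) = (Csum f a b + f (S b))%C.
Proof. intros H. unfold Csum. now rewrite sum_n_Sm. Qed.

Lemma Csum_split (f : nat -> C) (M n : nat) : (M <= n)%nat ->
  Csum f 0 n = (Csum f 0 M + Csum f (S M) n)%C.
Proof. intros H. unfold Csum. rewrite (sum_n_m_Chasles _ 0 M n) by lia. reflexivity. Qed.

Lemma Csum_ind (P : C -> Prop) (f : nat -> C) (a b : nat) :
  P (RtoC 0) -> (forall x k, (a <= k <= b)%nat -> P x -> P (x + f k)%C) -> P (Csum f a b).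
Proof.
  intros H0 HS. destruct (Nat.le_gt_cases a (S b)) as [Hab|Hab].
  2: { rewrite Csum_empty by lia; exact H0. }
  induction b as [|b IH].
  - destruct a as [|a]; [|rewrite Csum_empty by lia; exact H0].
    unfold Csum. rewrite sum_n_n. replace (f O) with (RtoC 0 + f O)%C by ring. apply HS; [lia | exact H0].
  - destruct (Nat.eq_dec a (S (S b))) as [->|N]; [rewrite Csum_empty by lia; exact H0|].
    rewrite Csum_S by lia. apply HS; [lia|]. apply IH; [|lia]. intros x k Hk; apply HS; lia.
Qed.

Lemma Cmod_Csum_le (f : nat -> C) (g : nat -> R) (a b : nat) :
  (forall k, (a <= k <= b)%nat -> Cmod (f k) <= g k) -> Cmod (Csum f a b) <= rsum g a b.
Proof.
  intros H. destruct (Nat.le_gt_cases a (S b)) as [Hab|Hab].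
  2: { rewrite Csum_empty, rsum_empty, Cmod_0 by lia; lra. }
  induction b as [|b IH].
  - destruct a as [|a]; [|rewrite Csum_empty, rsum_empty, Cmod_0 by lia; lra].
    unfold Csum, rsum. rewrite !sum_n_n. apply H; lia.
  - destruct (Nat.eq_dec a (S (S b))) as [->|N]; [rewrite Csum_empty, rsum_empty, Cmod_0 by lia; lra|].
    rewrite Csum_S, rsum_S by lia. eapply Rle_trans; [apply Cmod_triangle|].
    apply Rplus_le_compat; [apply IH | apply H]; try lia. intros k Hk; apply H; lia.
Qed.

Lemma Csum_plus (f g : nat -> C) (a b : nat) :
  Csum (fun k => f k + g k)%C a b = (Csum f a b + Csum g a b)%C.
Proof. unfold Csum. apply (sum_n_m_plus (G := C_AbelianMonoid)). Qed.

Lemma Csum_minus (f g : nat -> C) (a b : nat) :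
  Csum (fun k => f k - g k)%C a b = (Csum f a b - Csum g a b)%C.
Proof.
  assert (E : Csum (fun k => f k - g k + g k)%C a b = Csum f a b).
  { unfold Csum. apply sum_n_m_ext. intros k. change (f k - g k + g k = f k)%C. ring. }
  rewrite <- E, (Csum_plus (fun k => f k - g k)%C g). ring.
Qed.

Lemma Re_Csum (f : nat -> C) (n : nat) : Re (Csum f 0 n) = sum_n (fun k => Re (f k)) n.
Proof.
  induction n as [|n IH].
  - unfold Csum. rewrite sum_n_n, sum_O. reflexivity.
  - rewrite Csum_S, sum_Sn by lia. rewrite <- IH. reflexivity.
Qed.

Lemma Im_Csum (f : nat -> C) (n : nat) : Im (Csum f 0 n) = sum_n (fun k => Im (f k)) n.
Proof.
  induction n as [|n IH].
  - unfold Csum. rewrite sum_n_n, sum_O. reflexivity.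
  - rewrite Csum_S, sum_Sn by lia. rewrite <- IH. reflexivity.
Qed.

(** * Absolutely convergent complex series *)

Definition abs_summable (f : nat -> C) : Prop :=
  exists B, forall n, rsum (fun k => Cmod (f k)) 0 n <= B.

Lemma abs_summable_le (f : nat -> C) (g : nat -> R) (B : R) :
  (forall k, Cmod (f k) <= g k) -> (forall n, rsum g 0 n <= B) -> abs_summable f.
Proof.
  intros H HB. exists B. intros n. eapply Rle_trans; [|apply HB]. apply rsum_le. auto.
Qed.

Lemma abs_summable_ex (f : nat -> C) : abs_summable f ->
  ex_series (fun k => Re (f k)) /\ ex_series (fun k => Im (f k)).
Proof.
  intros [B HB].
  assert (X : ex_series (fun k => Cmod (f k))).
  {    destruct (ex_finite_lim_seq_incr (sum_n (fun k => Cmod (f k))) B) as [l Hl].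
    - intros n. rewrite sum_Sn. unfold plus; simpl. pose proof (Cmod_ge_0 (f (S n))). lra.
    - exact HB.
    - exists l. exact Hl. }
  split; apply (ex_series_le (V := R_CompleteNormedModule)) with (b := fun k => Cmod (f k)); auto; intros n.
  - apply re_le_Cmod.
  - apply im_le_Cmod.
Qed.

(** Bounds on partial sums pass to the limit. With [z = 0] this estimates a series, with [z] a
    partial sum or a truncation its tail; [n0] lets the bound start beyond the cut. *)
Lemma CSeries_bound (f : nat -> C) (z : C) (B : R) (n0 : nat) : abs_summable f ->
  (forall n, (n0 <= n)%nat -> Cmod (Csum f 0 n - z) <= B) -> Cmod (CSeries f - z) <= B.
Proof.
  intros Hs H. destruct (abs_summable_ex f Hs) as [H1 H2].
  apply Series_correct in H1, H2.
  apply le_epsilon. intros eps Heps.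
  assert (He : 0 < eps / 2) by lra.
  destruct (proj2 (is_lim_seq_spec (sum_n (fun k => Re (f k))) (Finite _)) H1 (mkposreal _ He)) as [n1 N1].
  destruct (proj2 (is_lim_seq_spec (sum_n (fun k => Im (f k))) (Finite _)) H2 (mkposreal _ He)) as [n2 N2].
  set (n := Nat.max n0 (Nat.max n1 n2)).
  specialize (N1 n ltac:(lia)). specialize (N2 n ltac:(lia)). specialize (H n ltac:(lia)).
  simpl in N1, N2.
  replace (CSeries f - z)%C with ((CSeries f - Csum f 0 n) + (Csum f 0 n - z))%C by ring.
  eapply Rle_trans; [apply Cmod_triangle|]. rewrite Rplus_comm. apply Rplus_le_compat; [exact H|].
  replace eps with (eps / 2 + eps / 2) by field.
  apply Cmod_le_box.
  - replace (Re (CSeries f - Csum f 0 n)) with (- (sum_n (fun k => Re (f k)) n - Series (fun k => Re (f k))))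
      by (rewrite <- Re_Csum; simpl; ring).
    rewrite Rabs_Ropp. lra.
  - replace (Im (CSeries f - Csum f 0 n)) with (- (sum_n (fun k => Im (f k)) n - Series (fun k => Im (f k))))
      by (rewrite <- Im_Csum; simpl; ring).
    rewrite Rabs_Ropp. lra.
Qed.

Lemma CSeries_plus (f g : nat -> C) : abs_summable f -> abs_summable g ->
  CSeries (fun k => f k + g k)%C = (CSeries f + CSeries g)%C.
Proof.
  intros Hf Hg. destruct (abs_summable_ex f Hf), (abs_summable_ex g Hg).
  unfold CSeries, Cplus; simpl. f_equal; now apply Series_plus.
Qed.

Lemma CSeries_first (f : nat -> C) : abs_summable f ->
  CSeries f = (f O + CSeries (fun k => f (S k)))%C.
Proof.
  intros Hf. destruct (abs_summable_ex f Hf).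
  unfold CSeries, Cplus; simpl. f_equal; now apply Series_incr_1.
Qed.

Lemma CSeries_ext (f g : nat -> C) : (forall k, f k = g k) -> CSeries f = CSeries g.
Proof. intros H. unfold CSeries. f_equal; apply Series_ext; intros k; now rewrite H. Qed.

(** * The logarithm of the Euler product *)

Definition coef_bounded (m : nat) (c : nat -> nat -> C) : Prop :=
  forall j p : nat, (1 <= j <= m)%nat -> is_prime p -> Cmod (c j p) <= 1.

Lemma d_coef_le (m : nat) (c : nat -> nat -> C) (p l : nat) :
  coef_bounded m c -> is_prime p -> Cmod (d_coef m c p l) <= INR m.
Proof.
  intros H Hp. replace (INR m) with (rsum (fun _ => 1) 1 m).
  - apply Cmod_Csum_le. intros j Hj. rewrite Cmod_pow.
    rewrite <- (pow1 l). apply pow_incr. split; [apply Cmod_ge_0 | now apply H].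
  - unfold rsum. rewrite sum_n_m_const, Nat.sub_succ, Nat.sub_0_r. ring.
Qed.

Lemma is_prime_ge_2 (p : nat) : is_prime p -> (2 <= p)%nat.
Proof. intros H. apply prime_ge_2 in H. lia. Qed.

Lemma log_term_le (m : nat) (c : nat -> nat -> C) (s : C) (p l : nat) :
  coef_bounded m c -> is_prime p -> (1 <= l)%nat ->
  Cmod (log_term m c s p l) <= INR m * Rpower (INR p) (- Re s) ^ l.
Proof.
  intros H Hp Hl. assert (L : 1 <= INR l) by (apply (le_INR 1); exact Hl).
  assert (N : (RtoC (INR l) * natCpow p (RtoC (INR l) * s))%C <> 0%C).
  { apply Cmult_neq_0; [|apply natCpow_neq0]. intros E. apply RtoC_inj in E; lra. }
  unfold log_term. rewrite Cmod_div, Cmod_mult, Cmod_natCpow, Cmod_R, Rabs_pos_eq by (auto; lra).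
  replace (Re (RtoC (INR l) * s)) with (INR l * Re s) by (destruct s; simpl; ring).
  assert (E : Rpower (INR p) (- Re s) ^ l = / Rpower (INR p) (INR l * Re s)).
  { rewrite <- Rpower_pow by apply exp_pos. rewrite Rpower_mult, <- Rpower_Ropp. f_equal. ring. }
  rewrite E. pose proof (exp_pos (INR l * Re s * ln (INR p))) as P.
  fold (Rpower (INR p) (INR l * Re s)) in P.
  apply Rmult_le_compat.
  - apply Cmod_ge_0.
  - left. apply Rinv_0_lt_compat. nra.
  - now apply d_coef_le.
  - apply Rinv_le_contravar; nra.
Qed.

(** [4] is [1 / (1 - 3 / 4)]; the ratio [3 / 4] is the one provided by [prime_pow_le]. *)
Lemma geometric_le (q : R) (a n : nat) : 0 <= q <= 3 / 4 ->
  rsum (fun k => q ^ k) a n <= 4 * q ^ a.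
Proof.
  intros Hq.
  assert (K : forall j, rsum (fun k => q ^ k) a (a + j) <= 4 * q ^ a - 4 * q ^ (a + j) * q).
  { assert (P : forall i, 0 <= q ^ i) by (intros; apply pow_le; lra).
    induction j as [|j IH].
    - rewrite Nat.add_0_r. unfold rsum. rewrite sum_n_n. specialize (P a). nra.
    - rewrite Nat.add_succ_r, rsum_S by lia. simpl. specialize (P (a + j)%nat).
      assert (0 <= q * q ^ (a + j)) by (apply Rmult_le_pos; lra). nra. }
  assert (P : forall i, 0 <= q ^ i) by (intros; apply pow_le; lra).
  destruct (Nat.le_gt_cases a n) as [L|L].
  - replace n with (a + (n - a))%nat by lia. eapply Rle_trans; [apply K|].
    specialize (P (a + (n - a))%nat). nra.
  - rewrite rsum_empty by lia. specialize (P a). lra.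
Qed.

(** All points of use have [Re s >= 1 - delta / 12 > 17 / 24 > 7 / 10]. This makes the sum over
    exponents geometric, as [2^(-7/10) <= exp (- 1 / 3) <= 3 / 4], and the sum over primes
    convergent, since squares contribute the exponent [7 / 5]. *)
Lemma prime_pow_le (p : nat) (x : R) : is_prime p -> 7 / 10 <= x ->
  0 < Rpower (INR p) (- x) <= 3 / 4 /\
  Rpower (INR p) (- x) ^ 2 <= Rpower (INR p) (- (1 + 2 / 5)).
Proof.
  intros Hp Hx. apply is_prime_ge_2 in Hp. apply le_INR in Hp. simpl in Hp.
  assert (L2 : 1 / 2 < ln 2) by (pose proof ln_lt_2; lra).
  assert (L : ln 2 <= ln (INR p)) by (apply ln_le; lra).
  split; [split; [apply exp_pos|]|].
  - unfold Rpower. apply Rle_trans with (exp (- (1 / 3))).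
    + apply exp_mono. nra.
    + rewrite exp_Ropp. pose proof (exp_ineq1_le (1 / 3)).
      replace (3 / 4) with (/ (4 / 3)) by field. apply Rinv_le_contravar; lra.
  - rewrite <- Rpower_pow by apply exp_pos. rewrite Rpower_mult.
    apply Rle_Rpower; simpl; lra.
Qed.

Section EulerProductLog.

Variables (m : nat) (c : nat -> nat -> C).
Hypothesis Hc : coef_bounded m c.

(** [C_const m c alpha] is, by conversion, [series_primes] of this function at [RtoC alpha]. *)
Definition power_part (s : C) (p : nat) : C := CSeries (fun k => log_term m c s p (k + 2)).

Definition power_part_trunc (X : nat) (s : C) (p : nat) : C :=
  Csum (fun k => log_term m c s p (k + 2)) 0 X.

(** The finite C_X: primes up to [X], and exponents from [2] to [X + 2]. *)
Definition C_trunc (X : nat) (s : C) : C := Csum (at_primes0 (power_part_trunc X s)) 0 X.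

Lemma rsum_shift_pow_le (q : R) (i a n : nat) : 0 <= q <= 3 / 4 ->
  rsum (fun k => INR m * q ^ (k + i)) a n <= INR m * (4 * q ^ (a + i)).
Proof.
  intros Hq. rewrite rsum_scal. apply Rmult_le_compat_l; [apply pos_INR|].
  replace (rsum (fun k => q ^ (k + i)) a n) with (q ^ i * rsum (fun k => q ^ k) a n).
  - pose proof (geometric_le q a n Hq). rewrite pow_add.
    assert (0 <= q ^ i) by (apply pow_le; lra). nra.
  - rewrite <- rsum_scal. unfold rsum. apply sum_n_m_ext. intros k. rewrite pow_add. apply Rmult_comm.
Qed.

Lemma log_terms_summable (s : C) (p i : nat) : is_prime p -> 7 / 10 <= Re s -> (1 <= i)%nat ->
  abs_summable (fun k => log_term m c s p (k + i)).
Proof.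
  intros Hp Hs Hi. destruct (prime_pow_le p (Re s) Hp Hs) as [Hq _].
  apply abs_summable_le with (g := fun k => INR m * Rpower (INR p) (- Re s) ^ (k + i))
    (B := INR m * (4 * Rpower (INR p) (- Re s) ^ (0 + i))).
  - intros k. apply log_term_le; auto; lia.
  - intros n. apply rsum_shift_pow_le. lra.
Qed.

Lemma power_part_le (s : C) (p : nat) : is_prime p -> 7 / 10 <= Re s ->
  Cmod (power_part s p) <= 4 * INR m * Rpower (INR p) (- (1 + 2 / 5)).
Proof.
  intros Hp Hs. destruct (prime_pow_le p (Re s) Hp Hs) as [Hq Hq2].
  replace (power_part s p) with (power_part s p - 0)%C by ring.
  apply CSeries_bound with (n0 := O); [apply log_terms_summable; auto|].
  intros n _. replace (Csum (fun k => log_term m c s p (k + 2)) 0 n - 0)%C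
    with (Csum (fun k => log_term m c s p (k + 2)) 0 n) by ring.
  eapply Rle_trans; [apply Cmod_Csum_le with (g := fun k => INR m * Rpower (INR p) (- Re s) ^ (k + 2))|].
  - intros k _. apply log_term_le; auto; lia.
  - eapply Rle_trans; [apply rsum_shift_pow_le; lra|]. pose proof (pos_INR m).
    simpl (0 + 2)%nat. nra.
Qed.

Lemma power_part_trunc_le (X : nat) (s : C) (p : nat) : is_prime p -> 7 / 10 <= Re s ->
  Cmod (power_part_trunc X s p) <= 4 * INR m * Rpower (INR p) (- (1 + 2 / 5)).
Proof.
  intros Hp Hs. destruct (prime_pow_le p (Re s) Hp Hs) as [Hq Hq2].
  eapply Rle_trans; [apply Cmod_Csum_le with (g := fun k => INR m * Rpower (INR p) (- Re s) ^ (k + 2))|].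
  - intros k _. apply log_term_le; auto; lia.
  - eapply Rle_trans; [apply rsum_shift_pow_le; lra|]. pose proof (pos_INR m).
    simpl (0 + 2)%nat. nra.
Qed.

Lemma power_part_tail (X : nat) (s : C) (p : nat) : is_prime p -> 7 / 10 <= Re s ->
  Cmod (power_part s p - power_part_trunc X s p) <=
  4 * INR m * (3 / 4) ^ X * Rpower (INR p) (- (1 + 2 / 5)).
Proof.
  intros Hp Hs. destruct (prime_pow_le p (Re s) Hp Hs) as [Hq Hq2].
  apply CSeries_bound with (n0 := X); [apply log_terms_summable; auto|].
  intros n Hn. rewrite (Csum_split _ X n Hn). unfold power_part_trunc.
  match goal with |- Cmod (?u + ?v - ?u) <= _ => replace (u + v - u)%C with v by ring end.
  eapply Rle_trans; [apply Cmod_Csum_le with (g := fun k => INR m * Rpower (INR p) (- Re s) ^ (k + 2))|].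
  - intros k _. apply log_term_le; auto; lia.
  - eapply Rle_trans; [apply rsum_shift_pow_le; lra|]. pose proof (pos_INR m).
    rewrite pow_add. set (q := Rpower (INR p) (- Re s)) in *.
    assert (q ^ S X <= (3 / 4) ^ X).
    { simpl. assert (q ^ X <= (3 / 4) ^ X) by (apply pow_incr; lra).
      assert (0 <= q ^ X) by (apply pow_le; lra). nra. }
    assert (0 <= q ^ S X) by (apply pow_le; lra). assert (0 <= q ^ 2) by (apply pow_le; lra).
    replace (4 * INR m * (3 / 4) ^ X * Rpower (INR p) (- (1 + 2 / 5)))
      with (INR m * (4 * ((3 / 4) ^ X * Rpower (INR p) (- (1 + 2 / 5))))) by ring.
    apply Rmult_le_compat_l; [lra|]. apply Rmult_le_compat_l; [lra|].
    apply Rmult_le_compat; lra.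
Qed.

Lemma at_primes0_le (f : nat -> C) (g : nat -> R) (p : nat) :
  (is_prime p -> Cmod (f p) <= g p) -> (0 <= g p) -> Cmod (at_primes0 f p) <= g p.
Proof.
  intros H Hg. unfold at_primes0. destruct prime_dec as [Hp|Hp]; [now apply H|].
  now rewrite Cmod_0.
Qed.

Lemma at_primes0_small (f : nat -> C) (a b : nat) : (b <= 1)%nat -> Csum (at_primes0 f) a b = RtoC 0.
Proof.
  intros Hb. apply Csum_ind; [reflexivity|]. intros x k Hk ->.
  unfold at_primes0. destruct prime_dec as [Hp|Hp]; [|ring].
  apply is_prime_ge_2 in Hp. lia.
Qed.

(** Starting at [2] avoids the default value of [Rpower] at [0] and fits [tail_pow_le] with
    [M = 1]. *)
Lemma Csum_primes_le (f : nat -> C) (g : nat -> R) (n : nat) :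
  (forall p, 0 <= g p) -> (forall p, is_prime p -> Cmod (f p) <= g p) ->
  Cmod (Csum (at_primes0 f) 0 n) <= rsum g 2 n.
Proof.
  intros Hg Hf.
  destruct (Nat.le_gt_cases n 1) as [L|L].
  - rewrite at_primes0_small, Cmod_0 by exact L. now apply rsum_nonneg.
  - rewrite (Csum_split _ 1 n) by lia. rewrite at_primes0_small by lia.
    rewrite Cplus_0_l. apply Cmod_Csum_le. intros k _. apply at_primes0_le; auto.
Qed.

Lemma sum_7_5_le (n : nat) : rsum (fun k => Rpower (INR k) (- (1 + 2 / 5))) 2 n <= 5 / 2.
Proof.
  eapply Rle_trans; [apply (tail_pow_le (2 / 5) 1 n); [lra | lia]|].
  simpl INR. unfold Rpower. rewrite ln_1, Rmult_0_r, exp_0. lra.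
Qed.

(** The bound does not depend on [X], which leaves [X] free to be chosen in terms of [N] and [y]. *)
Lemma C_trunc_le (X : nat) (s : C) : 7 / 10 <= Re s -> Cmod (C_trunc X s) <= 10 * INR m.
Proof.
  intros Hs. pose proof (pos_INR m).
  eapply Rle_trans.
  - apply Csum_primes_le with (g := fun p => 4 * INR m * Rpower (INR p) (- (1 + 2 / 5))).
    + intros p. apply Rmult_le_pos; [lra | left; apply exp_pos].
    + intros p Hp. now apply power_part_trunc_le.
  - rewrite rsum_scal. pose proof (sum_7_5_le X). nra.
Qed.

Lemma at_primes0_summable (f : nat -> C) (B u : R) : 0 <= B -> 0 < u ->
  (forall p, is_prime p -> Cmod (f p) <= B * Rpower (INR p) (- (1 + u))) ->
  abs_summable (at_primes0 f).
Proof.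
  intros HB Hu H.
  assert (P : forall p, 0 <= B * Rpower (INR p) (- (1 + u)))
    by (intros p; apply Rmult_le_pos; [exact HB | left; apply exp_pos]).
  exists (B * (/ u)). intros n.
  destruct (Nat.le_gt_cases n 1) as [L|L].
  - eapply Rle_trans with (rsum (fun _ => 0) 0 n).
    + apply rsum_le. intros k Hk. unfold at_primes0. destruct prime_dec as [Hp|Hp].
      * apply is_prime_ge_2 in Hp. lia.
      * rewrite Cmod_0; lra.
    + unfold rsum. rewrite sum_n_m_const, Rmult_0_r.
      apply Rmult_le_pos; [exact HB | left; now apply Rinv_0_lt_compat].
  - rewrite rsum_first, rsum_first by lia.
    assert (Z : forall k, (k < 2)%nat -> Cmod (at_primes0 f k) = 0).
    { intros k Hk. unfold at_primes0. destruct prime_dec as [Hp|Hp].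
      - apply is_prime_ge_2 in Hp. lia.
      - apply Cmod_0. }
    rewrite !Z, !Rplus_0_l by lia.
    eapply Rle_trans with (rsum (fun k => B * Rpower (INR k) (- (1 + u))) 2 n).
    + apply rsum_le. intros k _.
      apply (at_primes0_le f (fun k => B * Rpower (INR k) (- (1 + u)))); auto.
    + rewrite rsum_scal. apply Rmult_le_compat_l; [exact HB|].
      eapply Rle_trans; [apply (tail_pow_le u 1 n); [exact Hu | lia]|].
      simpl INR. unfold Rpower. rewrite ln_1, Rmult_0_r, exp_0. lra.
Qed.

(** The first summand pays for the exponents beyond [X + 2], the second for the primes beyond
    [X]. *)
Definition C_tail (X : nat) : R := 10 * INR m * ((3 / 4) ^ X + Rpower (INR X) (- (2 / 5))).

Lemma C_trunc_tail (X : nat) (s : C) : (1 <= X)%nat -> 7 / 10 <= Re s ->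
  Cmod (series_primes (power_part s) - C_trunc X s) <= C_tail X.
Proof.
  intros HX Hs. pose proof (pos_INR m).
  assert (P : forall p, 0 <= 4 * INR m * Rpower (INR p) (- (1 + 2 / 5)))
    by (intros p; apply Rmult_le_pos; [lra | left; apply exp_pos]).
  apply CSeries_bound with (n0 := X).
  - apply at_primes0_summable with (B := 4 * INR m) (u := 2 / 5); try lra.
    intros p Hp. now apply power_part_le.
  - intros n Hn. rewrite (Csum_split _ X n Hn).
    unfold C_trunc.
    match goal with |- Cmod (?u + ?v - ?w) <= _ =>
      replace (u + v - w)%C with ((u - w) + v)%C by ring end.
    eapply Rle_trans; [apply Cmod_triangle|].
    unfold C_tail. rewrite Rmult_plus_distr_l. apply Rplus_le_compat.
    + rewrite <- Csum_minus.
      replace (Csum (fun k => at_primes0 (power_part s) k - at_primes0 (power_part_trunc X s) k)%C 0 X)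
        with (Csum (at_primes0 (fun k => power_part s k - power_part_trunc X s k)%C) 0 X).
      * assert (0 < (3 / 4) ^ X) by (apply pow_lt; lra).
        eapply Rle_trans.
        -- apply Csum_primes_le with
             (g := fun p => 4 * INR m * (3 / 4) ^ X * Rpower (INR p) (- (1 + 2 / 5))).
           ++ intros p. apply Rmult_le_pos; [nra | left; apply exp_pos].
           ++ intros p Hp. now apply power_part_tail.
        -- rewrite rsum_scal. pose proof (sum_7_5_le X).
           replace (10 * INR m * (3 / 4) ^ X) with (4 * INR m * (3 / 4) ^ X * (5 / 2)) by field.
           apply Rmult_le_compat_l; [nra | assumption].
      * unfold Csum. apply sum_n_m_ext. intros k. unfold at_primes0.
        destruct prime_dec; [reflexivity|]. symmetry. exact (Cplus_opp_r 0).
    + eapply Rle_trans.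
      * apply Cmod_Csum_le with (g := fun p => 4 * INR m * Rpower (INR p) (- (1 + 2 / 5))).
        intros k _. apply (at_primes0_le _ (fun p => 4 * INR m * Rpower (INR p) (- (1 + 2 / 5)))); auto.
        intros Hp. now apply power_part_le.
      * rewrite rsum_scal. pose proof (tail_pow_le (2 / 5) X n ltac:(lra) HX).
        replace (10 * INR m * Rpower (INR X) (- (2 / 5)))
          with (4 * INR m * (Rpower (INR X) (- (2 / 5)) / (2 / 5))) by field.
        apply Rmult_le_compat_l; [lra | assumption].
Qed.

Lemma C_tail_small (eps : R) : 0 < eps -> exists X, (1 <= X)%nat /\ C_tail X <= eps.
Proof.
  intros He. pose proof (pos_INR m).
  set (e := eps / (20 * INR m + 1)).
  assert (Hee : 0 < e) by (apply Rdiv_lt_0_compat; lra).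
  destruct (pow_lt_1_zero (3 / 4) ltac:(rewrite Rabs_pos_eq; lra) e Hee) as [n1 N1].
  (* [1 / X <= e^(5/2)] is what makes [X^(- 2/5)] at most [e]. *)
  destruct (archimed_cor1 (Rpower e (5 / 2)) ltac:(apply exp_pos)) as [n2 [N2 N2']].
  exists (Nat.max n1 n2). split; [lia|].
  set (X := Nat.max n1 n2). specialize (N1 X ltac:(lia)).
  rewrite Rabs_pos_eq in N1 by (apply pow_le; lra).
  assert (HX : INR n2 <= INR X) by (apply le_INR; lia).
  assert (0 < INR n2) by (apply lt_0_INR; lia).
  assert (R2 : Rpower (INR X) (- (2 / 5)) <= e).
  { apply Rle_trans with (Rpower (Rpower e (5 / 2)) (2 / 5)).
    - replace (Rpower (INR X) (- (2 / 5))) with (Rpower (/ INR X) (2 / 5)).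
      + apply Rle_Rpower_l; [lra|]. split; [apply Rinv_0_lt_compat; lra|].
        left. eapply Rle_lt_trans; [|exact N2]. apply Rinv_le_contravar; lra.
      + unfold Rpower. rewrite ln_Rinv by lra. f_equal. ring.
    - rewrite Rpower_mult. replace (5 / 2 * (2 / 5)) with 1 by field. rewrite Rpower_1; lra. }
  unfold C_tail.
  apply Rle_trans with (20 * INR m * e); [nra|].
  unfold e. replace (20 * INR m * (eps / (20 * INR m + 1))) with (eps * (20 * INR m) / (20 * INR m + 1))
    by (field; lra).
  apply Rle_div_l; nra.
Qed.

(** * The first powers of the primes *)

Definition prime_term (s : C) (p : nat) : C := (d_coef m c p 1 / natCpow p s)%C.

Lemma prime_term_le (s : C) (p : nat) : is_prime p ->
  Cmod (prime_term s p) <= INR m * Rpower (INR p) (- Re s).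
Proof.
  intros Hp. unfold prime_term. rewrite Cmod_div, Cmod_natCpow, Rpower_Ropp by apply natCpow_neq0.
  apply Rmult_le_compat_r; [left; apply Rinv_0_lt_compat, exp_pos | now apply d_coef_le].
Qed.

Lemma log_term_1 (s : C) (p : nat) : log_term m c s p 1 = prime_term s p.
Proof.
  unfold log_term, prime_term. simpl INR. replace (RtoC 1 * s)%C with s by ring.
  now rewrite Cmult_1_l.
Qed.

Lemma log_series_split (s : C) : 1 < Re s ->
  log_series m c s = (series_primes (prime_term s) + series_primes (power_part s))%C.
Proof.
  intros Hs. pose proof (pos_INR m). unfold log_series, series_primes.
  rewrite <- CSeries_plus.
  - apply CSeries_ext. intros p. unfold at_primes0. destruct prime_dec as [Hp|Hp]; [|ring].
    rewrite (CSeries_first (fun k => log_term m c s p (k + 1))) by (apply log_terms_summable; auto; lra).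
    rewrite log_term_1. f_equal. apply CSeries_ext. intros k. f_equal. lia.
  - apply at_primes0_summable with (B := INR m) (u := Re s - 1); try lra.
    intros p Hp. replace (- (1 + (Re s - 1))) with (- Re s) by ring. now apply prime_term_le.
  - apply at_primes0_summable with (B := 4 * INR m) (u := 2 / 5); try lra.
    intros p Hp. apply power_part_le; auto; lra.
Qed.

(** The first omitted index is kept apart so that the comparison with an integral starts at [S M].
    For [M] the integer part of [y] one has [S M > y], and no loss [(y / M)^u] arises, even for
    large [u]. *)
Lemma log_series_tail (M X : nat) (s : C) (u : R) : (1 <= X)%nat -> 0 < u -> Re s = 1 + u ->
  Cmod (log_series m c s - C_trunc X s - Csum (at_primes0 (prime_term s)) 0 M) <=
  INR m * (Rpower (INR (S M)) (- (1 + u)) + Rpower (INR (S M)) (- u) / u) + C_tail X.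
Proof.
  intros HX Hu Hs. pose proof (pos_INR m). rewrite log_series_split by lra.
  match goal with |- Cmod (?u + ?v - ?w - ?z) <= _ =>
      replace (u + v - w - z)%C with ((u - z) + (v - w))%C by ring end.
  eapply Rle_trans; [apply Cmod_triangle|].
  apply Rplus_le_compat; [|apply C_trunc_tail; auto; lra].
  assert (P : forall p, 0 <= INR m * Rpower (INR p) (- (1 + u)))
    by (intros p; apply Rmult_le_pos; [lra | left; apply exp_pos]).
  apply CSeries_bound with (n0 := S M).
  - apply at_primes0_summable with (B := INR m) (u := u); try lra.
    intros p Hp. rewrite <- Hs. now apply prime_term_le.
  - intros n Hn. rewrite (Csum_split _ M n) by lia.
    match goal with |- Cmod (?u + ?v - ?u) <= _ => replace (u + v - u)%C with v by ring end.
    eapply Rle_trans.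
    + apply Cmod_Csum_le with (g := fun p => INR m * Rpower (INR p) (- (1 + u))).
      intros k _. apply (at_primes0_le _ (fun p => INR m * Rpower (INR p) (- (1 + u)))); auto.
      intros Hp. rewrite <- Hs. now apply prime_term_le.
    + rewrite rsum_scal. apply Rmult_le_compat_l; [lra|].
      rewrite rsum_first by exact Hn. apply Rplus_le_compat_l.
      apply tail_pow_le; [exact Hu | lia].
Qed.

Lemma prime_sum_le (M : nat) (s : C) (u : R) : 0 < u -> Re s = 1 - u ->
  Cmod (Csum (at_primes0 (prime_term s)) 0 M) <= INR m * (Rpower (INR M + 1) u / u).
Proof.
  intros Hu Hs. pose proof (pos_INR m).
  assert (P : forall p, 0 <= INR m * Rpower (INR p) (u - 1))
    by (intros p; apply Rmult_le_pos; [lra | left; apply exp_pos]).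
  eapply Rle_trans.
  - apply Csum_primes_le with (g := fun p => INR m * Rpower (INR p) (u - 1)); auto.
    intros p Hp. replace (u - 1) with (- Re s) by lra. now apply prime_term_le.
  - rewrite rsum_scal. apply Rmult_le_compat_l; [lra|].
    eapply Rle_trans; [|apply sum_pow_pred_le; exact Hu].
    destruct M as [|M]; [rewrite !rsum_empty by lia; lra|].
    rewrite (rsum_first _ 1) by lia. pose proof (exp_pos ((u - 1) * ln (INR 1))) as E.
    unfold Rpower at 2. lra.
Qed.

(** * Differentiability of the finite sums in s *)

Lemma cdiff_Csum (f : C -> nat -> C) (a b : nat) (z : C) :
  (forall k, cdiff (fun w => f w k) z) -> cdiff (fun w => Csum (f w) a b) z.
Proof.
  intros H. destruct (Nat.le_gt_cases a (S b)) as [Hab|Hab].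
  2: { apply cdiff_ext with (fun _ => RtoC 0); [|apply cdiff_const].
       intros w. now rewrite Csum_empty by lia. }
  induction b as [|b IH].
  - destruct a as [|a].
    + apply cdiff_ext with (fun w => f w O); [|apply H]. intros w. unfold Csum. now rewrite sum_n_n.
    + apply cdiff_ext with (fun _ => RtoC 0); [|apply cdiff_const].
      intros w. now rewrite Csum_empty by lia.
  - destruct (Nat.eq_dec a (S (S b))) as [->|N].
    + apply cdiff_ext with (fun _ => RtoC 0); [|apply cdiff_const].
      intros w. now rewrite Csum_empty by lia.
    + apply cdiff_ext with (fun w => Csum (f w) a b + f w (S b))%C.
      * intros w. now rewrite Csum_S by lia.
      * apply cdiff_plus; [apply IH; lia | apply H].
Qed.

Lemma cdiff_at_primes0 (f : C -> nat -> C) (p : nat) (z : C) :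
  (is_prime p -> cdiff (fun w => f w p) z) -> cdiff (fun w => at_primes0 (f w) p) z.
Proof.
  intros H. unfold at_primes0. destruct prime_dec as [Hp|Hp]; [now apply H | apply cdiff_const].
Qed.

Lemma cdiff_log_term (p l : nat) (z : C) : (1 <= l)%nat -> cdiff (fun s => log_term m c s p l) z.
Proof.
  intros Hl. apply cdiff_div; [|apply cdiff_const|].
  - apply Cmult_neq_0; [|apply natCpow_neq0]. intros E. apply RtoC_inj in E.
    apply le_INR in Hl. simpl in Hl. lra.
  - apply cdiff_mult; [apply cdiff_const|]. apply cdiff_natCpow.
    apply cdiff_mult; [apply cdiff_const | apply cdiff_id].
Qed.

Lemma cdiff_C_trunc (X : nat) (z : C) : cdiff (C_trunc X) z.
Proof.
  apply (cdiff_Csum (fun s => at_primes0 (power_part_trunc X s))). intros p.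
  apply (cdiff_at_primes0 (power_part_trunc X)). intros _.
  apply (cdiff_Csum (fun s k => log_term m c s p (k + 2))). intros k. apply cdiff_log_term. lia.
Qed.

Lemma cdiff_prime_sum (M : nat) (z : C) :
  cdiff (fun s => Csum (at_primes0 (prime_term s)) 0 M) z.
Proof.
  apply (cdiff_Csum (fun s => at_primes0 (prime_term s))). intros p.
  apply (cdiff_at_primes0 prime_term). intros _.
  apply cdiff_div; [apply natCpow_neq0 | apply cdiff_const | apply cdiff_natCpow, cdiff_id].
Qed.

End EulerProductLog.

(** * The approximation of log L *)

Lemma log_series_at_2 (m : nat) (c : nat -> nat -> C) (t : R) : coef_bounded m c ->
  Cmod (log_series m c (2, t)) <= 30 * INR m.
Proof.
  intros Hc. pose proof (pos_INR m).
  (* An empty prime sum, [X = 1] and [u = 1]: the tail gives [2 m + 35/2 m], and the truncation adds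
     [10 m]. *)
  pose proof (log_series_tail m c Hc 0 1 (2, t) 1 ltac:(lia) ltac:(lra) ltac:(simpl; lra)) as T.
  pose proof (C_trunc_le m c Hc 1 (2, t) ltac:(simpl; lra)) as B.
  rewrite at_primes0_small in T by lia.
  assert (R1 : forall x, Rpower 1 x = 1) by (intros; unfold Rpower; now rewrite ln_1, Rmult_0_r, exp_0).
  unfold C_tail in T. simpl INR in T. rewrite !R1 in T.
  replace (log_series m c (2, t)) with
    ((log_series m c (2, t) - C_trunc m c 1 (2, t) - 0) + C_trunc m c 1 (2, t))%C by ring.
  eapply Rle_trans; [apply Cmod_triangle|]. lra.
Qed.

Lemma ln_ge_2 (N : nat) : (16 <= N)%nat -> 2 < ln (INR N).
Proof.
  intros HN. apply le_INR in HN. replace (INR 16) with (2 ^ 4) in HN by (simpl; lra).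
  apply Rlt_le_trans with (ln (2 ^ 4)).
  - rewrite ln_pow by lra. simpl INR. pose proof ln_lt_2. lra.
  - apply ln_le; [simpl; lra | exact HN].
Qed.

(** Collects, per unit of [ln N], the logarithm of the growth bound for [L] ([Rmax A 1] makes the
    logarithm of the constant harmless) and [30 m] for log L on the line [Re s = 2]. *)
Definition growth_const (m : nat) (gamma1 gamma2 A : R) : R :=
  Rmax A 1 + gamma1 + 2 * gamma2 + 30 * INR m.

Lemma growth_const_ge_1 (m : nat) (gamma1 gamma2 A : R) :
  0 < gamma1 -> 0 < gamma2 -> 1 <= growth_const m gamma1 gamma2 A.
Proof.
  intros H1 H2. unfold growth_const. pose proof (pos_INR m). pose proof (Rmax_r A 1). lra.
Qed.

Section ZeroFreeRegion.

Variables (m : nat) (gamma1 gamma2 A : R) (c : nat -> nat -> C) (N : nat)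
  (delta sigmaL : R) (L logL : C -> C).
Hypotheses (Hg1 : 0 < gamma1) (Hg2 : 0 < gamma2) (Hc : coef_bounded m c)
  (HN : (16 <= N)%nat) (Hd : 0 < delta < 7 / 2) (HsL : delta < 7 * (1 - sigmaL)).
Hypothesis L_growth : forall s : C, sigmaL < Re s < 4 ->
  Cmod (L s) <= A * (Rpower (INR N) gamma1 * Rpower (1 + Rabs (Im s)) gamma2).
Hypothesis logL_branch : is_log_branch m c (D_region delta N) L logL.

Let Lam := ln (INR N).

Lemma logL_diff (z : C) : D_region delta N z -> cdiff logL z.
Proof.
  intros Hz. destruct logL_branch as [(U & _ & HU & DU) _].
  apply ex_derive_cdiff, DU, HU, Hz.
Qed.

(** [3 / 2] exceeds the half-side [1 + delta / 8] of the squares used in [logL_le], and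
    [Lam + 3 / 2 <= 2 Lam^3] as [Lam > 2]. *)
Lemma in_D_region (z : C) : 1 - delta / 7 <= Re z -> Rabs (Im z) <= Lam + 3 / 2 ->
  D_region delta N z.
Proof.
  intros H1 H2. destruct (Rle_dec 1 (Re z)) as [G|G]; [now left|]. right.
  split; [lra|]. fold Lam. pose proof (ln_ge_2 N HN) as HL. fold Lam in HL. simpl.
  assert (4 <= Lam * Lam) by nra. nra.
Qed.

(** The real part of [logL] is the logarithm of the modulus of [L]. The crude
    [ln (1 + |t|) <= |t| <= 2 * Lam] is enough, because the factor [N^gamma1] already contributes a
    multiple of [Lam]. *)
Lemma Re_logL_le (w : C) : 1 - delta / 7 <= Re w < 4 -> Rabs (Im w) <= Lam + 3 / 2 ->
  Re (logL w) <= (Rmax A 1 + gamma1 + 2 * gamma2) * Lam.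
Proof.
  intros Hw1 Hw2. pose proof (ln_ge_2 N HN) as HL. fold Lam in HL.
  destruct logL_branch as [_ [HE _]].
  specialize (HE w (in_D_region w (proj1 Hw1) Hw2)).
  specialize (L_growth w ltac:(lra)). rewrite <- HE, Cmod_Cexp in L_growth.
  pose proof (Rmax_l A 1) as M1. pose proof (Rmax_r A 1) as M2. set (A' := Rmax A 1) in *.
  assert (P1 : 0 < Rpower (INR N) gamma1) by apply exp_pos.
  assert (P2 : 0 < Rpower (1 + Rabs (Im w)) gamma2) by apply exp_pos.
  assert (G : exp (Re (logL w)) <= A' * (Rpower (INR N) gamma1 * Rpower (1 + Rabs (Im w)) gamma2)).
  { eapply Rle_trans; [exact L_growth|]. apply Rmult_le_compat_r; [|exact M1]. nra. }
  apply ln_le in G; [|apply exp_pos]. rewrite ln_exp, !ln_mult in G; try nra.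
  unfold Rpower in G. rewrite !ln_exp in G. fold Lam in G.
  pose proof (Rabs_pos (Im w)).
  pose proof (ln_le_sub_1 (1 + Rabs (Im w)) ltac:(lra)). pose proof (ln_le_sub_1 A' ltac:(lra)).
  assert (gamma2 * ln (1 + Rabs (Im w)) <= gamma2 * (2 * Lam)) by (apply Rmult_le_compat_l; lra).
  assert (A' <= A' * Lam) by nra. lra.
Qed.

(** Borel-Caratheodory about [2 + i Im z] with half-side [1 + delta / 8]: the square stays to the
    right of [1 - delta / 7], while [z] is within [1 + delta / 12] of the centre. The ratio of these
    falls short of [1] by [delta / 24] over [1 + delta / 8], which yields [48 (1 + delta / 8) <= 72]
    over [delta]. *)
Lemma logL_le (z : C) : 1 - delta / 12 <= Re z <= 1 -> Rabs (Im z) <= Lam ->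
  Cmod (logL z) <= (72 * growth_const m gamma1 gamma2 A + 60 * INR m) * Lam / delta.
Proof.
  intros Hz1 Hz2. pose proof (ln_ge_2 N HN) as HL. fold Lam in HL. pose proof (pos_INR m).
  pose proof (growth_const_ge_1 m gamma1 gamma2 A Hg1 Hg2) as HG.
  set (K := growth_const m gamma1 gamma2 A) in *.
  set (s0 := (2, Im z) : C).
  assert (B0 : Cmod (logL s0) <= 30 * INR m).
  { destruct logL_branch as [_ [_ HS]]. rewrite HS by (simpl; lra). now apply log_series_at_2. }
  assert (Box : forall w, in_rect (2 - (1 + delta / 8)) (2 + (1 + delta / 8))
      (Im z - (1 + delta / 8)) (Im z + (1 + delta / 8)) w ->
      1 - delta / 7 <= Re w < 4 /\ Rabs (Im w) <= Lam + 3 / 2).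
  { intros w [H1 H2]. apply Rabs_le_between in Hz2. split; [lra|]. apply Rabs_le. lra. }
  assert (Bz : Cmod (logL z - logL s0) <=
     2 * (K * Lam) / (1 - (1 + delta / 12) / (1 + delta / 8))).
  { apply (borel_caratheodory_square logL s0 z (1 + delta / 8)).
    - lra.
    - nra.
    - apply Rlt_div_l; lra.
    - intros w Hw. destruct (Box w Hw). apply logL_diff, in_D_region; lra.
    - intros w Hw. destruct (Box w Hw) as [W1 W2].
      pose proof (Re_logL_le w W1 W2) as RB. pose proof (re_le_Cmod (logL s0)) as RS.
      replace (Re (logL w - logL s0)) with (Re (logL w) - Re (logL s0))
        by (destruct (logL w), (logL s0); simpl; ring).
      pose proof (Rle_abs (- Re (logL s0))) as RN. rewrite Rabs_Ropp in RN.
      unfold K, growth_const. assert (30 * INR m <= 30 * INR m * Lam) by nra. lra.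
    - replace (z - s0)%C with (RtoC (Re z - 2)).
      + rewrite Cmod_R, Rabs_left1 by lra.
        replace ((1 + delta / 12) / (1 + delta / 8) * (1 + delta / 8)) with (1 + delta / 12) by (field; lra).
        lra.
      + unfold s0. destruct z; apply injective_projections; simpl; ring. }
  replace (logL z) with ((logL z - logL s0) + logL s0)%C by ring.
  eapply Rle_trans; [apply Cmod_triangle|].
  eapply Rle_trans; [apply Rplus_le_compat; [exact Bz | exact B0]|].
  replace (2 * (K * Lam) / (1 - (1 + delta / 12) / (1 + delta / 8)))
    with (48 * (1 + delta / 8) * K * Lam / delta) by (field; lra).
  replace ((72 * K + 60 * INR m) * Lam / delta)
    with (72 * K * Lam / delta + 30 * INR m * (2 * Lam / delta)) by (field; lra).
  apply Rplus_le_compat.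
  - apply Rmult_le_compat_r; [left; apply Rinv_0_lt_compat; lra|].
    apply Rmult_le_compat_r; [lra|]. apply Rmult_le_compat_r; lra.
  - rewrite <- (Rmult_1_r (30 * INR m)) at 1. apply Rmult_le_compat_l; [lra|].
    apply Rle_div_r; lra.
Qed.

(** The bound of [logL_le] with [20 m] more for the truncation: [10 m <= 20 m Lam / delta]. *)
Definition edge_const : R := 72 * growth_const m gamma1 gamma2 A + 80 * INR m.

Lemma edge_const_nonneg : 0 <= edge_const.
Proof.
  unfold edge_const. pose proof (growth_const_ge_1 m gamma1 gamma2 A Hg1 Hg2).
  pose proof (pos_INR m). lra.
Qed.

Lemma exp_neg_sq_le (z : R) : 0 < z -> exp (- z) <= / z /\ exp (- z) <= 4 / (z * z).
Proof.
  intros Hz. pose proof (exp_ineq1_le z) as E1. pose proof (exp_ineq1_le (z / 2)) as E2.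
  assert (E3 : z * z / 4 <= exp z).
  { replace z with (z / 2 + z / 2) at 3 by field. rewrite exp_plus.
    replace (z * z / 4) with (z / 2 * (z / 2)) by field. apply Rmult_le_compat; lra. }
  rewrite exp_Ropp. split.
  - apply Rinv_le_contravar; lra.
  - replace (4 / (z * z)) with (/ (z * z / 4)) by (field; lra).
    apply Rinv_le_contravar; [nra | exact E3].
Qed.

(** * Contour bounds for given alpha and y *)

Section Approximation.

Variables (alpha y : R).
Hypotheses (Hm : (1 <= m)%nat) (Halpha : 1 - delta / 28 < alpha < 2 - delta / 7)
  (Hy : Rpower Lam (14 / delta) <= y <= Rpower (INR N) (2 * PI / 5)).

Let M := Z.to_nat (Int_part y).
Let Y := ln y.

Lemma Lam_gt_2 : 2 < Lam.
Proof. exact (ln_ge_2 N HN). Qed.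

Lemma Lam_le_y : Lam <= y.
Proof.
  pose proof Lam_gt_2. eapply Rle_trans; [|apply Hy].
  rewrite <- (Rpower_1 Lam) at 1 by lra. apply Rle_Rpower; [lra|].
  apply Rle_div_r; lra.
Qed.

(** The lower bound on [y] in logarithmic form; it lets a small power of [y] absorb [ln Lam]. *)
Lemma ln_Lam_le : 0 < ln Lam /\ ln Lam <= delta * Y / 14.
Proof.
  pose proof Lam_gt_2. pose proof Lam_le_y.
  split; [rewrite <- ln_1; apply ln_increasing; lra|].
  pose proof (ln_le _ _ (exp_pos _) (proj1 Hy)) as E. unfold Rpower in E. rewrite ln_exp in E.
  fold Y in E. apply Rle_div_r; [lra|].
  apply (Rmult_le_compat_l delta) in E; [|lra].
  replace (delta * (14 / delta * ln Lam)) with (ln Lam * 14) in E by (field; lra). exact E.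
Qed.

Lemma Y_bounds : 0 < Y /\ Y <= 2 * Lam.
Proof.
  pose proof Lam_gt_2. pose proof Lam_le_y. split.
  - unfold Y. rewrite <- ln_1. apply ln_increasing; lra.
  - pose proof (ln_le y _ ltac:(lra) (proj2 Hy)) as E. unfold Rpower in E. rewrite ln_exp in E.
    fold Y Lam in E. pose proof PI_4. nra.
Qed.

Lemma floor_bounds : INR M <= y < INR (S M).
Proof.
  pose proof Lam_gt_2. pose proof Lam_le_y. destruct (base_Int_part y) as [I1 I2].
  assert (HZ : (0 <= Int_part y)%Z).
  { assert (-1 < Int_part y)%Z; [|lia]. apply lt_IZR. lra. }
  rewrite S_INR. unfold M. rewrite INR_IZR_INZ, Z2Nat.id by exact HZ. lra.
Qed.

(** The term at [S M] is at most [1 / (u y^u)] because [u <= Lam <= y < S M], and so is the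
    integral. Together they give [2 m]; the truncation error [e] gives at most [1 <= m]. *)
Lemma tail_weighted (u e : R) : 0 < u <= Lam -> 0 <= e -> e * (Lam * Rpower y Lam) <= 1 ->
  (INR m * (Rpower (INR (S M)) (- (1 + u)) + Rpower (INR (S M)) (- u) / u) + e) * u * exp (u * Y)
  <= 3 * INR m.
Proof.
  intros Hu He HeX. pose proof Lam_gt_2. pose proof Lam_le_y. pose proof floor_bounds as [F1 F2].
  assert (Hm1 : 1 <= INR m) by (apply (le_INR 1); exact Hm).
  change (exp (u * Y)) with (Rpower y u).
  assert (Py : 0 < Rpower y u) by apply exp_pos.
  assert (A1 : Rpower (INR (S M)) (- u) <= / Rpower y u).
  { rewrite Rpower_Ropp. apply Rinv_le_contravar; [exact Py|]. apply Rle_Rpower_l; lra. }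
  assert (A2 : Rpower (INR (S M)) (- (1 + u)) <= / Rpower y u * / u).
  { replace (- (1 + u)) with (- u - 1) by ring. rewrite Rpower_pred by lra.
    apply Rmult_le_compat; [left; apply exp_pos | left; apply Rinv_0_lt_compat; lra | exact A1 |].
    apply Rinv_le_contravar; lra. }
  assert (A3 : e * u * Rpower y u <= 1).
  { eapply Rle_trans; [|exact HeX]. rewrite Rmult_assoc. apply Rmult_le_compat_l; [exact He|].
    apply Rmult_le_compat; [lra | lra | lra |]. apply Rle_Rpower; lra. }
  assert (A4 : INR m * (Rpower (INR (S M)) (- (1 + u)) + Rpower (INR (S M)) (- u) / u) <=
     INR m * (2 * (/ Rpower y u * / u))).
  { apply Rmult_le_compat_l; [lra|].
    assert (Rpower (INR (S M)) (- u) / u <= / Rpower y u * / u); [|lra].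
    apply Rmult_le_compat_r; [left; apply Rinv_0_lt_compat; lra | exact A1]. }
  rewrite !Rmult_plus_distr_r.
  assert (A5 : INR m * (Rpower (INR (S M)) (- (1 + u)) + Rpower (INR (S M)) (- u) / u) * u * Rpower y u
     <= INR m * (2 * (/ Rpower y u * / u)) * u * Rpower y u).
  { apply Rmult_le_compat_r; [lra|]. apply Rmult_le_compat_r; lra. }
  replace (INR m * (2 * (/ Rpower y u * / u)) * u * Rpower y u) with (2 * INR m) in A5 by (field; lra).
  lra.
Qed.

(** Replacing [M + 1] by [y] costs [(1 + 1 / y)^u], which is at most [exp 1 <= 3] because
    [u <= Lam <= y]. *)
Lemma sum_weighted (u : R) : 0 < u <= Lam ->
  INR m * (Rpower (INR M + 1) u / u) * u * exp (- u * Y) <= 3 * INR m.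
Proof.
  intros Hu. pose proof Lam_gt_2. pose proof Lam_le_y. pose proof floor_bounds as [F1 F2].
  pose proof (pos_INR m). pose proof (pos_INR M).
  assert (B : Rpower (INR M + 1) u <= exp (u * Y) * 3).
  { apply Rle_trans with (Rpower (y * (1 + / y)) u).
    - apply Rle_Rpower_l; [lra|]. replace (y * (1 + / y)) with (y + 1) by (field; lra). lra.
    - assert (0 < / y) by (apply Rinv_0_lt_compat; lra).
      rewrite <- Rpower_mult_distr by lra. apply Rmult_le_compat_l; [left; apply exp_pos|].
      unfold Rpower. eapply Rle_trans; [|exact exp_le_3]. apply exp_mono.
      pose proof (ln_le_sub_1 (1 + / y) ltac:(lra)).
      apply Rle_trans with (u * / y); [apply Rmult_le_compat_l; lra|].
      apply Rle_div_l; lra. }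
  replace (INR m * (Rpower (INR M + 1) u / u) * u * exp (- u * Y))
    with (INR m * (Rpower (INR M + 1) u * exp (- u * Y))) by (field; lra).
  replace (3 * INR m) with (INR m * (exp (u * Y) * 3 * exp (- u * Y))).
  - apply Rmult_le_compat_l; [lra|]. apply Rmult_le_compat_r; [left; apply exp_pos | exact B].
  - replace (exp (u * Y) * 3 * exp (- u * Y)) with (3 * (exp (u * Y) * exp (- u * Y))) by ring.
    rewrite <- exp_plus. replace (u * Y + - u * Y) with 0 by ring. rewrite exp_0. ring.
Qed.

Lemma approximation_contour :
  Cmod (logL (RtoC alpha) - (Csum (at_primes0 (prime_term m c (RtoC alpha))) 0 M + C_const m c alpha)) <=
  144 * (3 * INR m * exp ((1 - alpha) * Y) / Lam
    + edge_const * Lam / delta * exp ((1 - alpha) * Y) * (delta / 12) / (Lam * Lam * Y)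
    + edge_const * Lam / delta * exp ((1 - alpha - delta / 12) * Y)
      * ln (1 + Lam / (delta / 12 - (1 - alpha))))
  + exp ((1 - alpha) * Y) / Lam.
Proof.
  pose proof Lam_gt_2 as HL. pose proof Lam_le_y as HLy. pose proof Y_bounds as [Y1 Y2].
  pose proof edge_const_nonneg as HK. pose proof (pos_INR m) as Hm0.
  (* The tolerance for the truncation: its weight [u * y^u] never exceeds [Lam * y^Lam] on the
     contour. *)
  set (e0 := / (Lam * Rpower y Lam)).
  assert (He0 : 0 < e0).
  { apply Rinv_0_lt_compat. apply Rmult_lt_0_compat; [lra | apply exp_pos]. }
  destruct (C_tail_small m e0 He0) as (X & HX & HXe).
  assert (HX0 : 0 <= C_tail m X).
  { unfold C_tail. assert (0 < (3 / 4) ^ X) by (apply pow_lt; lra).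
    pose proof (exp_pos (- (2 / 5) * ln (INR X))) as P. fold (Rpower (INR X) (- (2 / 5))) in P.
    apply Rmult_le_pos; lra. }
  set (H := fun w => (logL (RtoC alpha + w) - C_trunc m c X (RtoC alpha + w))%C).
  set (S := fun w => Csum (at_primes0 (prime_term m c (RtoC alpha + w))) 0 M).
  assert (Shift : forall w, cdiff (fun w => RtoC alpha + w)%C w)
    by (intros w; apply cdiff_plus; [apply cdiff_const | apply cdiff_id]).
  assert (NC : Cmod (H 0 - S 0) <= 144 *
    (3 * INR m * exp ((1 - alpha) * Y) / Lam
     + edge_const * Lam / delta * exp ((1 - alpha) * Y) * (delta / 12) / (Lam * Lam * Y)
     + edge_const * Lam / delta * exp ((1 - alpha - delta / 12) * Y)
       * ln (1 + Lam / (delta / 12 - (1 - alpha))))).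
  { apply newman_contour; try lra.
    - intros w [W1 W2]. apply cdiff_minus.
      + apply (cdiff_comp logL (fun w => RtoC alpha + w)%C); [apply Shift|].
        apply logL_diff, in_D_region; destruct w; simpl in *; [lra|]. apply Rabs_le; lra.
      + apply (cdiff_comp (C_trunc m c X) (fun w => RtoC alpha + w)%C); [apply Shift | apply cdiff_C_trunc].
    - intros w. apply (cdiff_comp (fun s => Csum (at_primes0 (prime_term m c s)) 0 M)
        (fun w => RtoC alpha + w)%C); [apply Shift | apply cdiff_prime_sum].
    - intros u t Hu Ht. unfold H, S.
      replace (RtoC alpha + ((1 - alpha + u)%R, t))%C with ((1 + u, t)%R : C)
        by (apply injective_projections; simpl; ring).
      destruct logL_branch as [_ [_ HS]]. rewrite HS by (simpl; lra).
      eapply Rle_trans; [|apply (tail_weighted u (C_tail m X) Hu HX0)].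
      + apply Rmult_le_compat_r; [left; apply exp_pos|]. apply Rmult_le_compat_r; [lra|].
        apply log_series_tail; auto; lra.
      + apply Rle_trans with (e0 * (Lam * Rpower y Lam)).
        * apply Rmult_le_compat_r; [|exact HXe]. apply Rmult_le_pos; [lra | left; apply exp_pos].
        * unfold e0. rewrite Rinv_l; [lra|]. apply Rgt_not_eq, Rmult_lt_0_compat; [lra | apply exp_pos].
    - intros u t Hu Ht. unfold S.
      replace (RtoC alpha + ((1 - alpha - u)%R, t))%C with ((1 - u, t)%R : C)
        by (apply injective_projections; simpl; ring).
      eapply Rle_trans; [|apply (sum_weighted u Hu)].
      apply Rmult_le_compat_r; [left; apply exp_pos|]. apply Rmult_le_compat_r; [lra|].
      apply prime_sum_le; auto; lra.
    - intros u t Hu Ht. unfold H.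
      replace (RtoC alpha + ((1 - alpha - u)%R, t))%C with ((1 - u, t)%R : C)
        by (apply injective_projections; simpl; ring).
      eapply Rle_trans; [apply Cmod_minus_le|].
      pose proof (logL_le (1 - u, t)%R ltac:(simpl; lra) Ht) as B1.
      pose proof (C_trunc_le m c Hc X (1 - u, t)%R ltac:(simpl; lra)) as B2.
      unfold edge_const.
      assert (1 <= 2 * Lam / delta) by (apply Rle_div_r; lra).
      replace ((72 * growth_const m gamma1 gamma2 A + 80 * INR m) * Lam / delta)
        with ((72 * growth_const m gamma1 gamma2 A + 60 * INR m) * Lam / delta
              + 10 * INR m * (2 * Lam / delta)) by (field; lra).
      assert (10 * INR m * 1 <= 10 * INR m * (2 * Lam / delta)) by (apply Rmult_le_compat_l; lra).
      lra. }
  (* The same tolerance covers the passage from C_X back to the full constant, since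
     [- Lam <= 1 - alpha]. *)
  assert (CT : Cmod (C_const m c alpha - C_trunc m c X (RtoC alpha)) <= exp ((1 - alpha) * Y) / Lam).
  { eapply Rle_trans; [apply (C_trunc_tail m c Hc X (RtoC alpha) HX); simpl; lra|].
    eapply Rle_trans; [exact HXe|]. unfold e0. rewrite Rinv_mult, Rmult_comm.
    apply Rmult_le_compat_r; [left; apply Rinv_0_lt_compat; lra|].
    rewrite <- Rpower_Ropp. unfold Rpower. apply exp_mono. fold Y. nra. }
  replace (logL (RtoC alpha) - (Csum (at_primes0 (prime_term m c (RtoC alpha))) 0 M + C_const m c alpha))%C
    with ((H 0 - S 0) - (C_const m c alpha - C_trunc m c X (RtoC alpha)))%C.
  - eapply Rle_trans; [apply Cmod_minus_le|]. apply Rplus_le_compat; assumption.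
  - unfold H, S. rewrite Cplus_0_r. ring.
Qed.

(** [1728 = 144 * 3 * 4] for the tail and the sum, [288 = 144 * 2] for the horizontal sides of [H],
    [4] for the truncation, and the last summand for the vertical side of [H]. *)
Definition error_const : R := 1728 * INR m + 288 * edge_const + 4 + 144 * (8820 * edge_const).

(* As [delta / 12 - delta / 14 = delta / 84], a factor [exp (- (x / 84))] with
   [x = delta * Y] is available; it absorbs [ln Lam <= x / 14] as well as one
   factor [1 / x]. *)
Lemma log_factor_le :
  exp ((1 - alpha - delta / 12) * Y) * ln (1 + Lam / (delta / 12 - (1 - alpha))) <=
  8820 * (exp ((1 - delta / 14 - alpha) * Y) / (delta * delta * Y)).
Proof.
  pose proof Lam_gt_2 as HL. pose proof Y_bounds as [Y1 Y2]. pose proof ln_Lam_le as [L1 L2].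
  (* The left side is at distance more than [delta / 12 - delta / 28 = delta / 21] from the pole; as
     [Lam > 1], a factor [Lam] can be taken out of the logarithm. *)
  assert (Ln : ln (1 + Lam / (delta / 12 - (1 - alpha))) <= delta * Y / 14 + 21 / delta).
  { apply Rle_trans with (ln (Lam * (1 + 21 / delta))).
    - assert (0 < Lam / (delta / 12 - (1 - alpha))) by (apply Rdiv_lt_0_compat; lra).
      apply ln_le; [lra|].
      assert (Lam / (delta / 12 - (1 - alpha)) <= Lam * (21 / delta)).
      { apply Rmult_le_compat_l; [lra|]. replace (21 / delta) with (/ (delta / 21)) by (field; lra).
        apply Rinv_le_contravar; lra. }
      lra.
    - assert (0 < 21 / delta) by (apply Rdiv_lt_0_compat; lra).
      rewrite ln_mult by lra. pose proof (ln_le_sub_1 (1 + 21 / delta) ltac:(lra)). lra. }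
  set (x := delta * Y). assert (Hx : 0 < x) by (unfold x; nra).
  destruct (exp_neg_sq_le (x / 84) ltac:(lra)) as [E1 E2].
  replace (exp ((1 - alpha - delta / 12) * Y))
    with (exp ((1 - delta / 14 - alpha) * Y) * exp (- (x / 84)))
    by (rewrite <- exp_plus; f_equal; unfold x; field).
  rewrite Rmult_assoc.
  replace (8820 * (exp ((1 - delta / 14 - alpha) * Y) / (delta * delta * Y)))
    with (exp ((1 - delta / 14 - alpha) * Y) * (8820 / (delta * x))) by (unfold x; field; lra).
  apply Rmult_le_compat_l; [left; apply exp_pos|].
  pose proof (exp_pos (- (x / 84))) as P.
  apply Rle_trans with (exp (- (x / 84)) * (x / 14 + 21 / delta)).
  { apply Rmult_le_compat_l; [lra | exact Ln]. }
  rewrite Rmult_plus_distr_l.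
  (* The quadratic decay is spent on [x / 14] and the linear one on [21 / delta]:
     [4 * 84^2 / 14 = 2016] and [84 * 21 = 1764]. Then [delta < 7 / 2] turns [2016] into
     [7056 / delta], and [7056 + 1764 = 8820]. *)
  assert (T1 : exp (- (x / 84)) * (x / 14) <= 2016 / x).
  { replace (2016 / x) with (4 / (x / 84 * (x / 84)) * (x / 14)) by (field; lra).
    apply Rmult_le_compat_r; lra. }
  assert (T2 : exp (- (x / 84)) * (21 / delta) <= 1764 / (delta * x)).
  { replace (1764 / (delta * x)) with (/ (x / 84) * (21 / delta)) by (field; lra).
    apply Rmult_le_compat_r; [|exact E1]. left; apply Rdiv_lt_0_compat; lra. }
  assert (T3 : 2016 / x <= 7056 / (delta * x)).
  { replace (7056 / (delta * x)) with (7056 / delta / x) by (field; lra).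
    apply Rmult_le_compat_r; [left; now apply Rinv_0_lt_compat|]. apply (proj1 (Rle_div_r 2016 7056 delta ltac:(lra))); lra. }
  replace (8820 / (delta * x)) with (7056 / (delta * x) + 1764 / (delta * x)) by (field; lra).
  lra.
Qed.

Theorem approximation :
  Cmod (logL (RtoC alpha) - (Csum (at_primes0 (prime_term m c (RtoC alpha))) 0 M + C_const m c alpha)) <=
  error_const * (Rpower y (1 - alpha) / ((2 - alpha) ^ 2 * ln y)
           + Lam ^ 2 / (ln Lam * Rpower Lam (14 / delta))
           + Rpower y (1 + delta / 14) * Rpower Lam (delta / 14 + 3 / 2)
             / (delta ^ 2 * Rpower (INR N) (PI / 2))
           + Rpower y (1 - delta / 14 - alpha) * Lam / (delta ^ 3 * ln y)).
Proof.
  pose proof Lam_gt_2 as HL. pose proof Y_bounds as [Y1 Y2]. pose proof ln_Lam_le as [L1 L2].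
  pose proof edge_const_nonneg as HK. pose proof (pos_INR m) as Hm0.
  eapply Rle_trans; [exact approximation_contour|].
  change (ln y) with Y. unfold Rpower at 1. fold Y.
  set (Ea := exp ((1 - alpha) * Y)). assert (HEa : 0 < Ea) by apply exp_pos.
  (* The contour contributions are absorbed by [E1] and [E4]; for [E2] and [E3] nonnegativity
     suffices. *)
  set (E2 := Lam ^ 2 / (ln Lam * Rpower Lam (14 / delta))).
  assert (HE2 : 0 <= E2).
  { apply Rdiv_le_0_compat; [nra|]. apply Rmult_lt_0_compat; [lra | apply exp_pos]. }
  set (E3 := Rpower y (1 + delta / 14) * Rpower Lam (delta / 14 + 3 / 2)
     / (delta ^ 2 * Rpower (INR N) (PI / 2))).
  assert (HE3 : 0 <= E3).
  { apply Rdiv_le_0_compat.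
    - left; apply Rmult_lt_0_compat; apply exp_pos.
    - apply Rmult_lt_0_compat; [nra | apply exp_pos]. }
  set (E1 := Ea / ((2 - alpha) ^ 2 * Y)).
  (* From [alpha > 1 - delta / 28 > 7 / 8] one has [(2 - alpha)^2 < 2]. *)
  assert (B1 : Ea / Y <= 2 * E1).
  { unfold E1. assert (0 < (2 - alpha) ^ 2 <= 2) by (simpl; split; nra).
    replace (2 * (Ea / ((2 - alpha) ^ 2 * Y))) with (Ea / Y * (2 / (2 - alpha) ^ 2)) by (field; lra).
    rewrite <- (Rmult_1_r (Ea / Y)) at 1.
    apply Rmult_le_compat_l; [left; now apply Rdiv_lt_0_compat|]. apply Rle_div_r; lra. }
  (* Here [y <= N ^ (2 PI / 5)] is used, through [Y <= 2 * Lam]. *)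
  assert (B2 : Ea / Lam <= 4 * E1).
  { apply Rle_trans with (2 * (Ea / Y)); [|lra].
    replace (2 * (Ea / Y)) with (Ea * (2 / Y)) by (field; lra).
    apply Rmult_le_compat_l; [lra|]. replace (2 / Y) with (/ (Y / 2)) by (field; lra).
    apply Rinv_le_contravar; lra. }
  assert (B3 : edge_const * Lam / delta * Ea * (delta / 12) / (Lam * Lam * Y) <= edge_const * (2 * E1)).
  { replace (edge_const * Lam / delta * Ea * (delta / 12) / (Lam * Lam * Y))
      with (edge_const * (Ea / Y * / (12 * Lam))) by (field; lra).
    apply Rmult_le_compat_l; [exact HK|]. eapply Rle_trans; [|exact B1].
    rewrite <- (Rmult_1_r (Ea / Y)) at 2.
    apply Rmult_le_compat_l; [left; now apply Rdiv_lt_0_compat|].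
    rewrite <- Rinv_1. apply Rinv_le_contravar; lra. }
  set (E4 := Rpower y (1 - delta / 14 - alpha) * Lam / (delta ^ 3 * Y)).
  assert (B4 : edge_const * Lam / delta * exp ((1 - alpha - delta / 12) * Y)
      * ln (1 + Lam / (delta / 12 - (1 - alpha))) <= 8820 * edge_const * E4).
  { pose proof log_factor_le as LF.
    replace (8820 * edge_const * E4) with (edge_const * Lam / delta *
      (8820 * (exp ((1 - delta / 14 - alpha) * Y) / (delta * delta * Y)))).
    - rewrite Rmult_assoc. apply Rmult_le_compat_l; [|exact LF].
      apply Rdiv_le_0_compat; [|lra]. nra.
    - unfold E4, Rpower. fold Y. field. lra. }
  assert (HE1 : 0 <= E1) by (assert (0 < Ea / Y) by (now apply Rdiv_lt_0_compat); lra).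
  assert (HE4 : 0 <= E4).
  { apply Rdiv_le_0_compat.
    - apply Rmult_le_pos; [left; apply exp_pos | lra].
    - apply Rmult_lt_0_compat; [simpl; apply Rmult_lt_0_compat; nra | exact Y1]. }
  replace (3 * INR m * Ea / Lam) with (3 * INR m * (Ea / Lam)) by (field; lra).
  assert (B5 : 3 * INR m * (Ea / Lam) <= 3 * INR m * (4 * E1)) by (apply Rmult_le_compat_l; lra).
  unfold error_const.
  assert (0 <= edge_const * E1) by nra. assert (0 <= edge_const * E4) by nra.
  assert (0 <= INR m * E1) by nra. assert (0 <= INR m * E4) by nra.
  assert (0 <= (1728 * INR m + 288 * edge_const + 4 + 144 * (8820 * edge_const)) * E2) by nra.
  assert (0 <= (1728 * INR m + 288 * edge_const + 4 + 144 * (8820 * edge_const)) * E3) by nra.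
  lra.
Qed.

End Approximation.

End ZeroFreeRegion.

Lemma natCpow_1 (p : nat) : is_prime p -> natCpow p (RtoC 1) = RtoC (INR p).
Proof.
  intros Hp. apply is_prime_ge_2, le_INR in Hp. simpl in Hp.
  unfold natCpow, Cexp. apply injective_projections; simpl.
  - replace (1 * ln (INR p) - 0 * 0) with (ln (INR p)) by ring.
    replace (1 * 0 + 0 * ln (INR p)) with 0 by ring. rewrite cos_0, exp_ln by lra. ring.
  - replace (1 * 0 + 0 * ln (INR p)) with 0 by ring. rewrite sin_0. ring.
Qed.

Lemma prime_sum_at_1 (m : nat) (c : nat -> nat -> C) (y : R) :
  sum_primes_le y (fun p => d_coef m c p 1 / RtoC (INR p))%C =
  sum_primes_le y (fun p => d_coef m c p 1 / natCpow p (RtoC 1))%C.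
Proof.
  apply sum_n_m_ext. intros p. unfold at_primes0. destruct prime_dec as [Hp|Hp]; [|reflexivity].
  now rewrite natCpow_1.
Qed.

Theorem theorem3 :
  forall (m : nat) (gamma1 gamma2 A : R),
    (1 <= m)%nat -> 0 < gamma1 -> 0 < gamma2 ->
  exists K : R,
  forall (c : nat -> nat -> C) (N : nat) (delta sigmaL : R) (L logL : C -> C),
    (forall j p : nat, (1 <= j <= m)%nat -> is_prime p -> Cmod (c j p) <= 1) ->
    (16 <= N)%nat ->
    0 < delta < 7 / 2 ->
    (forall s : C, 1 < Re s -> is_euler_product m c s (L s)) ->
    (* (i) *)
    1 / 2 <= sigmaL < 1 ->
    delta < 7 * (1 - sigmaL) ->
    holomorphic_on (half_plane sigmaL) L ->
    (* (ii) *)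
    (forall s : C, D_region delta N s -> L s <> RtoC 0) ->
    (* (iii) *)
    (forall s : C, sigmaL < Re s < 4 ->
       Cmod (L s)
       <= A * (Rpower (INR N) gamma1 * Rpower (1 + Rabs (Im s)) gamma2)) ->
    is_log_branch m c (D_region delta N) L logL ->
    (forall alpha y : R,
       1 - delta / 28 < alpha < 2 - delta / 7 ->
       Rpower (ln (INR N)) (14 / delta) <= y <= Rpower (INR N) (2 * PI / 5) ->
       Cmod (logL (RtoC alpha)
             - (sum_primes_le y (fun p => d_coef m c p 1 / natCpow p (RtoC alpha))
                + C_const m c alpha))%C
       <= K *
          (Rpower y (1 - alpha) / ((2 - alpha) ^ 2 * ln y)
           + (ln (INR N)) ^ 2
             / (ln (ln (INR N)) * Rpower (ln (INR N)) (14 / delta))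
           + Rpower y (1 + delta / 14) * Rpower (ln (INR N)) (delta / 14 + 3 / 2)
             / (delta ^ 2 * Rpower (INR N) (PI / 2))
           + Rpower y (1 - delta / 14 - alpha) * ln (INR N)
             / (delta ^ 3 * ln y)))
    /\
    (forall y : R,
       Rpower (ln (INR N)) (14 / delta) <= y <= Rpower (INR N) (2 * PI / 5) ->
       Cmod (logL (RtoC 1)
             - (sum_primes_le y (fun p => d_coef m c p 1 / RtoC (INR p))
                + C_const m c 1))%C
       <= K *
          (1 / ln y
           + (ln (INR N)) ^ 2
             / (ln (ln (INR N)) * Rpower (ln (INR N)) (14 / delta))
           + Rpower y (1 + delta / 14) * Rpower (ln (INR N)) (delta / 14 + 3 / 2)
             / (delta ^ 2 * Rpower (INR N) (PI / 2))
           + ln (INR N) / (delta ^ 3 * Rpower y (delta / 14) * ln y))).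
Proof.
  intros m gamma1 gamma2 A Hm Hg1 Hg2. exists (error_const m gamma1 gamma2 A).
  intros c N delta sigmaL L logL Hc HN Hd _ _ HsL _ _ Hgrowth Hbranch.
  (* The conclusion is left to unification: it agrees with that of [approximation] up to unfolding
     [sum_primes_le] and [prime_term]. *)
  assert (Main : forall alpha y : R, 1 - delta / 28 < alpha < 2 - delta / 7 ->
    Rpower (ln (INR N)) (14 / delta) <= y <= Rpower (INR N) (2 * PI / 5) -> _)
    by (intros alpha y Ha Hy; exact (approximation m gamma1 gamma2 A c N delta sigmaL L logL
      Hg1 Hg2 Hc HN Hd HsL Hgrowth Hbranch alpha y Hm Ha Hy)).
  split; [exact Main|].
  (* [alpha = 1] is admissible because [delta < 7 / 2] gives [1 < 2 - delta / 7]; what remains is to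
     simplify the first and last error terms. *)
  intros y Hy. specialize (Main 1 y ltac:(lra) Hy).
  rewrite prime_sum_at_1.
  eapply Rle_trans; [exact Main|]. right. f_equal. f_equal; [f_equal; f_equal|].
  - replace (1 - 1) with 0 by ring. replace ((2 - 1) ^ 2 * ln y) with (ln y) by ring.
    f_equal. unfold Rpower. rewrite Rmult_0_l. apply exp_0.
  - replace (1 - delta / 14 - 1) with (- (delta / 14)) by field. rewrite Rpower_Ropp.
    pose proof (exp_pos (delta / 14 * ln y)) as P. fold (Rpower y (delta / 14)) in P.
    unfold Rdiv. rewrite !Rinv_mult. ring.
Qed.
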